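(* Let $d\ge1$ and let $\mu\in\mathcal{P}(\mathbb{R}^d)\cap L^\infty(\mathbb{R}^d)$ be compactly supported. Fix a nonnegative probability density $\theta\in C_c^\infty(\mathbb{R}^d)$. For $a\in\mathbb{R}^d$ let $\rho_{a,t}$ be the solution of $\partial_t\rho-\operatorname{div}(\rho\nabla g*(\rho-\mu))=0$ with initial datum $\rho_{0,a}=\theta(\cdot-a)$. There is no function $\gamma:[0,\infty)\to(0,\infty)$ with $\gamma(t)\to0$ as $t\to\infty$ such that, for every $a\in\mathbb{R}^d$, $$\mathrm{MMD}^2(\rho_{a,t},\mu)\le\gamma(t)\,\mathrm{MMD}^2(\rho_{0,a},\mu)\qquad\text{for every }t\ge0.$$
   Context: $\mathcal{P}(\mathbb{R}^d)$ is the set of Borel probability measures, identified with densities when absolutely continuous. $g$ is the Coulomb kernel on $\mathbb{R}^d$: $g(x)=-\frac12|x|$ for $d=1$, $g(x)=-\frac1{2\pi}\log|x|$ for $d=2$, $g(x)=\frac1{(d-2)\sigma_d}|x|^{2-d}$ for $d\ge3$, $\sigma_d=|\mathbb{S}^{d-1}|$. $\mathrm{MMD}^2(\rho,\mu):=\frac12\int g*(\rho-\mu)\,d(\rho-\mu)$. The solution with initial datum $\rho_0\in\mathcal{P}\cap L^\infty$ is the unique global weak solution in $L^\infty_{\mathrm{loc}}([0,\infty);L^\infty(\mathbb{R}^d))$ (taken narrowly continuous in time), i.e. the unique curve $\rho:[0,\infty)\to\mathcal{P}(\mathbb{R}^d)$ in that class such that, with $v_t=-\nabla g*(\rho_t-\mu)$,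 for every $T>0$ and every $\varphi\in C_c^\infty([0,T)\times\mathbb{R}^d)$: $\int_0^T\int(\partial_t\varphi+v_t\cdot\nabla\varphi)\,d\rho_t\,dt+\int\varphi(0,x)\,d\rho_0(x)=0$. *)

(* Defs.v *)
From HB Require Import structures.
From mathcomp Require Import all_boot all_order all_algebra.
From mathcomp Require Import all_classical all_reals all_analysis.
From mathcomp Require Import measurable_realfun ess_sup_inf.

Set Implicit Arguments.
Unset Strict Implicit.
Unset Printing Implicit Defensive.

Import Order.TTheory GRing.Theory Num.Theory.
Import numFieldNormedType.Exports.

Local Open Scope classical_set_scope.
Local Open Scope ring_scope.

(* R^d is 'rV[R]_d with the library topology (the one of the max norm, which is
   the Euclidean one) and its Borel sigma-algebra. *)

HB.instance Definition _ (R : realType) (m n : nat) :=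
  @isMeasurable.Build (sigma_display (@open 'M[R]_(m, n)))
    'M[R]_(m, n) <<s @open 'M[R]_(m, n) >>
    (@sigma_algebra0 _ setT _) (@sigma_algebraC _ _)
    (@sigma_algebra_bigcup _ setT _).

Section borel_mx.
Context {R : realType}.

Lemma open_measurable_mx m n (U : set 'M[R]_(m, n)) : open U -> measurable U.
Proof. by move=> oU; exact: sub_sigma_algebra. Qed.

Lemma continuous_measurable_mx m n (f : 'M[R]_(m, n) -> R) :
  continuous f -> measurable_fun setT f.
Proof.
move=> /continuousP cf.
apply: (measurability _ (RGenOpens.measurableE R)) => _ [_ [a [b ->]] <-].
by rewrite setTI; apply: open_measurable_mx; apply: cf; exact: interval_open.
Qed.

Lemma measurable_coord_mx m n (i : 'I_m) (j : 'I_n) :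
  measurable_fun setT (fun x : 'M[R]_(m, n) => x i j).
Proof. by apply: continuous_measurable_mx; exact: coord_continuous. Qed.

Lemma measurable_fun_mx d (T : measurableType d) m n (f : T -> 'M[R]_(m, n)) :
  (forall i j, measurable_fun setT (fun t => f t i j)) -> measurable_fun setT f.
Proof.
move=> mf.
pose idx := {ffun 'I_m * 'I_n -> rat * rat}.
pose box (q : idx) : set 'M[R]_(m, n) :=
  [set x | forall ij, ratr (q ij).1 < x ij.1 ij.2 < ratr (q ij).2].
apply: (@measurability _ _ _ _ _ _ (@open 'M[R]_(m, n))) => // _ [U oU <-].
rewrite setTI.
have -> : f @^-1` U = \bigcup_(q in [set: idx])
    (if `[< box q `<=` U >] then f @^-1` box q else set0).
  apply/seteqP; split=> t /=; last first.
    by move=> [q _]; case: asboolP => // qU /qU.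
  move=> Uft.
  have /nbhs_ballP[e /= e0 eU] : nbhs (f t) U by exact: open_nbhs_nbhs.
  have lo i j : exists q : rat, f t i j - e < ratr q < f t i j.
    have /rat_in_itvoo[q] : f t i j - e < f t i j by rewrite ltrBlDr ltrDl.
    by rewrite in_itv/= => ?; exists q.
  have hi i j : exists q : rat, f t i j < ratr q < f t i j + e.
    have /rat_in_itvoo[q] : f t i j < f t i j + e by rewrite ltrDl.
    by rewrite in_itv/= => ?; exists q.
  pose q : idx := [ffun ij =>
    (projT1 (cid (lo ij.1 ij.2)), projT1 (cid (hi ij.1 ij.2)))].
  have qP ij : [/\ f t ij.1 ij.2 - e < ratr (q ij).1,
      ratr (q ij).1 < f t ij.1 ij.2, f t ij.1 ij.2 < ratr (q ij).2 &
      ratr (q ij).2 < f t ij.1 ij.2 + e].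
    rewrite ffunE/=; case: (cid (lo _ _)) => a /= /andP[? ?].
    by case: (cid (hi _ _)) => b /= /andP[? ?].
  exists q => //; case: asboolP => [_ ij|]; first by have [_ -> ->] := qP ij.
  case=> x qx; apply: eU; split=> // i j.
  have [/= q1 q2 q3 q4] := qP (i, j); have /andP[/= x1 x2] := qx (i, j).
  rewrite /ball/= ltr_norml; apply/andP; split.
    by rewrite ltrBrDl ltrBlDr; apply: lt_trans x2 _.
  by rewrite ltrBlDr -ltrBlDl; apply: lt_trans x1.
apply: countable_bigcupT_measurable => [|q]; first exact: countableP.
case: ifPn => // _.
have -> : f @^-1` box q = \bigcap_(ij in [set: 'I_m * 'I_n])
    (fun t => f t ij.1 ij.2) @^-1` `]ratr (q ij).1, ratr (q ij).2[%classic.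
  apply/seteqP; split=> t /=.
    by move=> qt ij _; rewrite /= in_itv/=; exact: qt.
  by move=> qt ij; have := qt ij I; rewrite /= in_itv.
apply: fin_bigcap_measurable => [|ij _]; first exact: finite_finset.
rewrite -[X in measurable X]setTI.
exact: (mf ij.1 ij.2).
Qed.

End borel_mx.

Section lebesgue_rV.
Context {R : realType}.

Definition cons_rV (n : nat) (p : R * 'rV[R]_n) : 'rV[R]_n.+1 :=
  row_mx (p.1)%:M p.2.

Lemma measurable_cons_rV n : measurable_fun setT (@cons_rV n).
Proof.
apply: measurable_fun_mx => i j; rewrite /cons_rV.
rewrite -(@splitK 1 n j); case: (@fintype.split 1 n j) => k /=.
  rewrite (_ : (fun _ => _) = fst); last first.
    apply/funext => p; apply: (etrans (row_mxEl _ _ _ _)).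
    by rewrite mxE !ord1 eqxx.
  exact: measurable_fst.
rewrite (_ : (fun _ => _) = (fun x : 'rV[R]_n => x i k) \o snd); last first.
  by apply/funext => p; exact: row_mxEr.
exact: (measurableT_comp (measurable_coord_mx i k)).
Qed.

Definition uncons_rV (n : nat) (x : 'rV[R]_n.+1) : R * 'rV[R]_n :=
  (@lsubmx R 1 1 n x 0 0, @rsubmx R 1 1 n x).

Lemma cons_rVK n : cancel (@cons_rV n) (@uncons_rV n).
Proof.
by move=> [a y]; rewrite /cons_rV /uncons_rV row_mxKl row_mxKr mxE eqxx.
Qed.

Lemma uncons_rVK n : cancel (@uncons_rV n) (@cons_rV n).
Proof.
by move=> x; rewrite /cons_rV /uncons_rV/= -mx11_scalar hsubmxK.
Qed.

Lemma measurable_uncons_rV n : measurable_fun setT (@uncons_rV n).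
Proof.
apply: measurable_fun_pair.
  rewrite (_ : (fun _ => _) = (fun x : 'rV[R]_n.+1 => x 0 (@lshift 1 n 0))).
    exact: (@measurable_coord_mx R 1 n.+1).
  by apply/funext => x; rewrite mxE.
apply: measurable_fun_mx => i j.
rewrite (_ : (fun _ => _) = (fun x : 'rV[R]_n.+1 => x i (@rshift 1 n j))).
  exact: (@measurable_coord_mx R 1 n.+1).
by apply/funext => x; rewrite mxE.
Qed.

Section step.
Variables (n : nat) (m : {sigma_finite_measure set 'rV[R]_n -> \bar R}).

Definition lebesgue_rV_succ : set 'rV[R]_n.+1 -> \bar R :=
  pushforward (lebesgue_measure \x m)%E (@cons_rV n).

Let succ0 : lebesgue_rV_succ set0 = 0%E.
Proof. by rewrite /lebesgue_rV_succ /pushforward preimage_set0 measure0. Qed.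

Let succ_ge0 A : (0 <= lebesgue_rV_succ A)%E.
Proof. by rewrite /lebesgue_rV_succ /pushforward measure_ge0. Qed.

Let succ_sigma_additive : semi_sigma_additive lebesgue_rV_succ.
Proof.
have mf (A : set 'rV[R]_n.+1) : measurable A -> measurable (@cons_rV n @^-1` A).
  by move=> mA; rewrite -[X in measurable X]setTI; exact: measurable_cons_rV.
move=> F mF tF mUF; rewrite /lebesgue_rV_succ /pushforward preimage_bigcup.
apply: measure_semi_sigma_additive => [k||].
- exact: mf.
- apply/trivIsetP => /= i j _ _ ij; rewrite -preimage_setI.
  by move/trivIsetP : tF => /(_ _ _ _ _ ij) ->//; rewrite preimage_set0.
- by rewrite -preimage_bigcup; exact: mf.
Qed.

HB.instance Definition _ := isMeasure.Build _ _ _ lebesgue_rV_succ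
  succ0 succ_ge0 succ_sigma_additive.

Let succ_sigma_finite : sigma_finite setT lebesgue_rV_succ.
Proof.
have [F FT Foo] : sigma_finite setT (lebesgue_measure \x m)%E.
  have /sigma_finiteP[F [TF ndF Foo]] := sigma_finiteT (@lebesgue_measure R).
  have /sigma_finiteP[G [TG ndG Goo]] := sigma_finiteT m.
  exists (fun k => F k `*` G k).
    rewrite -setXTT TF TG predeqE => -[x y]; split.
      move=> [/= [i _ Fix] [j _ Gjy]]; exists (maxn i j) => //; split.
      - by move: x Fix; exact/subsetPset/ndF/leq_maxl.
      - by move: y Gjy; exact/subsetPset/ndG/leq_maxr.
    by move=> [i _ []/= ? ?]; split; exists i.
  move=> k; have [? ?] := Foo k; have [? ?] := Goo k.
  split; first exact: measurableX.
  by rewrite product_measure1E// lte_mul_pinfty// ge0_fin_numE.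
exists (fun k => @uncons_rV n @^-1` F k).
  by rewrite -preimage_bigcup -FT preimage_setT.
move=> k; have [mF Fk] := Foo k; split.
  by rewrite -[X in measurable X]setTI; exact: measurable_uncons_rV.
rewrite /lebesgue_rV_succ /pushforward (_ : _ @^-1` _ = F k)//.
by apply/funext => p; rewrite /preimage/= cons_rVK.
Qed.

HB.instance Definition _ := Measure_isSigmaFinite.Build _ _ _ lebesgue_rV_succ
  succ_sigma_finite.

End step.

Fixpoint lebesgue_rV (n : nat) : {sigma_finite_measure set 'rV[R]_n -> \bar R} :=
  match n with
  | 0 => \d_(0 : 'rV[R]_0)
  | k.+1 => lebesgue_rV_succ (lebesgue_rV k)
  end.

End lebesgue_rV.

Section calculus.
Context {R : realType}.

(* All directional derivatives up to order k exist everywhere and are continuous;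
   in finite dimension this is the class C^k. *)
Fixpoint class_C (k : nat) (V : normedModType R) (f : V -> R) : Prop :=
  continuous f /\
  if k is k'.+1 then
    forall v, (forall x, derivable f x v) /\ class_C k' (fun x => 'D_v f x)
  else True.

Definition smooth (V : normedModType R) (f : V -> R) : Prop :=
  forall k, class_C k f.

Definition tsupport (V : topologicalType) (f : V -> R) : set V :=
  closure [set x | f x != 0].

Definition grad d (f : 'rV[R]_d -> R) (x : 'rV[R]_d) : 'rV[R]_d :=
  \row_i 'D_(delta_mx 0 i) f x.

Definition dot d (x y : 'rV[R]_d) : R := \sum_i x 0 i * y 0 i.

Definition enorm d (x : 'rV[R]_d) : R := Num.sqrt (dot x x).

End calculus.

Section densities.
Context {R : realType} {d : nat}.
Implicit Type m : probability 'rV[R]_d R.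

Definition is_density m (f : 'rV[R]_d -> R) : Prop :=
  [/\ measurable_fun setT f, forall x, 0 <= f x &
      forall A, measurable A ->
        m A = (\int[lebesgue_rV d]_(x in A) (f x)%:E)%E].

Definition Linfty_le m (M : R) : Prop :=
  exists2 f, is_density m f & ('N[lebesgue_rV d]_+oo[EFin \o f] <= M%:E)%E.

Definition compactly_supported m : Prop :=
  exists2 K : set 'rV[R]_d, compact K & m (~` K) = 0%E.

End densities.

Section coulomb.
Context {R : realType}.

(* |S^(d-1)| = d |B(0,1)|, i.e. the surface measure of a part A of the sphere is
   d times the volume of the cone {r x | x in A, 0 <= r <= 1}. *)
Definition sphere_area (d : nat) : R :=
  d%:R * fine (lebesgue_rV d [set x : 'rV[R]_d | enorm x <= 1]).

(* The value at the origin is irrelevant: it only matters on a null set for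
   measures with a density. *)
Definition coulomb (d : nat) (x : 'rV[R]_d) : R :=
  match d with
  | 1 => - (enorm x / 2)
  | 2 => - ((2 * pi)^-1 * ln (enorm x))
  | _ => ((d - 2)%N%:R * sphere_area d)^-1 * enorm x ^- (d - 2)
  end.

Context {d : nat}.
Implicit Types rho mu : probability 'rV[R]_d R.

(* g * (rho - mu) *)
Definition potential rho mu (x : 'rV[R]_d) : \bar R :=
  (\int[rho]_y (coulomb (x - y))%:E - \int[mu]_y (coulomb (x - y))%:E)%E.

Definition MMD2 rho mu : \bar R :=
  (2^-1%:E * (\int[rho]_x potential rho mu x - \int[mu]_x potential rho mu x))%E.

(* - (grad g) * (rho - mu) *)
Definition velocity rho mu (x : 'rV[R]_d) : 'rV[R]_d :=
  - \row_i (\int[rho]_y grad (@coulomb d) (x - y) 0 i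
            - \int[mu]_y grad (@coulomb d) (x - y) 0 i).

End coulomb.

Section weak_solution.
Context {R : realType} {d : nat}.

(* Curves [0, oo) -> P(R^d) are functions on R of which only the restriction to
   t >= 0 is used. *)
Implicit Type rho : R -> probability 'rV[R]_d R.

Definition narrowly_continuous rho : Prop :=
  forall f : 'rV[R]_d -> R, continuous f -> (exists M, forall x, `|f x| <= M) ->
    {within `[0, +oo[, continuous (fun t => \int[rho t]_x f x)}.

Definition Linfty_loc rho : Prop :=
  forall T : R, 0 < T -> exists M : R,
    \forall t \ae (@lebesgue_measure R), 0 <= t <= T -> Linfty_le (rho t) M.

(* C_c^oo([0, T) x R^d): restrictions to t >= 0 of smooth functions on R x R^d
   with compact support in (-oo, T) x R^d. *)
Definition test_function (T : R) (phi : R * 'rV[R]_d -> R) : Prop :=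
  [/\ smooth phi, compact (tsupport phi) &
      tsupport phi `<=` [set p | p.1 < T]].

Definition weak_solution (mu rho0 : probability 'rV[R]_d R) rho : Prop :=
  [/\ narrowly_continuous rho, Linfty_loc rho &
      forall T : R, 0 < T -> forall phi, test_function T phi ->
        \int[lebesgue_measure]_(t in `[0, T])
          (\int[rho t]_x
            (derive1 (fun s => phi (s, x)) t
             + dot (velocity (rho t) mu x) (grad (fun y => phi (t, y)) x)))
        + \int[rho0]_x phi (0, x) = 0].

End weak_solution.

(* Main.v *)
Require Import Defs.
From mathcomp Require Import all_boot all_order all_algebra.
From mathcomp Require Import all_classical all_reals all_analysis.
From mathcomp Require Import measurable_realfun ess_sup_inf ring lra.

(** In a fixed time the mass moves on average by an amount bounded uniformly in
    its initial position, whereas a decay rate uniform in a would force even the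
    most distant data to lose almost all of their discrepancy by then.

    Bound on the displacement. Formally the discrepancy dissipates the integral
    of |v|^2, and an observable phi with |grad phi| <= 1 grows at the rate of the
    integral of v . grad phi, so that the sum of both grows at most at the rate
    1 / 4. This bounds the first moment about a at time t in terms of t and of
    the energies, that is, of bounds on the densities of mu and of the datum,
    not of a. As a narrowly continuous weak solution need not satisfy an energy
    identity, the argument is run on the functional lyapunov, in which the
    Coulomb kernel is truncated to a smooth compactly supported one. Its
    increments over short times are those of a linear functional, to which the
    weak formulation applies, and the square is completed pointwise in
    lyapunov_increment, at the price of a larger constant growth_rate. The
    truncation scale depends on the density of the solution, but neither that
    constant nor the bound on the energies does, whence moment_bound; taking
    truncations of |x - a| for phi gives weak_solution_confined.

    Comparison at a distance. Let |a| = l be large. The solution at a fixed time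
    has all but a small part of its mass at distance of order l from mu, like the
    datum itself, so that interaction_far evaluates its interaction with mu by
    the size of the kernel at that distance. In dimension 1 the discrepancies at
    both times are of order l. In dimension 2 they are of order ln l. In
    dimension at least 3 the initial one is bounded and the later one is at least
    about half of the positive self energy of mu. So relative_gap provides a
    constant k0 > 0 such that at any given time, for a suitable a, the discrepancy
    exceeds k0 times a bound on the initial one; and k0 bounds gamma from below
    at almost every time, which excludes that gamma tends to 0. *)

Set Implicit Arguments.
Unset Strict Implicit.
Unset Printing Implicit Defensive.

Import Order.TTheory GRing.Theory Num.Theory.
Import numFieldNormedType.Exports.

Local Open Scope classical_set_scope.
Local Open Scope ring_scope.

(** * Functions of class C^k *)

Section class_C_theory.
Context {R : realType}.
Implicit Types U V : normedModType R.

(** Directional derivatives reduce to derivatives of functions of one real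
    variable, for which the chain rule is at hand. *)
Lemma is_derive_line V (f : V -> R) x v df :
  is_derive x v f df <-> is_derive (0 : R) 1 (fun h : R => f (h *: v + x)) df.
Proof.
have E : (fun h : R => h^-1 *: ((f \o shift x) (h *: v) - f x)) =
    (fun h : R => h^-1 *: (((fun h => f (h *: v + x)) \o shift 0) (h *: 1) -
                            f (0 *: v + x))).
  by apply/funext => h /=; rewrite addr0 scale0r add0r [_%:A]mulr1.
split => -[dx <-]; apply: DeriveDef; by rewrite /derivable /derive ?E// -E.
Qed.

Lemma is_derive_affine U V (A L : U -> V) (f : V -> R) x v df :
  (forall (h : R) v x, A (h *: v + x) = h *: L v + A x) ->
  is_derive (A x) (L v) f df -> is_derive x v (f \o A) df.
Proof.
move=> AL /is_derive_line fd; apply/is_derive_line.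
by rewrite (_ : (fun _ => _) = (fun h : R => f (h *: L v + A x)))//;
  apply/funext => h /=; rewrite AL.
Qed.

Lemma is_derive_comp1 V (h : R -> R) (f : V -> R) x v dh df :
  is_derive (f x) 1 h dh -> is_derive x v f df ->
  is_derive x v (h \o f) (dh * df).
Proof.
move=> hd /is_derive_line fd; apply/is_derive_line.
have hd' : is_derive (f (0 *: v + x)) 1 h dh by rewrite scale0r add0r.
have := @is_derive1_comp R h (fun t : R => f (t *: v + x)) 0 dh df hd' fd.
by [].
Qed.

Lemma class_C0 V k (f : V -> R) : class_C k f -> continuous f.
Proof. by case: k => [|k] []. Qed.

Lemma class_CS V k (f : V -> R) : class_C k.+1 f -> class_C k f.
Proof.
elim: k f => [|k IH] f [cf Df]; split=> // v.
by have [fv Dv] := Df v; split=> //; exact: IH.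
Qed.

Lemma class_C_is_derive V k (f : V -> R) x v :
  class_C k.+1 f -> is_derive x v f ('D_v f x).
Proof. by move=> [_ /(_ v)[+ _]] => /(_ x) ?; exact: derivableP. Qed.

Lemma class_C_derive V k (f : V -> R) v :
  class_C k.+1 f -> class_C k (fun x => 'D_v f x).
Proof. by move=> [_ /(_ v)[]]. Qed.

(** The shape in which every closure property below is proved: exhibiting the
    derivatives is enough, since they determine the operator D. *)
Lemma class_C_step V k (f : V -> R) (g : V -> V -> R) : continuous f ->
  (forall x v, is_derive x v f (g v x)) -> (forall v, class_C k (g v)) ->
  class_C k.+1 f.
Proof.
move=> cf fg Cg; split=> // v; split=> [x|]; first by have [] := fg x v.
rewrite (_ : (fun x => _) = g v)//; apply/funext => x.
by have fgx := fg x v; rewrite derive_val.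
Qed.

Lemma class_C_cst V k (c : R) : class_C k (fun _ : V => c).
Proof.
elim: k c => [|k IH] c; first by split=> // x; exact: cst_continuous.
by apply: (@class_C_step _ _ _ (fun _ _ => 0)) => // x; exact: cst_continuous.
Qed.

Lemma class_CD V k (f g : V -> R) :
  class_C k f -> class_C k g -> class_C k (fun x => f x + g x).
Proof.
elim: k f g => [|k IH] f g Cf Cg.
  by split=> // x; apply: cvgD; [exact: (class_C0 Cf)|exact: (class_C0 Cg)].
apply: (@class_C_step _ _ _ (fun v x => 'D_v f x + 'D_v g x)).
- by move=> x; apply: cvgD; [exact: (class_C0 Cf)|exact: (class_C0 Cg)].
- move=> x v; have := class_C_is_derive x v Cf; have := class_C_is_derive x v Cg.
  by move=> ? ?; exact: is_deriveD.
- by move=> v; apply: IH; exact: class_C_derive.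
Qed.

Lemma class_CM V k (f g : V -> R) :
  class_C k f -> class_C k g -> class_C k (fun x => f x * g x).
Proof.
elim: k f g => [|k IH] f g Cf Cg.
  by split=> // x; apply: cvgM; [exact: (class_C0 Cf)|exact: (class_C0 Cg)].
apply: (@class_C_step _ _ _ (fun v x => f x * 'D_v g x + g x * 'D_v f x)).
- by move=> x; apply: cvgM; [exact: (class_C0 Cf)|exact: (class_C0 Cg)].
- move=> x v; have := class_C_is_derive x v Cf; have := class_C_is_derive x v Cg.
  by move=> ? ?; exact: is_deriveM.
- by move=> v; apply: class_CD; apply: IH; rewrite //;
    first [exact: class_C_derive | exact: class_CS].
Qed.

Lemma class_C_affine U V k (A L : U -> V) (f : V -> R) :
  (forall (h : R) v x, A (h *: v + x) = h *: L v + A x) -> continuous A ->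
  class_C k f -> class_C k (f \o A).
Proof.
move=> AL cA; elim: k f => [|k IH] f Cf.
  by split=> // x; apply: continuous_comp; [exact: cA|exact: (class_C0 Cf)].
apply: (@class_C_step _ _ _ (fun v => (fun x => 'D_(L v) f x) \o A)).
- by move=> x; apply: continuous_comp; [exact: cA|exact: (class_C0 Cf)].
- move=> x v; apply: is_derive_affine => //; exact: class_C_is_derive Cf.
- by move=> v; apply: IH; exact: class_C_derive.
Qed.

Lemma class_C_comp V k (h : R -> R) (f : V -> R) :
  class_C k h -> class_C k f -> class_C k (h \o f).
Proof.
elim: k h f => [|k IH] h f Ch Cf.
  by split=> // x; apply: continuous_comp; [exact: (class_C0 Cf)|exact: (class_C0 Ch)].
apply: (@class_C_step _ _ _ (fun v x => ((fun y => 'D_1 h y) \o f) x * 'D_v f x)).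
- by move=> x; apply: continuous_comp; [exact: (class_C0 Cf)|exact: (class_C0 Ch)].
- by move=> x v; apply: is_derive_comp1; apply: class_C_is_derive; eassumption.
- move=> v; apply: class_CM; last exact: class_C_derive.
  by apply: IH; [exact: class_C_derive|exact: class_CS].
Qed.

Lemma class_C_linear V k (f : V -> R) :
  (forall (h : R) v x, f (h *: v + x) = h * f v + f x) -> continuous f ->
  class_C k f.
Proof.
move=> fl cf; case: k => [|k]; first by split.
apply: (@class_C_step _ _ _ (fun v _ => f v)) => // [x v|v]; last exact: class_C_cst.
have -> : f = (id : R -> R) \o f by [].
by apply: (@is_derive_affine V R f f) => //; exact: is_derive_id.
Qed.

Lemma class_C_sum V k (I : Type) (r : seq I) (f : I -> V -> R) :
  (forall i, class_C k (f i)) -> class_C k (fun x => \sum_(i <- r) f i x).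
Proof.
move=> Cf; elim: r => [|i r IH].
  rewrite (_ : (fun _ => _) = (fun=> 0)); first exact: class_C_cst.
  by apply/funext => x; rewrite big_nil.
rewrite (_ : (fun _ => _) = (fun x => f i x + \sum_(j <- r) f j x)).
  exact: class_CD.
by apply/funext => x; rewrite big_cons.
Qed.

End class_C_theory.

Section real_smooth.
Context {R : realType}.
Implicit Types f F h : R -> R.

Lemma is_derive_real f (x v df : R) : is_derive (x : R) 1 f df -> is_derive x v f (v * df).
Proof.
move=> fd; apply/is_derive_line.
have hd : is_derive (0 : R) 1 (fun h : R => h *: v + x) v.
  have d1 : is_derive (0 : R) 1 (fun h : R => h *: v) v.
    have := @is_deriveM R R^o id (cst v) 0 1 1 0 (is_derive_id _ _) (is_derive_cst _ _ _).
    by rewrite /= scaler0 add0r [_ *: _]mulr1.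
  have := @is_deriveD R R^o R^o (fun h : R => h *: v) (cst x) 0 1 v 0 d1 (is_derive_cst _ _ _).
  by rewrite addr0.
have fd' : is_derive ((0 : R) *: v + x) 1 f df by rewrite scale0r add0r.
by rewrite mulrC; exact: (@is_derive1_comp R f (fun h : R => h *: v + x)).
Qed.

Lemma is_derive_continuous f g : (forall x, is_derive (x : R) 1 f (g x)) -> continuous f.
Proof.
move=> fg x; apply/differentiable_continuous/derivable1_diffP.
by have [] := fg x.
Qed.

Lemma is_derive_affine1 (k e x : R) : is_derive x 1 (fun y : R => k * y + e) k.
Proof.
have dk := @is_deriveZ R R^o R^o id k x 1 1 (is_derive_id _ _).
have := @is_deriveD R R^o R^o _ (cst e) x 1 _ 0 dk (is_derive_cst _ _ _).
by rewrite addr0 [_%:A]mulr1.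
Qed.

Lemma smooth_affine1 (k e : R) : smooth (fun y : R^o => k * y + e).
Proof.
move=> j; apply: class_CD; last exact: class_C_cst.
apply: class_CM; first exact: class_C_cst.
by apply: class_C_linear => // x; exact: cvg_id.
Qed.

Lemma class_C_step1 k f g : (forall x, is_derive (x : R) 1 f (g x)) ->
  class_C k g -> class_C k.+1 f.
Proof.
move=> fg Cg; apply: (@class_C_step R R^o k f (fun v x => v * g x)).
- exact: is_derive_continuous fg.
- by move=> x v; exact: is_derive_real.
- by move=> v; apply: class_CM => //; exact: class_C_cst.
Qed.

Lemma is_derive_ndecr f g (x y : R) : x <= y ->
  (forall z : R, x <= z <= y -> is_derive (z : R) 1 f (g z)) ->
  (forall z, x <= z <= y -> 0 <= g z) -> f x <= f y.
Proof.
move=> xy fg g0; apply: (@ger0_derive1_ndecr _ f x y) => //.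
- by move=> z /[!in_itv]/= /andP[xz zy]; have [] := fg z; rewrite ?(ltW xz) ?ltW.
- move=> z /[!in_itv]/= /andP[/ltW xz /ltW zy].
  have {}xzy : x <= z <= y by rewrite xz.
  by rewrite derive1E; have fgz := fg _ xzy; rewrite derive_val g0.
- apply: derivable_within_continuous => z /[!in_itv]/= xzy.
  by have [] := fg _ xzy.
Qed.

(** As f vanishes up to a, the integral from a - 1 is an antiderivative on the
    whole line. *)
Lemma antiderivative f a : continuous f -> (forall x, x <= a -> f x = 0) ->
  exists F, (forall x, is_derive (x : R) 1 F (f x)) /\ forall x, x <= a -> F x = 0.
Proof.
move=> cf f0.
pose F x := \int[lebesgue_measure]_(t in `[a - 1, x]) f t.
have F0 x : x <= a -> F x = 0.
  move=> xa; rewrite /F (@eq_Rintegral _ _ _ _ _ (cst 0)).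
    by rewrite Rintegral_cst// mul0r.
  by move=> t /[!inE]/= /[!in_itv]/= /andP[_ tx]; rewrite f0// (le_trans tx).
exists F; split=> // x.
have [xa|ax] := ltP x a.
  rewrite f0 ?ltW//.
  apply: (@near_eq_is_derive R R^o R^o (cst 0)).
    near=> y; rewrite F0//; apply: ltW; near: y; exact: lt_nbhsl.
have xx1 : x < x + 1 by rewrite ltrDl.
have a1x : a - 1 < x by rewrite ltrBlDr (le_lt_trans ax)// ltrDl.
have intf : lebesgue_measure.-integrable `[a - 1, x + 1] (EFin \o f).
  apply: continuous_compact_integrable; first exact: segment_compact.
  exact: continuous_subspaceT.
have [dF] := continuous_FTC1_closed xx1 intf a1x (cf x).
by rewrite derive1E => <-; exact: derivableP.
Unshelve. all: end_near. Qed.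
End real_smooth.

(** * Smooth steps *)

Section smooth_step.
Context {R : realType}.

Lemma compact_norm_le (V : normedModType R) (K : set V) : compact K ->
  exists2 A : R, 0 < A & forall x, K x -> `|x| <= A.
Proof.
move=> /compact_bounded[M [_ KM]]; exists (`|M| + 1); first by rewrite ltr_wpDl.
by move=> x Kx; apply: KM Kx; rewrite (le_lt_trans (ler_norm _))// ltrDl.
Qed.

Lemma coord_norm_le d (x : 'rV[R]_d) i : `|x 0 i| <= `|x|.
Proof.
by rewrite [leRHS]mx_normrE; exact: (le_bigmax _ (fun i => `|x i.1 i.2|) (0, i)).
Qed.

Lemma norm_le_coord d (x : 'rV[R]_d) (e : R) : 0 <= e ->
  (forall i, `|x 0 i| <= e) -> `|x| <= e.
Proof.
move=> e0 xe; rewrite [leLHS]mx_normrE; apply/bigmax_leP; split=> // -[i j] _ /=.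
by rewrite ord1.
Qed.

Lemma compact_norm_ball d (r : R) : compact [set x : 'rV[R]_d | `|x| <= r].
Proof.
apply: bounded_closed_compact.
  exists r; split; first exact: num_real.
  by move=> M rM x /= /le_trans; apply; exact: ltW.
apply: (@closed_comp _ _ (fun x : 'rV[R]_d => `|x|) [set y | y <= r]).
  by move=> x _; exact: norm_continuous.
exact: closed_le.
Qed.

Lemma tsupport_neq0 (V : topologicalType) (f : V -> R) x :
  f x != 0 -> tsupport f x.
Proof. by move=> ?; exact: subset_closure. Qed.

Definition smooth_step (S dS : R -> R) :=
  [/\ smooth (S : R^o -> R) /\ smooth (dS : R^o -> R),
      forall x : R, is_derive x 1 S (dS x), forall x, 0 <= dS x,
      forall x, x <= 0 -> S x = 0 & forall x, 1 <= x -> S x = 1].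

Section monotone.
Variables (S dS : R -> R).
Hypothesis SdS : smooth_step S dS.

Lemma smooth_step_ndecr x y : x <= y -> S x <= S y.
Proof. by case: SdS => _ dSE dS0 _ _ xy; exact: (@is_derive_ndecr R S dS). Qed.

Lemma smooth_step01 x : 0 <= S x <= 1.
Proof.
case: SdS => _ _ _ S0 S1; have [x0|x0] := leP x 0; first by rewrite S0// lexx ler01.
have [x1|x1] := leP 1 x; first by rewrite S1// lexx ler01.
rewrite -{1}(S0 0 (lexx _)) smooth_step_ndecr ?(ltW x0)//=.
by rewrite -(S1 1 (lexx _)) smooth_step_ndecr ?(ltW x1).
Qed.

End monotone.

(** The step is the normalised primitive of the bump h. *)
Lemma smooth_step_bump (h : R -> R) (A : R) : 0 < A ->
  smooth (h : R^o -> R) -> (forall s, 0 <= h s) -> 0 < h 0 ->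
  (forall s, h s != 0 -> `|s| <= A) -> exists S dS, smooth_step S dS.
Proof.
move=> A0 Ch h0 h00 hA.
have hz s : A < `|s| -> h s = 0.
  by move=> As; apply/eqP/negPn/negP => /hA; rewrite leNgt As.
have ch : continuous h by exact: (class_C0 (Ch 0%N)).
have [|F [dF F0]] := @antiderivative R h (- (A + 1)) ch.
  move=> x xA; apply: hz; rewrite ltr0_norm; lra.
have F_nd x y : x <= y -> F x <= F y.
  by move=> xy; exact: (@is_derive_ndecr R F h).
have Fcst x : A + 1 <= x -> F x = F (A + 1).
  move=> Ax; apply/eqP; rewrite eq_le (F_nd _ _ Ax) andbT -lerN2.
  apply: (@is_derive_ndecr R (fun y => - F y) (fun y => - h y)) => // z /andP[Az _].
  by rewrite hz ?oppr0// (lt_le_trans _ (ler_norm _))// (lt_le_trans _ Az)// ltrDl.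
(* Otherwise F, being nondecreasing, would be constant near 0, against
   0 < h 0. *)
have Z0 : 0 < F (A + 1).
  have /F_nd : - (A + 1) <= A + 1 by lra.
  rewrite F0// le_eqVlt => /predU1P[Z0|//]; exfalso.
  have : is_derive (0 : R) 1 F 0.
    apply: (@near_eq_is_derive R R^o R^o (cst 0)).
    near=> y; apply/esym/eqP; rewrite eq_le; apply/andP; split.
      rewrite /cst Z0; apply: F_nd; apply: ltW; near: y; apply: lt_nbhsl; lra.
    rewrite /cst -(F0 _ (lexx _)); apply: F_nd; apply: ltW; near: y.
    by apply: lt_nbhsr; lra.
  move=> [_ d0]; have [_] := dF 0; rewrite d0 => h00'.
  by move: h00; rewrite -h00' ltxx.
pose Z := F (A + 1); pose B := A + 1.
(* The interval [- B, B] that contains the support is rescaled to [0, 1]. *)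
exists (fun x => Z^-1 * F (2 * B * x - B)).
exists (fun x => Z^-1 * (h (2 * B * x - B) * (2 * B))).
have CF : smooth (F : R^o -> R) by move=> k; exact/class_CS/(class_C_step1 dF).
have Cl := smooth_affine1 (2 * B) (- B).
have dl := is_derive_affine1 (2 * B) (- B).
split; first split.
- move=> k; apply: class_CM; first exact: class_C_cst.
  exact: (class_C_comp (CF k) (Cl k)).
- move=> k; apply: class_CM; first exact: class_C_cst.
  apply: class_CM; last exact: class_C_cst.
  exact: (class_C_comp (Ch k) (Cl k)).
- move=> x.
  have dFl := @is_derive_comp1 R R^o F _ _ 1 _ _ (dF _) (dl x).
  exact: (@is_deriveZ R R^o R^o _ Z^-1 x 1 _ dFl).
- by move=> x; rewrite !mulr_ge0// ?invr_ge0 ?(ltW Z0)// /B addr_ge0// ltW.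
- move=> x x0; rewrite F0 ?mulr0// /B.
  have : 2 * (A + 1) * x <= 0 by rewrite mulr_ge0_le0//; lra.
  lra.
- move=> x x1; rewrite Fcst ?mulVf ?gt_eqF// -/B.
  have : 2 * B <= 2 * B * x by rewrite ler_peMr//; rewrite /B; lra.
  lra.
Unshelve. all: end_near. Qed.

(** A smooth bump is given: theta, nonzero somewhere since its integral is 1.
    Its restriction to a line is the bump h required above. *)
Lemma smooth_step_exists d (theta : 'rV[R]_d.+1 -> R) :
  smooth theta -> compact (tsupport theta) -> (forall x, 0 <= theta x) ->
  (\int[lebesgue_rV d.+1]_x (theta x)%:E = 1)%E ->
  exists S dS : R -> R, smooth_step S dS.
Proof.
move=> Ct /compact_norm_le[A A0 tA] t0 t1.
have [x0 tx0] : exists x0, theta x0 != 0.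
  apply: contrapT => /forallNP tz; move: t1.
  rewrite (eq_integral (cst 0%E)); last first.
    by move=> x _; have /negP/negPn/eqP -> := tz x.
  by rewrite integral0 => /eqP; rewrite eq_sym onee_eq0.
pose e : 'rV[R]_d.+1 := delta_mx 0 0.
pose l (s : R^o) := s *: e + x0.
have lE (s : R) : (l s) 0 0 = s + x0 0 0 by rewrite !mxE eqxx mulr1.
have cl : continuous l.
  by move=> s; apply: cvgD; [apply: cvgZl; exact: cvg_id|exact: cvg_cst].
apply: (@smooth_step_bump (theta \o l) (A + `|x0|)).
- by rewrite ltr_pwDl.
- move=> k; apply: (@class_C_affine R R^o _ k l (fun v => v *: e)) => //.
  by move=> h v x; rewrite /l scalerDl scalerA addrA.
- by move=> s; exact: t0.
- by rewrite /= /l scale0r add0r lt0r tx0 t0.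
- move=> s /= /tsupport_neq0 /tA lA.
  have -> : s = (l s) 0 0 - x0 0 0 by rewrite lE addrK.
  by rewrite (le_trans (ler_normB _ _))// lerD// (le_trans (coord_norm_le _ _)).
Qed.
End smooth_step.

(** * Radial profiles *)

Section profile.
Context {R : realType}.

(** The power is singular only at 0, where eta vanishes; its derivative has the
    same form with the exponent r - 1, so that the regularity k is arbitrary. *)
Lemma class_C_powR_cut k (r a : R) (eta : R -> R) : 0 < a ->
  smooth (eta : R^o -> R) -> (forall u, u < a -> eta u = 0) ->
  class_C k (fun u : R^o => u `^ r * eta u).
Proof.
move=> a0; elim: k r eta => [|k IH] r eta Ce e0; last first.
  apply: (class_C_step1
    (g := fun u => r * (u `^ (r - 1) * eta u) + u `^ r * 'D_1 (eta : R^o -> R) u)).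
    move=> u; have [ua|au] := ltP u a.
      rewrite e0//; have -> : 'D_1 (eta : R^o -> R) u = 0.
        rewrite (@near_eq_derive R R^o R^o eta (cst 0)) ?oner_eq0//.
          exact: derive_cst.
        by near=> y; rewrite e0//; near: y; exact: lt_nbhsl.
      rewrite !mulr0 add0r.
      apply: (@near_eq_is_derive R R^o R^o (cst 0)).
      by near=> y; rewrite e0 ?mulr0//; near: y; exact: lt_nbhsl.
    have u0 : 0 < u by exact: lt_le_trans au.
    have d1 := is_derive1_powR r u0.
    have d2 := class_C_is_derive (V := R^o) u 1 (Ce 1%N).
    have d12 := @is_deriveM R R ((@powR R)^~ r) eta u 1 _ _ d1 d2.
    apply: (is_derive_eq d12).
    by rewrite /GRing.scale/=; ring.
  apply: class_CD; last first.
    apply: IH => [j|u ua]; first exact: (class_C_derive (V := R^o) _ (Ce j.+1)).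
    rewrite (@near_eq_derive R R^o R^o eta (cst 0)) ?oner_eq0//.
      exact: derive_cst.
    by near=> y; rewrite e0//; near: y; exact: lt_nbhsl.
  by apply: class_CM; [exact: class_C_cst|exact: IH].
split=> // u; have [ua|au] := ltP u a.
  apply: (@cvg_trans _ ((cst 0 : R -> R) @ u)); last first.
    by rewrite e0// mulr0; exact: (@cst_continuous R R 0).
  apply: near_eq_cvg.
  by near=> y; rewrite e0 ?mulr0//; near: y; exact: lt_nbhsl.
have cp : {for u, continuous ((@powR R)^~ r)}.
  apply/differentiable_continuous/derivable1_diffP.
  by have [] := is_derive1_powR r (lt_le_trans a0 au).
by apply: cvgM; [exact: cp|exact: (class_C0 (Ce 0%N))].
Unshelve. all: end_near. Qed.

Lemma powR_sqrtN (u : R) p : 0 < u -> u `^ (- (p%:R / 2)) = Num.sqrt u ^- p.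
Proof.
by move=> u0; rewrite powRN -powR12_sqrt ?ltW// -powR_mulrn ?powR_ge0// -powRrM mulrC.
Qed.

(** Both functions are evaluated at the squared norm, which is smooth. Hence the
    factor 1 / 2: for a <= |x|^2 <= b the function P (|x|^2) has gradient
    x / |x|^p, like a power or the logarithm of the norm, but it is smooth
    everywhere and constant near 0 and near infinity. *)
Definition radial_profile (p : nat) (a b : R) (P f : R -> R) :=
  [/\ smooth (P : R^o -> R) /\ smooth (f : R^o -> R),
      forall x : R, is_derive x 1 P (f x),
      (forall x, 0 <= f x) /\ forall x, 0 < x -> f x <= 2^-1 * Num.sqrt x ^- p,
      forall x, a <= x <= b -> f x = 2^-1 * Num.sqrt x ^- p &
      (forall x, x <= a / 2 -> P x = 0) /\ forall x, b + 1 <= x -> f x = 0].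

Lemma radial_profile_exists (S dS : R -> R) p (a b : R) : smooth_step S dS -> 0 < a ->
  exists P f, radial_profile p a b P f.
Proof.
move=> SdS a0; have [[CS _] _ _ Sle0 Sge1] := SdS.
have S01 := smooth_step01 SdS.
pose eta u := S (2 / a * u - 1) * (1 - S (u - b)).
have eta_lt u : u <= a / 2 -> eta u = 0.
  move=> ua; rewrite /eta Sle0 ?mul0r// subr_le0 mulrAC ler_pdivrMr// mul1r.
  by rewrite -ler_pdivlMl// mulrC.
have Ceta : smooth (eta : R^o -> R).
  move=> k; apply: class_CM; first exact: (class_C_comp (CS k) (smooth_affine1 _ _ k)).
  apply: class_CD; first exact: class_C_cst.
  rewrite (_ : (fun _ => _) = (fun u => -1 * S (1 * u - b))); last first.
    by apply/funext => u; rewrite mulN1r mul1r.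
  apply: class_CM; first exact: class_C_cst.
  exact: (class_C_comp (CS k) (smooth_affine1 _ _ k)).
have eta01 u : 0 <= eta u <= 1.
  have /andP[s0 s1] := S01 (2 / a * u - 1); have /andP[t0 t1] := S01 (u - b).
  by rewrite /eta mulr_ge0 ?subr_ge0//= mulr_ile1 ?subr_ge0// lerBlDr lerDl.
pose f u := 2^-1 * (u `^ (- (p%:R / 2)) * eta u).
have Cf : smooth (f : R^o -> R).
  move=> k; apply: class_CM; first exact: class_C_cst.
  apply: (@class_C_powR_cut _ _ (a / 2)) => //; first by rewrite divr_gt0.
  by move=> u /ltW; exact: eta_lt.
have f0 x : x <= a / 2 -> f x = 0 by move=> xa; rewrite /f eta_lt// !mulr0.
have [P [dP P0]] := antiderivative (class_C0 (Cf 0%N)) f0.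
exists P, f; split => //.
- by split=> // k; exact/class_CS/(class_C_step1 dP).
- split=> x => [|x0].
    have /andP[e0 _] := eta01 x.
    by rewrite /f mulr_ge0 ?invr_ge0// mulr_ge0 ?powR_ge0.
  have /andP[_ e1] := eta01 x.
  by rewrite /f powR_sqrtN// ler_pM2l ?invr_gt0// ler_piMr.
- move=> x /andP[ax xb]; rewrite /f powR_sqrtN ?(lt_le_trans a0)//.
  rewrite /eta Sge1 ?Sle0 ?subr_le0 ?subr0 ?mulr1//.
  by rewrite lerBrDr mulrAC ler_pdivlMr//; lra.
- split=> // x bx; rewrite /f /eta (Sge1 (x - b)) ?subrr ?mulr0//.
  by rewrite lerBrDr addrC.
Qed.

Section bounds.
Variables (p : nat) (a b : R) (P f : R -> R).
Hypothesis Pf : radial_profile p a b P f.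

Lemma radial_profile_ndecr x y : x <= y -> P x <= P y.
Proof. by case: Pf => _ dP [f0 _] _ _ xy; exact: (@is_derive_ndecr R P f). Qed.

Lemma radial_profile_cst x : b + 1 <= x -> P x = P (b + 1).
Proof.
case: Pf => _ dP _ _ [_ f0] bx.
apply/eqP; rewrite eq_le (radial_profile_ndecr bx) andbT -lerN2.
apply: (@is_derive_ndecr R (fun y => - P y) (fun y => - f y)) => // z /andP[bz _].
by rewrite f0// oppr0.
Qed.

(** On [s, t] the density f is at most (sqrt s)^-(p - 1) times the derivative of
    the square root. The bound is uniform in the cutoff a. *)
Lemma radial_profile_tail s t : (0 < p)%N -> 0 < s -> s <= t ->
  P t - P s <= Num.sqrt t * Num.sqrt s ^- p.-1.
Proof.
case: Pf => _ dP [_ fle] _ _ p0 s0 st.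
pose k := Num.sqrt s ^- p.-1.
have k0 : 0 <= k by rewrite invr_ge0 exprn_ge0// sqrtr_ge0.
suff : k * Num.sqrt s - P s <= k * Num.sqrt t - P t.
  have : 0 <= k * Num.sqrt s by rewrite mulr_ge0// sqrtr_ge0.
  rewrite -/k (mulrC (Num.sqrt t)); lra.
apply: (@is_derive_ndecr R (fun u => k * Num.sqrt u - P u)
  (fun u => k * (2 * Num.sqrt u)^-1 - f u)) => // u /andP[su _].
  have d1 := is_derive1_sqrt (lt_le_trans s0 su).
  have d2 := @is_deriveZ R R^o R^o _ k u 1 _ d1.
  exact: (@is_deriveB R R^o R^o _ _ u 1 _ _ d2 (dP u)).
have u0 := lt_le_trans s0 su.
rewrite subr_ge0 (le_trans (fle _ u0))// invfM mulrCA ler_pM2l ?invr_gt0//.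
rewrite -{1}(prednK p0) exprS invfM mulrC ler_wpM2r ?invr_ge0 ?sqrtr_ge0//.
rewrite /k lef_pV2 ?posrE ?exprn_gt0 ?sqrtr_gt0//.
by apply: lerXn2r; rewrite ?nnegrE ?sqrtr_ge0// ler_sqrt// ltW.
Qed.

Lemma radial_profile_ge0 x : 0 < a -> 0 <= P x.
Proof.
case: Pf => _ _ _ _ [P0 _] a0.
rewrite -(P0 (Num.min x (a / 2))) ?ge_min ?lexx ?orbT//.
by apply: radial_profile_ndecr; rewrite ge_min lexx.
Qed.

End bounds.

(** For the exponent p = 1 the profile is a truncation of the distance. *)
Lemma radial_profile1_le (a b : R) P f x : radial_profile 1 a b P f -> 0 < a ->
  0 <= x -> P x <= Num.sqrt x.
Proof.
move=> Pf a0; case: (Pf) => _ _ _ _ [P0 _] x0.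
have [xa|ax] := leP x (a / 2); first by rewrite P0// sqrtr_ge0.
have a20 : 0 < a / 2 by rewrite divr_gt0.
have := radial_profile_tail Pf (ltn0Sn 0) a20 (ltW ax).
by rewrite /= expr0 invr1 mulr1 (P0 _ (lexx _)) subr0.
Qed.

Lemma radial_profile1_ge (b : R) P f x : radial_profile 1 1 b P f ->
  1 <= x <= b -> Num.sqrt x - 1 <= P x.
Proof.
move=> Pf; have := radial_profile_ge0 Pf 1 ltr01; case: Pf => _ dP _ fE _.
move=> P1 /andP[x1 xb].
suff : P 1 - Num.sqrt 1 <= P x - Num.sqrt x by rewrite sqrtr1; lra.
apply: (@is_derive_ndecr R (fun u => P u - Num.sqrt u)
  (fun u => f u - (2 * Num.sqrt u)^-1)) => // u /andP[u1 ux].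
  have d1 := is_derive1_sqrt (lt_le_trans ltr01 u1).
  exact: (@is_deriveB R R^o R^o _ _ u 1 _ _ (dP u) d1).
by rewrite fE ?u1 ?(le_trans ux)// expr1 invfM subrr.
Qed.

End profile.

(** * The Coulomb force *)

Section euclid.
Context {R : realType}.
Implicit Types d : nat.

Lemma dotC d (x y : 'rV[R]_d) : dot x y = dot y x.
Proof. by apply: eq_bigr => i _; rewrite mulrC. Qed.

Lemma dotDl d (x y z : 'rV[R]_d) : dot (x + y) z = dot x z + dot y z.
Proof. by rewrite -big_split; apply: eq_bigr => i _; rewrite mxE mulrDl. Qed.

Lemma dotDr d (x y z : 'rV[R]_d) : dot z (x + y) = dot z x + dot z y.
Proof. by rewrite !(dotC z) dotDl. Qed.

Lemma dotZl d (k : R) (x z : 'rV[R]_d) : dot (k *: x) z = k * dot x z.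
Proof. by rewrite mulr_sumr; apply: eq_bigr => i _; rewrite mxE mulrA. Qed.

Lemma dot_delta d (x : 'rV[R]_d) i : dot x (delta_mx 0 i) = x 0 i.
Proof.
rewrite /dot (bigD1 i)//= mxE !eqxx mulr1 big1 ?addr0// => j ji.
by rewrite mxE (negbTE ji) mulr0.
Qed.

Lemma dot_ge0 d (x : 'rV[R]_d) : 0 <= dot x x.
Proof. by apply: sumr_ge0 => i _; rewrite -expr2 sqr_ge0. Qed.

Lemma enorm_ge0 d (x : 'rV[R]_d) : 0 <= enorm x.
Proof. exact: sqrtr_ge0. Qed.

Lemma enormN d (x : 'rV[R]_d) : enorm (- x) = enorm x.
Proof. by congr Num.sqrt; apply: eq_bigr => i _; rewrite !mxE mulrNN. Qed.

Lemma norm_le_enorm d (x : 'rV[R]_d) : `|x| <= enorm x.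
Proof.
apply: norm_le_coord => [|i]; first exact: enorm_ge0.
rewrite -(@ler_pXn2r _ 2) ?nnegrE ?enorm_ge0// sqr_sqrtr ?dot_ge0// real_normK ?num_real//.
rewrite /dot (bigD1 i)//= -expr2 lerDl; apply: sumr_ge0 => j _.
by rewrite -expr2 sqr_ge0.
Qed.

Lemma enorm_le_norm d (x : 'rV[R]_d) : enorm x <= d%:R * `|x|.
Proof.
rewrite -(@ler_pXn2r _ 2) ?nnegrE ?enorm_ge0 ?mulr_ge0//.
rewrite sqr_sqrtr ?dot_ge0//; case: d x => [|d] x; first by rewrite /dot big_ord0 sqr_ge0.
apply: (@le_trans _ _ (\sum_(i < d.+1) `|x| ^+ 2)).
  apply: ler_sum => i _; rewrite -expr2 -real_normK ?num_real//.
  by rewrite lerXn2r ?nnegrE ?coord_norm_le.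
rewrite sumr_const card_ord -[leLHS]mulr_natl exprMn ler_wpM2r ?sqr_ge0//.
by rewrite expr2 ler_peMl// ler1n.
Qed.

Lemma enorm_eq0 d (x : 'rV[R]_d) : (enorm x == 0) = (x == 0).
Proof.
apply/eqP/eqP => [x0|->].
  by apply/eqP; rewrite -normr_eq0 eq_le normr_ge0 andbT -x0 norm_le_enorm.
by apply/eqP; rewrite eq_le enorm_ge0 andbT (le_trans (enorm_le_norm _))// normr0 mulr0.
Qed.

Lemma enorm0 d : enorm (0 : 'rV[R]_d) = 0.
Proof. by apply/eqP; rewrite enorm_eq0. Qed.

Lemma enorm_gt0 d (x : 'rV[R]_d) : (0 < enorm x) = (x != 0).
Proof. by rewrite lt0r enorm_eq0 enorm_ge0 andbT. Qed.

Lemma is_derive_dot d (x v : 'rV[R]_d) :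
  is_derive x v (fun x => dot x x) (2 * dot x v).
Proof.
apply/is_derive_line.
rewrite (_ : (fun _ => _) = (fun h : R =>
   (dot v v * h + 2 * dot x v) * h + dot x x)); last first.
  apply/funext => h; rewrite !dotDl !dotDr !dotZl !(dotC _ (h *: _)) !dotZl (dotC v x).
  ring.
have d2 := @is_deriveM R R^o _ _ 0 1 _ _ (is_derive_affine1 (dot v v) (2 * dot x v) 0)
  (is_derive_id _ _).
have := @is_deriveD R R^o R^o _ (cst (dot x x)) 0 1 _ 0 d2 (is_derive_cst _ _ _).
rewrite addr0 mulr0 add0r scale0r addr0 [_%:A]mulr1.
exact.
Qed.

Lemma smooth_dot d : smooth (fun x : 'rV[R]_d => dot x x).
Proof.
move=> k; apply: class_C_sum => i.
by apply: class_CM; apply: class_C_linear; first [exact: coord_continuous |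
    by move=> h v x; rewrite !mxE].
Qed.

Lemma smooth_radial d (P : R -> R) : smooth (P : R^o -> R) ->
  smooth (fun x : 'rV[R]_d => P (dot x x)).
Proof. by move=> CP k; exact: (class_C_comp (CP k) (@smooth_dot d k)). Qed.

Lemma is_derive_radial d (P : R -> R) (x v : 'rV[R]_d) dP :
  is_derive (dot x x : R) 1 P dP ->
  is_derive x v (fun x => P (dot x x)) (dP * (2 * dot x v)).
Proof.
by move=> ?; exact: (@is_derive_comp1 _ _ P (fun x => dot x x) x v _ _ _ (is_derive_dot x v)).
Qed.

Lemma is_derive_translate d (f : 'rV[R]_d -> R) (x a v : 'rV[R]_d) df :
  is_derive (x - a) v f df -> is_derive x v (fun x => f (x - a)) df.
Proof.
apply: (@is_derive_affine _ _ _ (fun x => x - a) id).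
by move=> h w y /=; rewrite addrA.
Qed.

Lemma is_derive_reflect d (f : 'rV[R]_d -> R) (x a v : 'rV[R]_d) df :
  is_derive (a - x) (- v) f df -> is_derive x v (fun x => f (a - x)) df.
Proof.
apply: (@is_derive_affine _ _ _ (fun x => a - x) -%R).
by move=> h w y /=; rewrite opprD scalerN addrCA.
Qed.

Lemma grad_is_derive d (f : 'rV[R]_d -> R) x i df :
  is_derive x (delta_mx 0 i) f df -> grad f x 0 i = df.
Proof. by move=> H; rewrite mxE derive_val. Qed.

Lemma smooth_translate d (f : 'rV[R]_d -> R) a : smooth f ->
  smooth (fun x => f (x - a)).
Proof.
move=> Cf k; apply: (@class_C_affine _ _ _ k (fun x => x - a) id) => //.
  by move=> h w y /=; rewrite addrA.
by move=> x; apply: (@continuousB _ _ _ id (fun=> a)) => //; exact: cst_continuous.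
Qed.

Lemma smooth_reflect d (f : 'rV[R]_d -> R) a : smooth f ->
  smooth (fun x => f (a - x)).
Proof.
move=> Cf k; apply: (@class_C_affine _ _ _ k (fun x => a - x) -%R) => //.
  by move=> h w y /=; rewrite opprD scalerN addrCA.
by move=> x; apply: (@continuousB _ _ _ (fun=> a) id) => //; exact: cst_continuous.
Qed.

(** The constant of the force, -grad g(x) = c x / |x|^d. *)
Definition force_cst d : R :=
  match d with 1 => 2^-1 | 2 => (2 * pi)^-1 | _ => (sphere_area d)^-1 end.

Definition force d (z : 'rV[R]_d) i : R := force_cst d * (z 0 i * enorm z ^- d).

(** In each of its three forms the kernel is a function of the squared norm. *)
Lemma grad_coulomb d (x : 'rV[R]_d) i : x != 0 ->
  grad (@coulomb R d) x 0 i = - force x i.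
Proof.
move=> x0; apply: grad_is_derive.
have u0 : 0 < dot x x by move: x0; rewrite -enorm_gt0 sqrtr_gt0.
have n0 : Num.sqrt (dot x x) != 0 by rewrite gt_eqF// sqrtr_gt0.
have ds := is_derive1_sqrt u0.
rewrite -[delta_mx _ _]/(delta_mx 0 i).
have E : dot x (delta_mx 0 i) = x 0 i by exact: dot_delta.
rewrite /force /enorm -E.
move: (delta_mx 0 i) => v.
move: d x i x0 u0 n0 ds {E} v => [|[|[|d]]] x i x0 u0 n0 ds v.
- by case: i => [].
- rewrite (_ : @coulomb R 1 = (fun x => (fun u => - 2^-1 * Num.sqrt u) (dot x x))).
    have d1 := @is_deriveZ R R^o R^o _ (- 2^-1) (dot x x) 1 _ ds.
    apply: (is_derive_eq (@is_derive_radial _ _ x v _ d1)).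
    by rewrite /GRing.scale/=; field.
  by apply/funext => y; rewrite /coulomb /enorm mulNr mulrC.
- rewrite (_ : @coulomb R 2 = (fun x => (fun u => - (2 * pi)^-1 * ln (Num.sqrt u)) (dot x x))).
    have s0 : 0 < Num.sqrt (dot x x) by rewrite sqrtr_gt0.
    have dl := @is_derive1_comp R _ _ _ _ _ (is_derive1_ln s0) ds.
    have d1 := @is_deriveZ R R^o R^o _ (- (2 * pi)^-1) (dot x x) 1 _ dl.
    apply: (is_derive_eq (@is_derive_radial _ _ x v _ d1)).
    rewrite /GRing.scale/= /force_cst.
    move: (@pi R) (pi_gt0 R) => p p0.
    by field; rewrite n0 gt_eqF.
  by apply/funext => y; rewrite /coulomb /enorm mulNr.
- pose s := @sphere_area R d.+3.
  rewrite (_ : @coulomb R d.+3 =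
    (fun x => (fun u => ((d.+1)%:R * s)^-1 * (Num.sqrt u ^+ d.+1)^-1) (dot x x))); last first.
    by apply/funext => y.
  have dX := @is_deriveX R R^o _ d.+1 (dot x x) 1 _ ds.
  rewrite exprfctE in dX.
  have nX : (Num.sqrt (dot x x)) ^+ d.+1 != 0 by rewrite expf_neq0.
  have dV := @is_deriveV R (fun u => Num.sqrt u ^+ d.+1) _ _ _ nX dX.
  have d1 := @is_deriveZ R R^o R^o _ (((d.+1)%:R * s)^-1) (dot x x) 1 _ dV.
  apply: (is_derive_eq (@is_derive_radial _ _ x v _ d1)).
  rewrite /GRing.scale/= /force_cst -/s.
  rewrite !exprS expr0 !mulr1.
  have [->|s0] := eqVneq s 0; first by rewrite mulr0 !invr0 !mul0r oppr0.
  have D0 : (d.+1)%:R != 0 :> R by rewrite pnatr_eq0.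
  have t0 : Num.sqrt (dot x x) ^+ d != 0 by rewrite expf_neq0.
  move: D0 t0 n0; move: (Num.sqrt (dot x x) ^+ d) => y.
  move: (Num.sqrt (dot x x)) ((d.+1)%:R) => t D D0 y0 t0.
  by field; rewrite t0 s0 y0 D0.
Qed.

End euclid.

(** * Measures with a bounded density *)

Section measure_rV.
Context {R : realType}.
Local Open Scope ereal_scope.

Lemma measurable_ball_rV n (x : 'rV[R]_n) r : measurable (ball x r).
Proof. by apply: open_measurable_mx; exact: ball_open. Qed.

Lemma cons_rVEl n (p : R * 'rV[R]_n) i (k : 'I_1) :
  cons_rV p i (@lshift 1 n k : 'I_n.+1) = p.1.
Proof. by apply: (etrans (row_mxEl _ _ _ _)); rewrite mxE !ord1 eqxx. Qed.

Lemma cons_rVEr n (p : R * 'rV[R]_n) i k :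
  cons_rV p i (@rshift 1 n k : 'I_n.+1) = p.2 i k.
Proof. exact: (etrans (row_mxEr _ _ _ _)). Qed.

(** The balls are cubes, since the norm is the maximum of the coordinates. *)
Lemma lebesgue_rV_ball n (x : 'rV[R]_n) (r : R) : (0 < r)%R ->
  lebesgue_rV n (ball x r) = ((2 * r) ^+ n)%:E.
Proof.
move=> r0; elim: n x => [|n IH] x.
  rewrite /= diracE mem_set//; split=> // i; by case.
rewrite /= /lebesgue_rV_succ /pushforward.
rewrite (_ : _ @^-1` _ = ball (x ord0 ord0) r `*` ball (@rsubmx R 1 1 n x) r).
  rewrite product_measure1E//; [|exact: measurable_ball|exact: measurable_ball_rV].
  transitivity ((r *+ 2)%:E * ((2 * r) ^+ n)%:E).
    by congr (_ * _); [exact: (lebesgue_measure_ball _ (ltW r0))|exact: IH].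
  by rewrite -EFinM exprS mulr_natl.
have l0 : @lshift 1 n ord0 = ord0 :> 'I_n.+1 by apply/val_inj.
apply/seteqP; split=> [p [_ xp]|p /= [xa [_ xy]]].
  split=> /=; first by have := xp ord0 (@lshift 1 n ord0); rewrite cons_rVEl l0.
  by split=> // i j; have := xp i (@rshift 1 n j); rewrite cons_rVEr mxE.
split=> // i j; rewrite -(@splitK 1 n j); case: (@fintype.split 1 n j) => k /=.
  by rewrite cons_rVEl !ord1 l0.
by rewrite cons_rVEr; have := xy i k; rewrite mxE.
Qed.

(** The only trace of a bounded density that the estimates use. *)
Definition ball_regular n (m : probability 'rV[R]_n R) (K : R) :=
  forall (x : 'rV[R]_n) (r : R), (0 < r)%R -> m (ball x r) <= (K * r ^+ n)%:E.

Lemma Linfty_le_regular n (m : probability 'rV[R]_n R) M : Linfty_le m M ->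
  ball_regular m (Num.max M 0 * 2 ^+ n)%R.
Proof.
move=> [f [mf f0 mE] fM].
have : \forall x \ae lebesgue_rV n, (f x)%:E <= M%:E.
  move: fM; rewrite unlock.
  have leb0 : 0 < lebesgue_rV n [set: 'rV[R]_n].
    have b0 : 0 < lebesgue_rV n (ball (0%R : 'rV[R]_n) 1%R).
      by rewrite lebesgue_rV_ball// lte_fin exprn_gt0// mulr1.
    apply: (lt_le_trans b0); apply: le_measure; rewrite ?inE//.
    exact: measurable_ball_rV.
  rewrite leb0.
  move=> /ess_supP; apply: filterS => x /=; rewrite lee_fin; apply: le_trans.
  exact: ler_norm.
move=> fMae x r r0; rewrite mE; last exact: measurable_ball_rV.
apply: (@le_trans _ _ (\int[lebesgue_rV n]_(y in ball x r) (Num.max M 0)%:E)).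
  apply: ae_ge0_le_integral => //.
  - exact: measurable_ball_rV.
  - by move=> y _; rewrite lee_fin.
  - by apply/measurable_EFinP; exact: measurable_funS mf.
  - by move=> y _; rewrite lee_fin le_max lexx orbT.
  - move: fMae; apply: filterS => y; rewrite !lee_fin => fy _.
    by rewrite le_max fy.
rewrite integral_cst; last exact: measurable_ball_rV.
rewrite (_ : _ * _ = (Num.max M 0)%:E * ((2 * r) ^+ n)%:E).
  by rewrite -EFinM lee_fin exprMn mulrA.
by congr (_ * _); exact: lebesgue_rV_ball.
Qed.

Lemma measurable_norm_rV n : measurable_fun setT (fun z : 'rV[R]_n => `|z|%R).
Proof. by apply: continuous_measurable_mx; exact: norm_continuous. Qed.

Lemma measurable_funV d (T : measurableType d) D (f : T -> R) :
  (forall x, 0 <= f x)%R -> measurable_fun D f ->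
  measurable_fun D (fun x => (f x)^-1)%R.
Proof.
move=> f0 mf; rewrite (_ : (fun _ => _) = (fun x => f x `^ (-1))%R).
  exact: (measurableT_comp (@measurable_powR R (-1)%R) mf).
by apply/funext => x; rewrite powR_inv1.
Qed.

Lemma measurable_sub_rV n :
  measurable_fun setT (fun p : 'rV[R]_n * 'rV[R]_n => (p.1 - p.2)%R).
Proof.
apply: measurable_fun_mx => i j.
rewrite (_ : (fun _ => _) = (fun p : 'rV[R]_n * 'rV[R]_n => p.1 i j - p.2 i j)%R).
  apply: measurable_funB.
    exact: (measurableT_comp (measurable_coord_mx i j) measurable_fst).
  exact: (measurableT_comp (measurable_coord_mx i j) measurable_snd).
by apply/funext => p; rewrite !mxE.
Qed.

Lemma measurable_subl_rV n (x : 'rV[R]_n) :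
  measurable_fun setT (fun y : 'rV[R]_n => (x - y)%R).
Proof.
have mx : measurable_fun setT (fun y : 'rV[R]_n => (x, y)).
  by apply: measurable_fun_pair => //; exact: measurable_cst.
exact: (measurableT_comp (@measurable_sub_rV n) mx).
Qed.

Variable d : nat.
Notation V := 'rV[R]_d.+1.

(** Majorant of the force near its singularity. *)
Definition singular (e : R) (z : V) : R := (`|z| ^- d * (`|z| < e)%R%:R)%R.

Lemma singular_ge0 e z : (0 <= singular e z)%R.
Proof. by rewrite mulr_ge0// invr_ge0 exprn_ge0. Qed.

Lemma measurable_singular e : measurable_fun setT (singular e).
Proof.
apply: measurable_funM.
  apply: measurable_funV => [x|]; first by rewrite exprn_ge0.
  by apply: measurable_funX; exact: measurable_norm_rV.
rewrite (_ : (fun _ => _) = (fun z : V => if (`|z| < e)%R then 1%R else 0%R)).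
  apply: measurable_fun_ifT; [|exact: measurable_cst|exact: measurable_cst].
  apply: measurable_fun_ltr; last exact: measurable_cst.
  exact: measurable_norm_rV.
by apply/funext => z; case: ifP.
Qed.

(** Dyadic shells: the shell of radius 2^-k e has mass at most K (2^-k e)^(d+1),
    and the singularity is of order -d there. *)
Lemma integral_singular_le (m : probability V R) K e x :
  ball_regular m K -> (0 <= K)%R -> (0 < e)%R ->
  \int[m]_y (singular e (x - y))%:E <= (2 ^+ d.+1 * K * e)%:E.
Proof.
move=> mK K0 e0.
pose r k : R := (e / 2 ^+ k)%R.
have r0 k : (0 < r k)%R by rewrite divr_gt0// exprn_gt0.
pose F k y : \bar R := ((r k.+1) ^- d)%:E * (\1_(ball x (r k)) y)%:E.
have F0 k y : 0 <= F k y.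
  by rewrite /F -EFinM lee_fin mulr_ge0// invr_ge0 exprn_ge0 ?ltW.
have mF k : measurable_fun setT (F k).
  apply: emeasurable_funM; first exact: measurable_cst.
  by apply/measurable_EFinP/measurable_indic; exact: measurable_ball_rV.
apply: (@le_trans _ _ (\int[m]_y \sum_(k <oo) F k y)).
  apply: ge0_le_integral => //.
  - by move=> y _; rewrite lee_fin singular_ge0.
  - apply/measurable_EFinP/(measurableT_comp (measurable_singular e)).
    exact: measurable_subl_rV.
  - exact: ge0_emeasurable_sum.
  - move=> y _; rewrite /singular.
    have [ye|ye] := ltP `|x - y|%R e; last first.
      by rewrite mulr0; exact: nneseries_ge0.
    rewrite mulr1.
    suff [k Fk] : exists k, (`|x - y|%R ^- d)%:E <= F k y.
      apply: (le_trans Fk); apply: le_trans (nneseries_lim_ge k.+1 _) => //.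
      by rewrite big_nat_recr//= leeDr// sume_ge0.
    have in_ball k : (`|x - y| < r k)%R -> F k y = ((r k.+1) ^- d)%:E.
      move=> yk; rewrite /F indicE mem_set ?mule1//.
      by rewrite -ball_normE.
    have [xy|xy] := eqVneq x y.
      exists 0%N; rewrite in_ball xy subrr normr0; last by rewrite /r expr0 divr1.
      rewrite lee_fin; case: d => [|d']; first by rewrite !expr0 invr1 lexx.
      by rewrite expr0n/= invr0 invr_ge0 exprn_ge0// ltW.
    have n0 : (0 < `|x - y|)%R by rewrite normr_gt0 subr_eq0.
    have ex : exists k, (r k.+1 <= `|x - y|)%R.
      have h1 : (`|2^-1 : R| < 1)%R by rewrite ger0_norm// invf_lt1// ltr1n.
      have /cvgr0_norm_lt/(_ _ n0)[k _ /(_ k (leqnn _)) kP] := cvg_geometric e h1.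
      exists k; apply/ltW/(le_lt_trans _ kP).
      rewrite /geometric/= ger0_norm ?mulr_ge0 ?(ltW e0)// /r exprVn.
      rewrite ler_pM2l// lef_pV2 ?posrE ?exprn_gt0// exprS ler_peMl//.
      by rewrite ler1n.
    case: (ex_minnP ex) => k rk kmin; exists k.
    rewrite in_ball.
      rewrite lee_fin lef_pV2 ?posrE ?exprn_gt0// lerXn2r ?nnegrE// ltW//.
    case: k kmin {rk} => [|k] kmin; first by rewrite /r expr0 divr1.
    by rewrite ltNge; apply/negP => /kmin; rewrite ltnn.
rewrite integral_nneseries//.
apply: (@le_trans _ _ (\sum_(k <oo) ((2 ^+ d.+1 * K * e) / (2 ^ (k + 1))%:R)%:E)).
  apply: lee_nneseries => [k _ _|k _]; first exact: integral_ge0.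
  rewrite ge0_integralZl_EFin//; last 2 first.
  - by apply/measurable_EFinP/measurable_indic; exact: measurable_ball_rV.
  - by rewrite invr_ge0 exprn_ge0// ltW.
  rewrite integral_indic//; last exact: measurable_ball_rV.
  rewrite setIT; apply: (@le_trans _ _ ((r k.+1 ^- d)%:E * (K * r k ^+ d.+1)%:E)).
    by rewrite lee_wpmul2l ?mK// lee_fin invr_ge0 exprn_ge0// ltW.
  rewrite -EFinM lee_fin addn1 natrX.
  have -> : r k = (2 * r k.+1)%R.
    by rewrite /r exprS; field; rewrite expf_neq0.
  rewrite -mulrA -/(r k.+1); move: (r k.+1) (r0 k.+1) => t t0.
  rewrite exprMn (exprS t) le_eqVlt; apply/orP; left; apply/eqP.
  have : (t ^+ d != 0)%R by rewrite expf_neq0// gt_eqF.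
  by move: (t ^+ d)%R => td td0; field.
have H := @cvg_geometric_eseries_half R (2 ^+ d.+1 * K * e) 0.
by rewrite (cvg_lim _ H)// expr0 divr1.
Qed.

End measure_rV.

(** * Convolutions *)

Section probability_integral.
Context {R : realType} (dT : measure_display) (T : measurableType dT).
Variable m : probability T R.
Implicit Types f g : T -> R.

Lemma bounded_integrable f B : measurable_fun setT f -> (forall x, `|f x| <= B) ->
  m.-integrable setT (EFin \o f).
Proof.
move=> mf fB; apply: measurable_bounded_integrable => //.
  by rewrite -ge0_fin_numE// fin_num_measure.
by exists B; split; [exact: num_real|move=> M BM x _ /=; rewrite (le_trans (fB x))// ltW].
Qed.

Lemma integrable_cstr (B : R) : m.-integrable setT (EFin \o fun=> B).
Proof. by apply: (@bounded_integrable _ `|B|) => //; exact: measurable_cst. Qed.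

Lemma integrable_addr f g : m.-integrable setT (EFin \o f) ->
  m.-integrable setT (EFin \o g) -> m.-integrable setT (EFin \o (fun x => f x + g x)).
Proof. by move=> fi gi; exact: (integrableD measurableT fi gi). Qed.

Lemma integrable_subr f g : m.-integrable setT (EFin \o f) ->
  m.-integrable setT (EFin \o g) -> m.-integrable setT (EFin \o (fun x => f x - g x)).
Proof. by move=> fi gi; exact: (integrableB measurableT fi gi). Qed.

Lemma integrable_mulr k f : m.-integrable setT (EFin \o f) ->
  m.-integrable setT (EFin \o (fun x => k * f x)).
Proof. by move=> fi; exact: (integrableZl measurableT k fi). Qed.

Lemma dominated_integrable f g : measurable_fun setT f ->
  (forall x, `|f x| <= g x) -> m.-integrable setT (EFin \o g) ->
  m.-integrable setT (EFin \o f).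
Proof.
move=> mf fg; apply: le_integrable => //; first exact/measurable_EFinP.
by move=> x _ /=; rewrite lee_fin (le_trans (fg x))// ler_norm.
Qed.

Lemma integrable_measurable f : m.-integrable setT (EFin \o f) ->
  measurable_fun setT f.
Proof. by move=> /integrableP[/measurable_EFinP]. Qed.

Lemma integral_cst1 (B : R) : (\int[m]_x B%:E = B%:E)%E.
Proof. by rewrite integral_cst//= probability_setT mule1. Qed.

Lemma Rintegral_cst1 (B : R) : \int[m]_x B = B.
Proof. by rewrite Rintegral_cst//= probability_setT mulr1. Qed.

Lemma Rintegral_le f B : m.-integrable setT (EFin \o f) -> (forall x, f x <= B) ->
  \int[m]_x f x <= B.
Proof.
move=> fi fB; rewrite -[leRHS]Rintegral_cst1; apply: le_Rintegral => //.
exact: integrable_cstr.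
Qed.

Lemma Rintegral_ge f B : m.-integrable setT (EFin \o f) -> (forall x, B <= f x) ->
  B <= \int[m]_x f x.
Proof.
move=> fi fB; rewrite -[leLHS]Rintegral_cst1; apply: le_Rintegral => //.
exact: integrable_cstr.
Qed.

Lemma Rintegral_norm_le f B : m.-integrable setT (EFin \o f) ->
  (forall x, `|f x| <= B) -> `|\int[m]_x f x| <= B.
Proof.
move=> fi fB; rewrite ler_norml; apply/andP; split.
  by apply: Rintegral_ge => // x; have /[!ler_norml]/andP[] := fB x.
by apply: Rintegral_le => // x; have /[!ler_norml]/andP[] := fB x.
Qed.

Lemma Rintegral_norm_le_nneg f (B : R) : measurable_fun setT f ->
  (\int[m]_x `|f x|%:E <= B%:E)%E ->
  m.-integrable setT (EFin \o f) /\ \int[m]_x `|f x| <= B.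
Proof.
move=> mf fB; split.
  apply/integrableP; split; first exact/measurable_EFinP.
  by apply: le_lt_trans fB _; exact: ltry.
have f0 : (0 <= \int[m]_x `|f x|%:E)%E.
  by apply: integral_ge0 => x _; rewrite lee_fin.
rewrite -lee_fin fineK// ge0_fin_numE//; apply: le_lt_trans fB _; exact: ltry.
Qed.

End probability_integral.

Section convolution.
Context {R : realType} {n : nat}.
Notation V := 'rV[R]_n.
Implicit Types m : probability V R.

Definition convol m (k : V -> R) (x : V) : R := \int[m]_y k (x - y).

Lemma measurable_convol_kernel (k : V -> R) (x : V) : measurable_fun setT k ->
  measurable_fun setT (fun y : V => k (x - y)).
Proof. by move=> mk; exact: (measurableT_comp mk (measurable_subl_rV x)). Qed.

Lemma measurable_convol m (k : V -> R) : measurable_fun setT k ->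
  measurable_fun setT (convol m k).
Proof.
move=> mk; apply: (measurableT_comp (@fine_measurable R setT measurableT)).
pose F (p : V * V) := (k (p.1 - p.2))%:E.
have mF : measurable_fun setT F.
  apply/measurable_EFinP.
  exact: (measurableT_comp mk (@measurable_sub_rV R n)).
rewrite (_ : (fun _ => _) = (fun x => \int[m]_y F^\+ (x, y) -
                                      \int[m]_y F^\- (x, y))%E); last first.
  apply/funext => x; rewrite [LHS]integralE; congr (_ - _)%E.
    by apply: eq_integral => y _; rewrite !funeposE.
  by apply: eq_integral => y _; rewrite !funenegE.
apply: emeasurable_funB.
  apply: (@measurable_fun_fubini_tonelli_F _ _ V V R m F^\+%E) => //.
  exact: measurable_funepos.
apply: (@measurable_fun_fubini_tonelli_F _ _ V V R m F^\-%E) => //.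
exact: measurable_funeneg.
Qed.

Lemma convol_integrable m (k : V -> R) B (x : V) : measurable_fun setT k ->
  (forall z, `|k z| <= B) -> m.-integrable setT (EFin \o (fun y : V => k (x - y))).
Proof.
by move=> mk kB; apply: (@bounded_integrable _ _ _ _ _ B) => //;
  exact: measurable_convol_kernel.
Qed.

Lemma convol_norm_le m (k : V -> R) B (x : V) : measurable_fun setT k ->
  (forall z, `|k z| <= B) -> `|convol m k x| <= B.
Proof.
by move=> mk kB; apply: Rintegral_norm_le => //; exact: convol_integrable mk kB.
Qed.

(** Fubini, for an even kernel. *)
Lemma convol_exchange (p q : probability V R) (k M : V -> R) : measurable_fun setT k ->
  (forall z, k (- z) = k z) ->
  (forall x, p.-integrable setT (EFin \o (fun y : V => k (x - y)))) ->
  (forall x, q.-integrable setT (EFin \o (fun y : V => k (x - y)))) ->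
  p.-integrable setT (EFin \o M) -> (forall x, \int[q]_y `|k (x - y)| <= M x) ->
  \int[p]_x convol q k x = \int[q]_x convol p k x.
Proof.
move=> mk ke ip iq iM kM; congr fine.
have mF : measurable_fun setT (EFin \o (fun z : V * V => k (z.1 - z.2))).
  apply/measurable_EFinP.
  exact: (measurableT_comp mk (@measurable_sub_rV R n)).
have iF : (p \x q)%E.-integrable setT (EFin \o (fun z : V * V => k (z.1 - z.2))).
  apply/integrable12ltyP => //.
  apply: (@le_lt_trans _ _ (\int[p]_x (M x)%:E)%E); last first.
    by rewrite ltey_eq (integrable_fin_num measurableT iM).
  apply: ge0_le_integral => //.
  - by move=> x _; exact: integral_ge0.
  - apply: (@measurable_fun_fubini_tonelli_F _ _ V V R q
      (fun z => `|(k (z.1 - z.2))%:E|)%E) => //.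
    exact: measurableT_comp.
  - by apply/measurable_EFinP; exact: integrable_measurable iM.
  - move=> x _; have iN := integrable_norm (iq x).
    by rewrite -(fineK (integrable_fin_num measurableT iN)) lee_fin; exact: kM.
have inner m x : m.-integrable setT (EFin \o (fun y : V => k (x - y))) ->
    (\int[m]_y (k (x - y))%:E)%E = (convol m k x)%:E.
  by move=> ik; rewrite fineK//; exact: integrable_fin_num.
under eq_integral do rewrite -(inner _ _ (iq _)).
under [RHS]eq_integral do rewrite -(inner _ _ (ip _)).
rewrite (Fubini iF); apply: eq_integral => y _; apply: eq_integral => x _ /=.
by rewrite -ke opprB.
Qed.

Lemma convol_sym m1 m2 (k : V -> R) B : measurable_fun setT k ->
  (forall z, `|k z| <= B) -> (forall z, k (- z) = k z) ->
  \int[m1]_x convol m2 k x = \int[m2]_x convol m1 k x.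
Proof.
move=> mk kB ke.
apply: (@convol_exchange _ _ _ (fun=> B)) => // [x|x||x].
- exact: convol_integrable mk kB.
- exact: convol_integrable mk kB.
- exact: integrable_cstr.
- by apply: Rintegral_le => //; exact: integrable_norm (convol_integrable m2 x mk kB).
Qed.

End convolution.

Section force.
Context {R : realType} {d : nat}.
Notation V := 'rV[R]_d.+1.
Implicit Types m : probability V R.

Lemma measurable_enorm : measurable_fun setT (fun z : V => enorm z).
Proof.
apply: continuous_measurable_mx => x.
apply: (@continuous_comp _ _ _ (fun z : V => dot z z) Num.sqrt).
  exact: (class_C0 (@smooth_dot R d.+1 0%N)).
exact: sqrt_continuous.
Qed.

(** The Euclidean unit ball lies between two cubes. *)
Lemma sphere_area_gt0 : 0 < sphere_area d.+1 :> R.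
Proof.
pose E := [set x : V | enorm x <= 1].
have mE : measurable E.
  rewrite (_ : E = setT `&` (fun z : V => enorm z) @^-1` `]-oo, 1]).
    by apply: measurable_enorm => //; exact: measurable_itv.
  by rewrite setTI; apply/seteqP; split=> x; rewrite /E /= in_itv.
rewrite /sphere_area mulr_gt0 ?ltr0n// fine_gt0//; apply/andP; split.
  apply: (@lt_le_trans _ _ (lebesgue_rV d.+1 (ball (0 : V) d.+1%:R^-1))).
    by rewrite lebesgue_rV_ball ?invr_gt0// lte_fin exprn_gt0// mulr_gt0// invr_gt0.
  apply: le_measure; rewrite ?inE//; first exact: measurable_ball_rV.
  move=> x; rewrite -ball_normE/= sub0r normrN => xd.
  rewrite /E/= (le_trans (enorm_le_norm _))// mulrC -ler_pdivlMr// div1r.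
  exact: ltW.
apply: (@le_lt_trans _ _ (lebesgue_rV d.+1 (ball (0 : V) 2))).
  apply: le_measure; rewrite ?inE//; first exact: measurable_ball_rV.
  move=> x; rewrite /E/= -ball_normE/= sub0r normrN => x1.
  by rewrite (le_lt_trans (norm_le_enorm _))// (le_lt_trans x1)// ltr1n.
by rewrite lebesgue_rV_ball// ltry.
Qed.

Lemma force_cst_gt0 : 0 < force_cst d.+1 :> R.
Proof.
have := sphere_area_gt0; case: (d) => [|[|d']] s0 /=.
- by rewrite invr_gt0.
- by rewrite invr_gt0 mulr_gt0// pi_gt0.
- by rewrite invr_gt0.
Qed.

Notation c := (force_cst d.+1).

Lemma measurable_force i : measurable_fun setT (fun z : V => force z i).
Proof.
apply: measurable_funM; first exact: measurable_cst.
apply: measurable_funM; first exact: measurable_coord_mx.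
apply: measurable_funV => [x|]; first by rewrite exprn_ge0// enorm_ge0.
by apply: measurable_funX; exact: measurable_enorm.
Qed.

Lemma force_le_enorm (z : V) i : `|force z i| <= c * enorm z ^- d.
Proof.
rewrite normrM gtr0_norm ?force_cst_gt0// ler_pM2l ?force_cst_gt0//.
rewrite normrM [X in _ * X]ger0_norm; last by rewrite invr_ge0 exprn_ge0// enorm_ge0.
have [->|z0] := eqVneq z 0.
  by rewrite mxE normr0 mul0r invr_ge0 exprn_ge0// enorm_ge0.
rewrite exprS invfM mulrA ler_piMl ?invr_ge0 ?exprn_ge0 ?enorm_ge0//.
rewrite ler_pdivrMr ?enorm_gt0// mul1r.
by rewrite (le_trans (coord_norm_le _ _))// norm_le_enorm.
Qed.

Lemma enormVX_le (z : V) : z != 0 -> enorm z ^- d <= `|z| ^- d.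
Proof.
move=> z0; rewrite lef_pV2 ?posrE ?exprn_gt0 ?enorm_gt0 ?normr_gt0//.
by rewrite lerXn2r ?nnegrE ?enorm_ge0// norm_le_enorm.
Qed.

Lemma enormVX0_le e : 0 < e -> enorm (0 : V) ^- d <= singular e (0 : V).
Proof.
move=> e0; rewrite /singular normr0 e0 mulr1.
by rewrite enorm0.
Qed.

Lemma enormVX_singular (e : R) (z : V) : 0 < e ->
  enorm z ^- d <= singular e z + e ^- d.
Proof.
move=> e0; have [->|z0] := eqVneq z 0.
  by rewrite (le_trans (enormVX0_le e0))// lerDl invr_ge0 exprn_ge0// ltW.
rewrite (le_trans (enormVX_le z0))// /singular.
have [ze|ez] := ltP `|z| e.
  by rewrite mulr1 lerDl invr_ge0 exprn_ge0// ltW.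
rewrite mulr0 add0r lef_pV2 ?posrE ?exprn_gt0 ?normr_gt0//.
by rewrite lerXn2r ?nnegrE// ltW.
Qed.

Section regular.
Variables (m : probability V R) (K : R).
Hypotheses (mK : ball_regular m K) (K0 : 0 <= K).

Lemma singular_integrable e x : 0 < e ->
  m.-integrable setT (EFin \o (fun y : V => singular e (x - y))) /\
  convol m (singular e) x <= 2 ^+ d.+1 * K * e.
Proof.
move=> e0; have mS : measurable_fun setT (fun y : V => singular e (x - y)).
  exact: (measurable_convol_kernel x (measurable_singular e)).
have [|iS S] := @Rintegral_norm_le_nneg R _ _ m _ (2 ^+ d.+1 * K * e) mS.
  under eq_integral do rewrite ger0_norm ?singular_ge0//.
  exact: integral_singular_le.
split=> //; apply: le_trans S; rewrite le_eqVlt; apply/orP; left; apply/eqP.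
by apply: eq_Rintegral => y _; rewrite ger0_norm ?singular_ge0.
Qed.

(** Kernels dominated by a singularity near 0 and bounded elsewhere. *)
Lemma convol_singular (k : V -> R) (e A B : R) x : measurable_fun setT k -> 0 < e ->
  0 <= A -> (forall z, `|k z| <= A * singular e z + B) ->
  m.-integrable setT (EFin \o (fun y : V => k (x - y))) /\
  `|convol m k x| <= A * (2 ^+ d.+1 * K * e) + B.
Proof.
move=> mk e0 A0 kAB; have [iS S] := singular_integrable x e0.
have iA := integrable_mulr A iS.
have iAB := integrable_addr iA (integrable_cstr m B).
have ik : m.-integrable setT (EFin \o (fun y : V => k (x - y))).
  by apply: (dominated_integrable _ _ iAB) => //; exact: measurable_convol_kernel.
split=> //; apply: (le_trans (le_normr_Rintegral measurableT ik)).
apply: (@le_trans _ _ (\int[m]_y (A * singular e (x - y) + B))).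
  by apply: le_Rintegral => //; exact: integrable_norm.
rewrite RintegralD//; last exact: integrable_cstr.
by rewrite Rintegral_cst1 lerD2r RintegralZl// ler_wpM2l.
Qed.

Lemma convol_force i x :
  m.-integrable setT (EFin \o (fun y : V => force (x - y) i)) /\
  `|convol m (fun z => force z i) x| <= c * (2 ^+ d.+1 * K + 1).
Proof.
have := @convol_singular (fun z => force z i) 1 c c x (measurable_force i) ltr01
  (ltW force_cst_gt0).
rewrite mulr1 -[X in _ + X]mulr1 -mulrDr; apply => z.
rewrite (le_trans (force_le_enorm z i))// -[X in _ + X]mulr1 -mulrDr.
rewrite ler_pM2l ?force_cst_gt0// (le_trans (enormVX_singular z ltr01))//.
by rewrite expr1n invr1.
Qed.

Lemma measurable_point (x : V) : measurable [set x].
Proof.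
rewrite -(setCK [set x]); apply: measurableC; apply: open_measurable_mx.
apply: closed_openC; apply: accessible_closed_set1; apply: hausdorff_accessible.
exact: norm_hausdorff.
Qed.

Lemma regular_point x : m [set x] = 0%E.
Proof.
apply/eqP; rewrite eq_le measure_ge0 andbT; apply/lee_addgt0Pr => e e0.
pose r := Num.min 1 (e / (K + 1)).
have K10 : 0 < K + 1 by rewrite ltr_wpDl.
have r0 : 0 < r by rewrite lt_min ltr01 divr_gt0.
apply: (@le_trans _ _ (m (ball x r))).
  apply: le_measure; rewrite ?inE.
  - exact: measurable_point.
  - exact: measurable_ball_rV.
  - by move=> y -> /=; exact: ballxx.
rewrite (le_trans (mK _ r0))// add0e lee_fin exprSr.
have r1 : r ^+ d <= 1 by rewrite exprn_ile1 ?(ltW r0)// ge_min lexx.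
have rK : r <= e / (K + 1) by rewrite ge_min lexx orbT.
have rKe : K * r <= e.
  have := rK; rewrite ler_pdivlMr// => rKe.
  by rewrite (le_trans _ rKe)// mulrC ler_pM2l// lerDl.
rewrite mulrCA (le_trans _ rKe)// mulrC.
by rewrite ler_piMr// mulr_ge0// ltW.
Qed.

End regular.

(** A point carries no mass, hence the value of a kernel at 0 is immaterial. *)
Lemma convol_off0 (m : probability V R) K (k k' : V -> R) x :
  ball_regular m K -> 0 <= K ->
  m.-integrable setT (EFin \o (fun y : V => k' (x - y))) ->
  (forall z, z != 0 -> k z = k' z) ->
  m.-integrable setT (EFin \o (fun y : V => k (x - y))) /\
  convol m k x = convol m k' x.
Proof.
move=> mK K0 ik' kk'.
have mI : measurable_fun setT (\1_[set x] : V -> R).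
  by apply: measurable_indic; exact: measurable_point.
have i1 : m.-integrable setT (EFin \o (\1_[set x] : V -> R)).
  apply: (@bounded_integrable _ _ _ _ _ 1) => // y.
  by rewrite indicE; case: (_ \in _); rewrite /= ?normr1 ?normr0.
have iI := integrable_mulr (k 0 - k' 0) i1.
have E : (fun y : V => k (x - y)) =
    (fun y => (k 0 - k' 0) * \1_[set x] y + k' (x - y)).
  apply/funext => y; rewrite indicE; have [<-|xy] := eqVneq x y.
    by rewrite mem_set// mulr1 subrr subrK.
  rewrite memNset; last by move=> /= yx; move: xy; rewrite yx eqxx.
  by rewrite mulr0 add0r kk'// subr_eq0.
rewrite /convol E; split; first exact: integrable_addr.
rewrite RintegralD// (RintegralZl _ measurableT i1) /Rintegral integral_indic//.
  by rewrite setIT; have /= -> := regular_point mK K0 x; rewrite /= mulr0 add0r.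
exact: measurable_point.
Qed.

(** The gradient of the kernel is only known off the origin, which is a null
    set here. *)
Lemma velocityE (r m : probability V R) K x i :
  ball_regular r K -> ball_regular m K -> 0 <= K ->
  velocity r m x 0 i =
  convol r (fun z => force z i) x - convol m (fun z => force z i) x.
Proof.
move=> rK mK K0; rewrite !mxE.
suff E p : ball_regular p K ->
    \int[p]_y grad (@coulomb R d.+1) (x - y) 0 i = - convol p (fun z => force z i) x.
  by rewrite !E// opprB opprK addrC.
move=> pK; have [iF _] := convol_force pK K0 i x.
have iN := integrable_mulr (-1) iF.
have [_ E] := convol_off0 (k := fun z => grad (@coulomb R d.+1) z 0 i)
  (k' := fun z => -1 * force z i) pK K0 iN
  (fun z z0 => etrans (grad_coulomb i z0) (esym (mulN1r _))).
by rewrite [LHS]E [LHS](RintegralZl _ measurableT iF) mulN1r.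
Qed.

End force.

(** * Integrals of functions of unknown measurability *)

Section integral_without_measurability.
Context {R : realType} (dT : measure_display) (T : measurableType dT).
Variable m : {measure set T -> \bar R}.
Local Open Scope ereal_scope.
Import HBNNSimple.

(** The integral is a difference of suprema over simple functions, hence it is
    monotone on arbitrary functions. *)
Lemma le_integral_any (D : set T) (f g : T -> \bar R) :
  (forall x, D x -> f x <= g x) ->
  \int[m]_(x in D) f x <= \int[m]_(x in D) g x.
Proof.
move=> fg; have le_nn (u v : T -> \bar R) : (forall x, 0 <= u x) ->
    (forall x, 0 <= v x) -> (forall x, u x <= v x) ->
    \int[m]_x u x <= \int[m]_x v x.
  move=> u0 v0 uv; rewrite !ge0_integralTE//; apply: le_ereal_sup.
  by move=> _ [h hu <-]; exists h => // x; exact: le_trans (uv x).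
have fgD x : (f \_ D) x <= (g \_ D) x.
  by rewrite !patchE; case: ifPn => // /[!inE]; exact: fg.
rewrite integral_mkcond [leRHS]integral_mkcond integralE [leRHS]integralE.
apply: leeB; apply: le_nn => x; rewrite ?funepos_ge0 ?funeneg_ge0//.
  by rewrite !funeposE ge_max !le_max fgD lexx orbT.
by rewrite !funenegE ge_max !le_max leeN2 fgD lexx orbT.
Qed.

(** For the integrand in time of the weak formulation, whose measurability is
    not established: bounds on f alone make the comparison valid. *)
Lemma le_Rintegral_ae (D : set T) (f u : T -> R) (B : R) : measurable D ->
  m D < +oo -> m.-integrable D (EFin \o u) ->
  (\forall x \ae m, D x -> (- B <= f x <= u x)%R) ->
  (\int[m]_(x in D) f x <= \int[m]_(x in D) u x)%R.
Proof.
move=> mD mDoo iu [N [mN N0 fuN]].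
have fu x : ~ N x -> D x -> (- B <= f x <= u x)%R.
  by move=> Nx; apply: contrapT => fux; apply/Nx/fuN.
pose U x := if x \in N then +oo else (u x)%:E.
pose L x := if x \in N then -oo else (- B)%:E.
have mu' : measurable_fun D (EFin \o u) by have /integrableP[] := iu.
have mNb : measurable_fun D (fun x => x \in N).
  apply: (measurable_fun_bool true); rewrite (_ : _ @^-1` _ = N).
    exact: measurableI.
  by apply/seteqP; split=> x /= => [/set_mem|/mem_set].
have aeN (v : T -> \bar R) c : ae_eq m D (fun x => if x \in N then c else v x) v.
  by exists N; split=> // x /=; apply: contra_notP => Nx _; rewrite memNset.
have mif (v : T -> \bar R) c : measurable_fun D v ->
    measurable_fun D (fun x => if x \in N then c else v x).
  move=> mv; apply: (measurable_fun_if mD mNb); first exact: measurable_cst.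
  by apply: measurable_funS mv.
have eU : \int[m]_(x in D) U x = \int[m]_(x in D) (u x)%:E.
  by apply: ae_eq_integral => //; [exact: mif|exact: aeN].
have eL : \int[m]_(x in D) L x = (- B)%:E * m D.
  rewrite -integral_cst//; apply: ae_eq_integral => //; last exact: aeN.
  by apply: mif; exact: measurable_cst.
have fU : \int[m]_(x in D) (f x)%:E <= \int[m]_(x in D) (u x)%:E.
  rewrite -eU; apply: le_integral_any => x Dx; rewrite /U.
  case: ifPn => [_|/negP]; first exact: leey.
  by rewrite inE lee_fin => Nx; have /andP[] := fu _ Nx Dx.
have fL : (- B)%:E * m D <= \int[m]_(x in D) (f x)%:E.
  rewrite -eL; apply: le_integral_any => x Dx; rewrite /L.
  case: ifPn => [_|/negP]; first exact: leNye.
  by rewrite inE lee_fin => Nx; have /andP[] := fu _ Nx Dx.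
have iufin : \int[m]_(x in D) (u x)%:E \is a fin_num.
  exact: (integrable_fin_num mD iu).
apply: fine_le => //; rewrite fin_numElt; apply/andP; split.
  by apply: lt_le_trans fL; rewrite ltNye_eq fin_numM// ge0_fin_numE.
by apply: (le_lt_trans fU); rewrite ltey_eq iufin.
Qed.

End integral_without_measurability.

(** * Test functions and drift *)

Section test_functions.
Context {R : realType}.
Implicit Types V : normedModType R.

Definition compact_smooth V (f : V -> R) := smooth f /\ compact (tsupport f).

Lemma tsupport_sub V (f : V -> R) (C : set V) : closed C ->
  (forall x, f x != 0 -> C x) -> tsupport f `<=` C.
Proof. by move=> cC fC; rewrite [C](closure_id _).1//; apply: closureS. Qed.

Lemma compact_tsupport_sub V (f : V -> R) (C : set V) : compact C ->
  (forall x, f x != 0 -> C x) -> compact (tsupport f).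
Proof.
move=> cC fC; apply: (subclosed_compact _ cC); first exact: closed_closure.
by apply: tsupport_sub => //; apply: compact_closed => //; exact: norm_hausdorff.
Qed.

Lemma compact_smooth_bounded V (f : V -> R) : compact_smooth f ->
  exists2 B, 0 < B & forall x, `|f x| <= B.
Proof.
move=> [Cf cf].
have cont : {within tsupport f, continuous f}.
  by apply: continuous_subspaceT; exact: (class_C0 (Cf 0%N)).
have [B B0 fB] := compact_norm_le (continuous_compact cont cf).
exists B => // x; have [->|fx0] := eqVneq (f x) 0; first by rewrite normr0 ltW.
by apply: fB; exists x => //; exact: tsupport_neq0.
Qed.

Lemma compact_smooth_derive V (f : V -> R) v : compact_smooth f ->
  compact_smooth (fun x => 'D_v f x).
Proof.
move=> [Cf cf]; split; first by move=> k; exact: (class_C_derive v (Cf k.+1)).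
apply: (compact_tsupport_sub cf) => x; apply: contra_neqP => fx.
have [->|v0] := eqVneq v 0; first by rewrite derive0.
rewrite (@near_eq_derive R V R^o f (cst 0))//; first exact: derive_cst.
have : nbhs x (~` tsupport f).
  by apply: open_nbhs_nbhs; split=> //; apply: closed_openC; exact: closed_closure.
apply: filterS => y fy; apply/eqP/negPn/negP => fy0; apply: fy.
exact: tsupport_neq0.
Qed.

Lemma compact_smooth_grad_bounded d (k : 'rV[R]_d -> R) : compact_smooth k ->
  exists2 D, 0 < D & forall x i, `|grad k x 0 i| <= D.
Proof.
move=> kC; have /choice[E EP] i : exists E, 0 < E /\
    forall x, `|'D_(delta_mx 0 i) k x| <= E.
  by have [E] := compact_smooth_bounded (compact_smooth_derive (delta_mx 0 i) kC); exists E.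
exists (1 + \sum_i E i).
  by rewrite ltr_pwDl// sumr_ge0// => i _; have [/ltW] := EP i.
move=> x i; rewrite mxE (bigD1 i)//= (le_trans (proj2 (EP i) x))//.
rewrite addrA [1 + E i]addrC -addrA lerDl addr_ge0// sumr_ge0// => j _.
by have [/ltW] := EP j.
Qed.

Lemma compact_smoothN V (k : V -> R) : compact_smooth k ->
  compact_smooth (fun x => - k x).
Proof.
move=> [Ck ck]; split.
  move=> j; rewrite (_ : (fun _ => _) = (fun x => -1 * k x)).
    by apply: class_CM => //; exact: class_C_cst.
  by apply/funext => x; rewrite mulN1r.
by apply: (compact_tsupport_sub ck) => x; rewrite oppr_eq0; exact: tsupport_neq0.
Qed.

Lemma compact_smooth_translate d (f : 'rV[R]_d -> R) a : compact_smooth f ->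
  compact_smooth (fun x => f (a - x)).
Proof.
move=> [Cf cf]; split; first exact: smooth_reflect.
have cont : continuous (fun x : 'rV[R]_d => a - x).
  by move=> x; apply: (@continuousB _ _ _ (fun=> a) id) => //; exact: cst_continuous.
apply: (@compact_tsupport_sub _ _ ((fun x => a - x) @` tsupport f)).
  by apply: continuous_compact => //; exact: continuous_subspaceT.
move=> x fx; exists (a - x); first exact: tsupport_neq0.
by rewrite opprB addrC subrK.
Qed.

Lemma smooth_measurable d (f : 'rV[R]_d -> R) : smooth f -> measurable_fun setT f.
Proof. by move=> Cf; apply: continuous_measurable_mx; exact: (class_C0 (Cf 0%N)). Qed.

Lemma test_function_tensor d (T lo hi : R) (chi : R -> R) (psi : 'rV[R]_d -> R) :
  smooth (chi : R^o -> R) -> (forall s, chi s != 0 -> lo <= s <= hi) -> hi < T ->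
  compact_smooth psi -> test_function T (fun p => chi p.1 * psi p.2).
Proof.
move=> Cchi chi0 hiT [Cpsi cpsi].
have cC : compact (`[lo, hi] `*` tsupport psi : set (R * 'rV[R]_d)).
  by apply: compact_setX => //; exact: segment_compact.
have sub : tsupport (fun p : R * 'rV[R]_d => chi p.1 * psi p.2) `<=`
    `[lo, hi] `*` tsupport psi.
  apply: tsupport_sub.
    by apply: compact_closed => //; exact: norm_hausdorff.
  move=> [s x] /=; rewrite mulf_eq0 negb_or => /andP[/chi0 s0 /tsupport_neq0 x0].
  by split=> //=; rewrite in_itv.
split.
- move=> k; apply: class_CM.
    apply: (@class_C_affine R _ R^o k fst fst) => // x; exact: cvg_fst.
  by apply: (@class_C_affine R _ _ k snd snd) => // x; exact: cvg_snd.
- by apply: (subclosed_compact _ cC sub); exact: closed_closure.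
- move=> p /sub[/= + _]; rewrite in_itv/= => /andP[_ phi].
  exact: le_lt_trans hiT.
Qed.

End test_functions.

Section drift.
Context {R : realType} {d : nat}.
Notation V := 'rV[R]_d.+1.
Notation c := (force_cst d.+1 : R).
Variables (mu : probability V R) (K : R).
Hypotheses (muK : ball_regular mu K) (K0 : 0 <= K).

Definition drift (r : probability V R) (psi : V -> R) (x : V) : R :=
  dot (velocity r mu x) (grad psi x).

Definition speed : R := 2 * (c * (2 ^+ d.+1 * K + 1)).

Lemma speed_ge0 : 0 <= speed.
Proof.
by rewrite !mulr_ge0 ?addr_ge0 ?mulr_ge0 ?exprn_ge0// ltW// force_cst_gt0.
Qed.

Lemma velocity_le r x i : ball_regular r K -> `|velocity r mu x 0 i| <= speed.
Proof.
move=> rK; rewrite (velocityE x i rK muK K0) (le_trans (ler_normB _ _))//.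
rewrite /speed mulr_natl mulr2n lerD//.
  by have [] := convol_force rK K0 i x.
by have [] := convol_force muK K0 i x.
Qed.

Lemma measurable_velocity r i : ball_regular r K ->
  measurable_fun setT (fun x => velocity r mu x 0 i).
Proof.
move=> rK; rewrite (_ : (fun _ => _) = (fun x =>
  convol r (fun z => force z i) x - convol mu (fun z => force z i) x)).
  by apply: measurable_funB; apply: measurable_convol; exact: measurable_force.
by apply/funext => x; rewrite (velocityE x i rK muK K0).
Qed.

Lemma drift_le r psi D x : ball_regular r K ->
  (forall i, `|grad psi x 0 i| <= D) -> `|drift r psi x| <= d.+1%:R * (speed * D).
Proof.
move=> rK psiD; rewrite /drift /dot (le_trans (ler_norm_sum _ _ _))//.
apply: (@le_trans _ _ (\sum_(i < d.+1) speed * D)).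
  by apply: ler_sum => i _; rewrite normrM ler_pM// velocity_le.
by rewrite sumr_const card_ord mulr_natl.
Qed.

Lemma measurable_drift r psi : ball_regular r K -> smooth psi ->
  measurable_fun setT (drift r psi).
Proof.
move=> rK Cpsi; rewrite /drift /dot; apply: measurable_sum => i.
apply: measurable_funM; first exact: measurable_velocity.
rewrite (_ : (fun _ => _) = (fun x => 'D_(delta_mx 0 i) psi x)).
  by apply: smooth_measurable => k; exact: (class_C_derive _ (Cpsi k.+1)).
by apply/funext => x; rewrite mxE.
Qed.

End drift.

(** * Time cutoffs *)

Section time_cutoff.
Context {R : realType}.
Notation leb := (@lebesgue_measure R).

Lemma continuous_segment_integrable (f : R -> R) a b : continuous f ->
  leb.-integrable `[a, b] (EFin \o f).
Proof.
move=> cf; apply: continuous_compact_integrable; first exact: segment_compact.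
exact: continuous_subspaceT.
Qed.

Lemma Rintegral_derive (f F : R -> R) a b : a < b -> continuous f ->
  (forall x : R, is_derive x 1 F (f x)) ->
  \int[leb]_(x in `[a, b]) f x = F b - F a.
Proof.
move=> ab cf dF; have cF := is_derive_continuous dF.
rewrite /Rintegral (@continuous_FTC2 R f F)//.
- exact: continuous_subspaceT.
- split; first by move=> x _; have [] := dF x.
    by apply: cvg_at_right_filter; exact: cF.
  by apply: cvg_at_left_filter; exact: cF.
- by move=> x _; rewrite derive1E; have dFx := dF x; rewrite derive_val.
Qed.

Lemma Rintegral_indic_segment (C s t T : R) : 0 <= s -> s <= t -> t <= T ->
  leb.-integrable `[0, T] (EFin \o (fun x => C * \1_(`[s, t]) x)) /\
  \int[leb]_(x in `[0, T]) (C * \1_(`[s, t]) x) = C * (t - s).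
Proof.
move=> s0 st tT.
have i1 : leb.-integrable `[0, T] (EFin \o (\1_(`[s, t]) : R -> R)).
  apply: measurable_bounded_integrable => //.
  - by rewrite /= lebesgue_measure_itv/=; case: ifP => _; rewrite ltry.
  - exists 1; split; first exact: num_real.
    move=> M M1 x _ /=; rewrite indicE; case: (_ \in _); rewrite /= ?normr1 ?normr0 ?ltW//.
    by rewrite (lt_trans _ M1).
split; first exact: (integrableZl _ C i1).
rewrite RintegralZl//; congr (_ * _).
rewrite /Rintegral integral_indic//.
rewrite (_ : `[s, t] `&` `[0, T] = `[s, t])%classic.
  rewrite /= lebesgue_measure_itv/= lte_fin; case: ltP => // ts.
  by apply/eqP; rewrite eq_sym subr_eq0 eq_le ts st.
apply/setIidPl => x /=; rewrite !in_itv/= => /andP[sx xt].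
by rewrite (le_trans s0 sx) (le_trans xt tT).
Qed.

Section step.
Variables (S dS : R -> R).
Hypothesis SdS : smooth_step S dS.

Lemma smooth_step_derive0 x : x < 0 \/ 1 < x -> dS x = 0.
Proof.
case: SdS => _ dSE _ S0 S1 x01.
have cst_derive (k : R) : (\forall y \near x, S y = k) -> dS x = 0.
  move=> Sk; have dSx := dSE x; rewrite -(@derive_val _ _ _ _ _ _ _ dSx).
  rewrite (@near_eq_derive R R^o R^o S (cst k)) ?oner_eq0//; exact: derive_cst.
case: x01 => [x0|x1].
  by apply: (cst_derive 0); near=> y; rewrite S0// ltW//; near: y; exact: lt_nbhsl.
by apply: (cst_derive 1); near=> y; rewrite S1// ltW//; near: y; exact: lt_nbhsr.
Unshelve. all: end_near. Qed.

Lemma smooth_step_bounded : exists2 B, 0 < B & forall x, `|dS x| <= B.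
Proof.
apply: (@compact_smooth_bounded R R^o dS); split; first by case: SdS => -[].
apply: (@compact_tsupport_sub R R^o _ `[0, 1]); first exact: segment_compact.
move=> x dSx; rewrite /= in_itv/= !leNgt; apply/andP; split; apply/negP => x01.
  by move: dSx; rewrite smooth_step_derive0 ?eqxx//; left.
by move: dSx; rewrite smooth_step_derive0 ?eqxx//; right.
Qed.

(** The time cutoff leaving 0 at time lo and reaching 1 at time lo + 1 / k. *)
Definition ramp (k lo x : R) : R := S (k * (x - lo)).

Let rampE k lo : ramp k lo = S \o (fun x => k * x + - (k * lo)).
Proof. by apply/funext => x; rewrite /ramp/= mulrBr. Qed.

Lemma ramp_smooth k lo : smooth (ramp k lo : R^o -> R).
Proof.
have [[CS _] _ _ _ _] := SdS; rewrite rampE => j.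
exact: (class_C_comp (CS j) (smooth_affine1 _ _ j)).
Qed.

Lemma ramp_derive (k lo x : R) : is_derive x 1 (ramp k lo) (k * dS (k * (x - lo))).
Proof.
have [_ dSE _ _ _] := SdS; rewrite rampE [X in is_derive _ _ _ X]mulrC mulrBr.
exact: (@is_derive1_comp R S _ x _ _ (dSE _) (is_derive_affine1 k (- (k * lo)) x)).
Qed.

Lemma ramp_derive_continuous (k lo : R) : continuous (fun x : R => k * dS (k * (x - lo))).
Proof.
have [[_ CdS] _ _ _ _] := SdS.
apply: (@class_C0 R R^o 0); apply: class_CM; first exact: class_C_cst.
rewrite (_ : (fun _ => _) = dS \o (fun x => k * x + - (k * lo))).
  exact: (class_C_comp (CdS 0%N) (smooth_affine1 _ _ 0%N)).
by apply/funext => x; rewrite /= mulrBr.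
Qed.

End step.
End time_cutoff.

(** * Increments of compactly supported observables *)

Lemma ae_mono (R : realType) (dT : measure_display) (T : semiRingOfSetsType dT)
  (m : set T -> \bar R) (P Q : T -> Prop) : (forall x, P x -> Q x) ->
  (\forall x \ae m, P x) -> \forall x \ae m, Q x.
Proof.
move=> PQ [N [mN N0 PN]]; exists N; split=> // x nQ; apply: PN => Px.
by apply: nQ; exact: PQ.
Qed.

Section weak_inequality.
Context {R : realType} {d : nat}.
Notation V := 'rV[R]_d.+1.
Notation leb := (@lebesgue_measure R).
Variables (mu rho0 : probability V R) (rho : R -> probability V R) (K T : R).
Hypotheses (Hrho : weak_solution mu rho0 rho) (muK : ball_regular mu K) (K0 : 0 <= K).
Hypotheses (T0 : 0 < T)
  (rhoK : \forall t \ae leb, 0 <= t <= T -> ball_regular (rho t) K).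

(** The weak formulation is used as an inequality, for test functions
    chi(t) psi(x): it is enough to bound its integrand from above at almost
    every time. *)
Lemma weak_solution_le (chi dchi U : R -> R) (lo hi M C : R) (psi : V -> R) :
  smooth (chi : R^o -> R) -> (forall s : R, is_derive s 1 chi (dchi s)) ->
  (forall s, 0 <= chi s <= 1) -> (forall s, `|dchi s| <= M) ->
  (forall s, chi s != 0 -> lo <= s <= hi) -> hi < T -> compact_smooth psi ->
  (\forall t \ae leb, 0 <= t <= T ->
     forall x, chi t * drift mu (rho t) psi x <= chi t * C) ->
  leb.-integrable `[0, T] (EFin \o U) ->
  (forall t, 0 <= t <= T -> dchi t * \int[rho t]_x psi x + chi t * C <= U t) ->
  0 <= \int[leb]_(t in `[0, T]) U t + chi 0 * \int[rho0]_x psi x.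
Proof.
move=> Cchi dchiE chi01 dchiM chi_supp hiT psiC driftC iU dchiU.
have [B B0 psiB] := compact_smooth_bounded psiC.
have mpsi : measurable_fun setT psi by apply: smooth_measurable; case: psiC.
have ipsi (r : probability V R) : r.-integrable setT (EFin \o psi).
  exact: bounded_integrable mpsi psiB.
have [D D0 psiD] := compact_smooth_grad_bounded psiC.
have [_ _ /(_ _ T0 _ (test_function_tensor Cchi chi_supp hiT psiC)) weak] := Hrho.
rewrite -[leLHS]weak /= (RintegralZl _ measurableT (ipsi rho0)) lerD2r.
pose Bw := M * B + d.+1%:R * (@speed R d K * D).
apply: (@le_Rintegral_ae _ _ _ _ _ _ _ Bw) => //.
  by rewrite /= lebesgue_measure_itv/=; case: ifP => _; rewrite ltry.
near=> t; rewrite /= in_itv/= => tT.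
have rK : ball_regular (rho t) K by move: tT; near: t.
have dC x : chi t * drift mu (rho t) psi x <= chi t * C.
  by move: x; move: tT; near: t.
have E x : derive1 (fun s => chi s * psi x) t +
    dot (velocity (rho t) mu x) (grad (fun y => chi t * psi y) x) =
    dchi t * psi x + chi t * drift mu (rho t) psi x.
  congr (_ + _).
    rewrite derive1E; have dc := dchiE t.
    have := @is_deriveM R R^o chi (cst (psi x)) t 1 _ 0 dc (is_derive_cst _ _ _).
    rewrite scaler0 add0r => dp.
    by rewrite (@derive_val _ _ _ _ _ _ _ dp) /GRing.scale/= mulrC.
  rewrite /drift /dot mulr_sumr; apply: eq_bigr => i _; rewrite mulrCA; congr (_ * _).
  rewrite !mxE; have dp := class_C_is_derive x (delta_mx 0 i) ((proj1 psiC) 1%N).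
  have dp' := @is_deriveZ R _ _ _ (chi t) x _ _ dp.
  exact: (@derive_val _ _ _ _ _ _ _ dp').
rewrite (_ : \int[rho t]_x _ =
    \int[rho t]_x (dchi t * psi x + chi t * drift mu (rho t) psi x)); last first.
  by apply: eq_Rintegral => x _; exact: E.
have mdr : measurable_fun setT (drift mu (rho t) psi).
  by apply: (measurable_drift muK K0 rK); case: psiC.
have drB x : `|drift mu (rho t) psi x| <= d.+1%:R * (@speed R d K * D).
  exact: (drift_le muK K0 rK (psiD x)).
have idr := @bounded_integrable _ _ _ (rho t) _ _ mdr drB.
have itot := integrable_addr (integrable_mulr (dchi t) (ipsi (rho t)))
  (integrable_mulr (chi t) idr).
have /andP[c0 c1] := chi01 t.
apply/andP; split.
  apply: Rintegral_ge => // x.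
  have : `|dchi t * psi x + chi t * drift mu (rho t) psi x| <= Bw.
    rewrite (le_trans (ler_normD _ _))// lerD// normrM.
      by rewrite ler_pM.
    by rewrite (ger0_norm c0) (le_trans _ (drB x))// ler_piMl.
  by rewrite ler_norml => /andP[].
apply: (le_trans _ (dchiU t tT)).
rewrite RintegralD//; [|exact: integrable_mulr|exact: integrable_mulr].
rewrite (RintegralZl _ measurableT (ipsi (rho t))) lerD2l.
apply: Rintegral_le => //.
exact: integrable_mulr.
Unshelve. all: end_near. Qed.

(** The curve with its prescribed initial datum put at time 0, so that the
    value of the solution at that time need not be identified. *)
Definition restart (t : R) : probability V R := if t <= 0 then rho0 else rho t.

Variables (S dS : R -> R).
Hypothesis SdS : smooth_step S dS.

(** The cutoff is A - B, where B is a ramp that ends at time t. Where the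
    derivative of A acts the observable is at most al, and where that of B acts,
    shortly before t, it is at least be. *)
Lemma weak_solution_increment (A dA : R -> R) (lo s t de M al be C : R) (psi : V -> R) :
  smooth (A : R^o -> R) -> (forall s : R, is_derive s 1 A (dA s)) ->
  continuous dA -> (forall s, 0 <= A s <= 1) ->
  (forall s, `|dA s| <= M) ->
  (forall u, A u != 0 -> lo <= u) -> (forall u, 0 <= u -> A u != 0 -> s <= u) ->
  (forall u, t - de <= u -> A u = 1) ->
  0 <= s -> s <= t -> t < T -> 0 < de -> de <= t -> 0 <= C -> compact_smooth psi ->
  (\forall u \ae leb, s <= u <= t -> forall x, drift mu (rho u) psi x <= C) ->
  (forall u, 0 <= u <= T -> dA u * \int[rho u]_x psi x <= dA u * al) ->
  (forall u, 0 <= u <= T -> t - de <= u <= t -> be <= \int[rho u]_x psi x) ->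
  be <= al * (1 - A 0) + A 0 * \int[rho0]_x psi x + C * (t - s).
Proof.
move=> CA dAE cdA A01 dAM Alo As A1 s0 st tT de0 det C0 psiC driftC dAal be_le.
pose B := ramp S de^-1 (t - de).
pose dB u := de^-1 * dS (de^-1 * (u - (t - de))).
have dBE : forall u : R, is_derive u 1 B (dB u) by exact: ramp_derive.
have [N N0 dSN] := smooth_step_bounded SdS.
have B0 u : u <= t - de -> B u = 0.
  have [_ _ _ S0 _] := SdS; move=> ut; rewrite /B /ramp S0//.
  by rewrite mulr_ge0_le0 ?subr_le0// invr_ge0 ltW.
have B1 u : t <= u -> B u = 1.
  have [_ _ _ _ S1] := SdS; move=> ut; rewrite /B /ramp S1//.
  by rewrite ler_pdivlMl// mulr1 lerBrDl subrK.
have B01 u : 0 <= B u <= 1 by exact: (smooth_step01 SdS).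
have chi_ge0 u : B u <= A u.
  have [ut|/ltW ut] := leP u (t - de); first by rewrite B0//; have /andP[] := A01 u.
  by rewrite A1//; have /andP[] := B01 u.
pose chi u := A u - B u.
have chi_supp u : chi u != 0 -> u <= t.
  apply: contra_neqT; rewrite -ltNge => tu; rewrite /chi A1 ?B1 ?subrr// ltW//.
  by rewrite (le_lt_trans _ tu)// gerBl ltW.
have B_neq0 u : B u != 0 -> t - de <= u.
  by apply: contra_neqT; rewrite -ltNge => /ltW; exact: B0.
have chiA u : chi u != 0 -> A u != 0.
  apply: contra_neq => Au; apply/eqP; rewrite /chi Au sub0r oppr_eq0.
  by rewrite eq_le -{1}Au chi_ge0; have /andP[] := B01 u.
have dB0 u : ~~ (t - de <= u <= t) -> dB u = 0.
  rewrite negb_and -!ltNge => /orP ut; rewrite /dB (smooth_step_derive0 SdS) ?mulr0//.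
  case: ut => ut; [left|right].
    by rewrite pmulr_rlt0 ?invr_gt0// subr_lt0.
  by rewrite ltr_pdivlMl// mulr1 ltrBrDl subrK.
have cdB : continuous dB.
  exact: (@ramp_derive_continuous R S dS SdS de^-1 (t - de)).
have t0 : 0 < t by exact: lt_le_trans det.
pose U u := al * dA u - be * dB u + C * \1_(`[s, t]) u.
have [iI I] := Rintegral_indic_segment C s0 st (ltW tT).
have idA := continuous_segment_integrable 0 T cdA.
have idB := continuous_segment_integrable 0 T cdB.
have iaA : leb.-integrable `[0, T] (EFin \o (fun u => al * dA u)).
  exact: (integrableZl _ al idA).
have ibB : leb.-integrable `[0, T] (EFin \o (fun u => be * dB u)).
  exact: (integrableZl _ be idB).
have iAB : leb.-integrable `[0, T] (EFin \o (fun u => al * dA u - be * dB u)).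
  exact: (integrableB _ iaA ibB).
have iU : leb.-integrable `[0, T] (EFin \o U) by exact: (integrableD _ iAB iI).
have IU : \int[leb]_(u in `[0, T]) U u =
    al * (1 - A 0) - be + C * (t - s).
  have ZA : \int[leb]_(u in `[0, T]) (al * dA u) = al * \int[leb]_(u in `[0, T]) dA u.
    by apply: RintegralZl.
  have ZB : \int[leb]_(u in `[0, T]) (be * dB u) = be * \int[leb]_(u in `[0, T]) dB u.
    by apply: RintegralZl.
  rewrite RintegralD// I RintegralB// ZA ZB.
  rewrite (Rintegral_derive T0 cdA dAE) (Rintegral_derive T0 cdB dBE).
  have tdT : t - de <= T by rewrite (le_trans _ (ltW tT))// gerBl ltW.
  have td0 : 0 <= t - de by rewrite subr_ge0.
  by rewrite (A1 _ tdT) (B1 _ (ltW tT)) (B0 _ td0) subr0 mulr1.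
have := @weak_solution_le chi (fun u => dA u - dB u) U lo t (M + de^-1 * N) C psi.
rewrite IU /chi (B0 0) ?subr0 ?subr_ge0// => H.
suff : 0 <= al * (1 - A 0) - be + C * (t - s) + A 0 * \int[rho0]_x psi x by lra.
apply: H => //.
- move=> k; apply: class_CD; first exact: CA.
  rewrite (_ : (fun _ => _) = (fun u => -1 * B u)).
    by apply: class_CM; [exact: class_C_cst|exact: (@ramp_smooth R S dS SdS de^-1 (t - de) k)].
  by apply/funext => u; rewrite mulN1r.
- move=> u; rewrite subr_ge0 chi_ge0/= lerBlDr.
  by have /andP[_ a1] := A01 u; have /andP[b0 _] := B01 u; rewrite (le_trans a1)// lerDl.
- move=> u; rewrite (le_trans (ler_normB _ _))// lerD// normrM.
  by rewrite ger0_norm ?ler_pM2l ?invr_gt0 ?invr_ge0 ?(ltW de0).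
- by move=> u cu; rewrite Alo/= ?chi_supp//; exact: chiA.
- apply: ae_mono driftC => u dC /andP[u0 uT] x.
  have [->|cu] := eqVneq (A u - B u) 0; first by rewrite !mul0r.
  have c0 : 0 <= A u - B u by rewrite subr_ge0.
  by rewrite ler_wpM2l// dC// chi_supp// As// chiA.
- move=> u uT; rewrite mulrBl /U lerD//.
    rewrite lerB//; first by rewrite mulrC [leRHS]mulrC mulrC; exact: dAal.
    have [ut|ut] := boolP (t - de <= u <= t); last by rewrite dB0// mulr0 mul0r.
    rewrite mulrC ler_wpM2l ?be_le//.
    have [_ _ dS0 _ _] := SdS.
    by rewrite mulr_ge0// invr_ge0 ltW.
  rewrite mulrC indicE; case: (boolP (u \in _)) => [_|/negP].
    rewrite mulr1 ler_piMr//.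
    by have /andP[_ a1] := A01 u; have /andP[b0 _] := B01 u; lra.
  rewrite inE /= in_itv/= => ust.
  have [->|cu] := eqVneq (A u - B u) 0; first by rewrite !mulr0.
  exfalso; apply: ust; have /andP[u0 _] := uT.
  by rewrite chi_supp// As// chiA.
Qed.

Lemma narrow_modulus (psi : V -> R) v e : compact_smooth psi -> 0 <= v -> 0 < e ->
  exists2 de, 0 < de & forall u, 0 <= u -> `|u - v| < de ->
    `|\int[rho u]_x psi x - \int[rho v]_x psi x| < e.
Proof.
move=> psiC v0 e0; have [B _ psiB] := compact_smooth_bounded psiC.
have [/(_ psi (class_C0 ((proj1 psiC) 0%N)))] := Hrho.
move=> /(_ (ex_intro _ B psiB))/subspace_continuousP/(_ v) + _ _.
rewrite /= in_itv/= v0 => /(_ isT)/cvgrPdist_lt/(_ e e0)/nbhs_ballP[de /= de0 H].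
exists de => // u u0 uv; rewrite distrC; apply: H; last by rewrite /= in_itv/= u0.
by rewrite /ball/= distrC.
Qed.

(** Narrow continuity turns the averages near the end points into the values
    there. When s = 0 the rising ramp lies at negative times, and the initial
    datum enters through the boundary term. *)
Lemma compact_increment s t C psi : 0 <= s -> s < t -> t < T -> 0 <= C ->
  compact_smooth psi ->
  (\forall u \ae leb, s <= u <= t -> forall x, drift mu (rho u) psi x <= C) ->
  \int[restart t]_x psi x - \int[restart s]_x psi x <= C * (t - s).
Proof.
move=> s0 st tT C0 psiC driftC; have t0 : 0 < t by exact: le_lt_trans st.
have [N N0 dSN] := smooth_step_bounded SdS; have [_ _ dS0 S0 S1] := SdS.
rewrite /restart (leNgt t 0) t0/= lerBlDr; apply/ler_addgt0Pr => e e0.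
have e20 : 0 < e / 2 by rewrite divr_gt0.
have [de1 de10 Ht] := narrow_modulus psiC (ltW t0) e20.
have nearT de u : de < de1 -> 0 <= u -> t - de <= u <= t ->
    \int[rho t]_x psi x - e / 2 <= \int[rho u]_x psi x.
  move=> dede u0 /andP[ut tu].
  have udt : `|u - t| < de1 by rewrite distrC ger0_norm ?subr_ge0//; lra.
  by have := Ht u u0 udt; rewrite ltr_norml => /andP[]; lra.
have [s_eq0|s_neq0] := eqVneq s 0.
  rewrite s_eq0 lexx subr0.
  pose de := Num.min (de1 / 2) t.
  have de0 : 0 < de by rewrite lt_min t0 divr_gt0.
  have det : de <= t by rewrite ge_min lexx orbT.
  have dede : de < de1.
    by rewrite (@le_lt_trans _ _ (de1 / 2))// ?ge_min ?lexx//; lra.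
  have dA0 u : 0 <= u -> 1 * dS (1 * (u - -2)) = 0.
    by move=> u0; rewrite !mul1r (smooth_step_derive0 SdS)//; right; lra.
  have A1 u : -1 <= u -> ramp S 1 (-2) u = 1.
    by move=> u1; rewrite /ramp S1//; lra.
  have := @weak_solution_increment (ramp S 1 (-2)) (fun u => 1 * dS (1 * (u - -2)))
    (-2) 0 t de N 0 (\int[rho t]_x psi x - e / 2) C psi (@ramp_smooth _ _ _ SdS _ _)
    (@ramp_derive _ _ _ SdS _ _) (@ramp_derive_continuous _ _ _ SdS _ _).
  rewrite (A1 0) ?lerN10// subrr mulr0 add0r mul1r subr0 => H.
  suff : \int[rho t]_x psi x - e / 2 <= \int[rho0]_x psi x + C * t by lra.
  apply: H => //.
  - by move=> u; exact: (smooth_step01 SdS).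
  - by move=> u; rewrite mul1r.
  - move=> u; apply: contra_neqT; rewrite -ltNge => u2; rewrite /ramp S0//; lra.
  - by move=> u ut; rewrite A1//; lra.
  - exact: ltW.
  - by rewrite -s_eq0.
  - by move=> u /andP[u0 _]; rewrite dA0// !mul0r.
  - by move=> u /andP[u0 _]; exact: nearT.
have s_gt0 : 0 < s by rewrite lt0r s_neq0.
rewrite (leNgt s 0) s_gt0/=.
have [de2 de20 Hs] := narrow_modulus psiC s0 e20.
pose de := Num.min (Num.min (de1 / 2) (de2 / 2)) ((t - s) / 2).
have de0 : 0 < de by rewrite !lt_min !divr_gt0// subr_gt0.
have ded1 : de <= de1 / 2 by rewrite !ge_min lexx.
have ded2 : de <= de2 / 2 by rewrite !ge_min lexx orbT.
have dets : de <= (t - s) / 2 by rewrite !ge_min lexx orbT.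
pose dA u := de^-1 * dS (de^-1 * (u - s)).
have A0 u : u <= s -> ramp S de^-1 s u = 0.
  by move=> us; rewrite /ramp S0// mulr_ge0_le0 ?subr_le0// invr_ge0 ltW.
have A1 u : s + de <= u -> ramp S de^-1 s u = 1.
  by move=> us; rewrite /ramp S1// ler_pdivlMl// mulr1 lerBrDl.
have As u : ramp S de^-1 s u != 0 -> s <= u.
  by apply: contra_neqT; rewrite -ltNge => /ltW; exact: A0.
have := @weak_solution_increment (ramp S de^-1 s) dA
    s s t de (de^-1 * N) (\int[rho s]_x psi x + e / 2)
    (\int[rho t]_x psi x - e / 2) C psi (@ramp_smooth _ _ _ SdS _ _)
    (@ramp_derive _ _ _ SdS _ _) (@ramp_derive_continuous _ _ _ SdS _ _).
rewrite (A0 0)// subr0 mulr1 mul0r addr0 => H.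
suff : \int[rho t]_x psi x - e / 2 <= \int[rho s]_x psi x + e / 2 + C * (t - s) by lra.
apply: H => //.
- by move=> u; exact: (smooth_step01 SdS).
- by move=> u; rewrite normrM gtr0_norm ?invr_gt0// ler_pM2l ?invr_gt0.
- by move=> u _; exact: As.
- by move=> u ut; rewrite A1//; lra.
- exact: ltW.
- lra.
- move=> u /andP[u0 _]; rewrite /dA.
  have [/andP[us su]|us] := boolP (s <= u <= s + de); last first.
    rewrite (smooth_step_derive0 SdS) ?mulr0 ?mul0r//.
    move: us; rewrite negb_and -!ltNge => /orP[us|us]; [left|right].
      by rewrite pmulr_rlt0 ?invr_gt0// subr_lt0.
    by rewrite ltr_pdivlMl// mulr1 ltrBrDl.
  rewrite ler_wpM2l//; first by rewrite mulr_ge0// invr_ge0 ltW.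
  have uds : `|u - s| < de2 by rewrite ger0_norm ?subr_ge0//; lra.
  by have := Hs u u0 uds; rewrite ltr_norml => /andP[_]; lra.
- by move=> u /andP[u0 _]; apply: nearT => //; lra.
Qed.

End weak_inequality.

(** * Increments of bounded observables *)

Lemma bounded_cvg_Rintegral (R : realType) (dT : measure_display) (T : measurableType dT)
  (m : probability T R) (f_ : nat -> T -> R) (f : T -> R) (B : R) :
  (forall n, measurable_fun setT (f_ n)) -> (forall n x, `|f_ n x| <= B) ->
  (forall x, f_ n x @[n --> \oo] --> f x) ->
  \int[m]_x f_ n x @[n --> \oo] --> \int[m]_x f x.
Proof.
move=> mf fB ff.
have mlim : measurable_fun setT f.
  by apply: (measurable_fun_cvg mf) => x _; exact: ff.
have limB x : `|f x| <= B.
  by apply: (cvgr_to_le (cvg_norm (ff x))); exact: nearW.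
have iflim := @bounded_integrable _ _ _ m _ _ mlim limB.
apply: fine_cvg; rewrite fineK ?integrable_fin_num//.
apply: (@dominated_cvg _ _ _ _ setT measurableT _ _ (EFin \o fun=> B)) => //.
- by move=> n; apply/measurable_EFinP.
- by move=> x _; apply: cvg_EFin; [exact: nearW|exact: ff].
- exact: integrable_cstr.
- by move=> n x _; rewrite lee_fin.
Qed.

Section space_cutoff.
Context {R : realType} {d : nat}.
Notation V := 'rV[R]_d.+1.
Variables (S dS : R -> R).
Hypothesis SdS : smooth_step S dS.

Definition space_cutoff (l : R) (x : V) : R := 1 - ramp S (l ^- 2) (l ^+ 2) (dot x x).

Lemma space_cutoff_compact_smooth l : 0 < l -> compact_smooth (space_cutoff l).
Proof.
move=> l0; split.
  move=> k; rewrite (_ : space_cutoff l =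
    (fun x => 1 + -1 * ramp S (l ^- 2) (l ^+ 2) (dot x x))).
    apply: class_CD; first exact: class_C_cst.
    apply: class_CM; first exact: class_C_cst.
    by apply: (@smooth_radial R d.+1 (ramp S _ _)); exact: (@ramp_smooth R S dS SdS).
  by apply/funext => x; rewrite mulN1r.
have cB := @compact_norm_ball R d.+1 (2 * l).
apply: (compact_tsupport_sub cB) => x.
apply: contra_neqP => /= /negP; rewrite -ltNge => lx.
have [_ _ _ _ S1] := SdS; rewrite /space_cutoff /ramp S1 ?subrr//.
rewrite ler_pdivlMl ?exprn_gt0// mulr1 lerBrDr.
have : (2 * l) ^+ 2 <= dot x x.
  rewrite -(sqr_sqrtr (dot_ge0 x)) lerXn2r ?nnegrE ?sqrtr_ge0 ?mulr_ge0 ?(ltW l0)//.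
  by rewrite (le_trans (ltW lx))//; exact: norm_le_enorm.
apply: le_trans; rewrite exprMn; have : 0 <= l ^+ 2 by exact: sqr_ge0.
lra.
Qed.

Lemma space_cutoff01 l x : 0 <= space_cutoff l x <= 1.
Proof.
have := smooth_step01 SdS (l ^- 2 * (dot x x - l ^+ 2)).
by rewrite /space_cutoff /ramp => /andP[? ?]; apply/andP; split; lra.
Qed.

Lemma space_cutoff_grad l N x i : 0 < l -> (forall u, `|dS u| <= N) ->
  `|grad (space_cutoff l) x 0 i| <= 4 * N / l.
Proof.
move=> l0 dSN; have N0 : 0 <= N by apply: le_trans (dSN 0).
pose k := l ^- 2; have k0 : 0 < k by rewrite invr_gt0 exprn_gt0.
have dr := @is_derive_radial R d.+1 _ x (delta_mx 0 i) _
  (ramp_derive SdS k (l ^+ 2) (dot x x)).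
have d1 := @is_deriveB R V R^o (cst 1) _ x _ 0 _ (is_derive_cst _ _ _) dr.
rewrite (grad_is_derive d1) sub0r normrN dot_delta.
have [xl|xl] := leP (dot x x) ((2 * l) ^+ 2); last first.
  rewrite (smooth_step_derive0 SdS).
    by rewrite mulr0 mul0r normr0 divr_ge0 ?mulr_ge0// ltW.
  right; rewrite ltr_pdivlMl ?exprn_gt0// mulr1 ltrBrDr.
  apply: le_lt_trans xl; rewrite exprMn; have : 0 <= l ^+ 2 by exact: sqr_ge0.
  lra.
have xi : `|x 0 i| <= 2 * l.
  rewrite (le_trans (coord_norm_le _ _))// (le_trans (norm_le_enorm _))//.
  by rewrite -(@ger0_norm _ (2 * l)) ?mulr_ge0 ?(ltW l0)// -sqrtr_sqr ler_sqrt// sqr_ge0.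
rewrite !normrM (gtr0_norm k0) (ger0_norm (_ : 0 <= 2))//.
rewrite (_ : 4 * N / l = k * N * (2 * (2 * l))); last first.
  by rewrite /k; field; rewrite gt_eqF.
by rewrite ler_pM// ?mulr_ge0// ?ler_pM2l// ltW.
Qed.

Lemma space_cutoff_cvg x : space_cutoff n.+1%:R x @[n --> \oo] --> (1 : R).
Proof.
apply: cvg_near_cst.
have := @nbhs_infty_gtr R (Num.sqrt (dot x x)).
apply: filterS => n xn; apply/eqP; rewrite eq_sym -subr_eq0 /space_cutoff opprB addrC subrK.
have [_ _ _ S0 _] := SdS; rewrite /ramp S0//.
rewrite mulr_ge0_le0 ?invr_ge0 ?exprn_ge0// subr_le0 -(sqr_sqrtr (dot_ge0 x)).
rewrite lerXn2r ?nnegrE ?sqrtr_ge0// ltW// (lt_le_trans xn)//.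
by rewrite ler_nat.
Qed.

End space_cutoff.

Section bounded_increment.
Context {R : realType} {d : nat}.
Notation V := 'rV[R]_d.+1.
Notation leb := (@lebesgue_measure R).
Variables (mu rho0 : probability V R) (rho : R -> probability V R) (K T : R).
Hypotheses (Hrho : weak_solution mu rho0 rho) (muK : ball_regular mu K) (K0 : 0 <= K).
Hypotheses (T0 : 0 < T)
  (rhoK : \forall t \ae leb, 0 <= t <= T -> ball_regular (rho t) K).
Variables (S dS : R -> R).
Hypothesis SdS : smooth_step S dS.

(** The velocity is bounded, so that cutting off in space costs a term
    of the order of the inverse of the cutoff radius. *)
Lemma bounded_increment s t B C (psi : V -> R) : 0 <= s -> s < t -> t < T -> 0 <= C ->
  smooth psi -> (forall x, `|psi x| <= B) ->
  (\forall u \ae leb, s <= u <= t ->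
     ball_regular (rho u) K /\ forall x, drift mu (rho u) psi x <= C) ->
  \int[restart rho0 rho t]_x psi x - \int[restart rho0 rho s]_x psi x <= C * (t - s).
Proof.
move=> s0 st tT C0 Cpsi psiB driftC.
have [N N0 dSN] := smooth_step_bounded SdS.
have B0 : 0 <= B by apply: le_trans (psiB 0).
pose E := B * (d.+1%:R * (@speed R d K * (4 * N))).
have sp0 : 0 <= @speed R d K by exact: speed_ge0.
have E0 : 0 <= E.
  by rewrite mulr_ge0// mulr_ge0// mulr_ge0// mulr_ge0// ltW.
pose f n x := psi x * space_cutoff S n.+1%:R x.
have Cf n : compact_smooth (f n).
  have [Cz cz] := @space_cutoff_compact_smooth R d S dS SdS n.+1%:R (ltr0Sn _ n).
  split; first by move=> k; exact: class_CM.
  apply: (compact_tsupport_sub cz) => x; rewrite /f mulf_eq0 negb_or => /andP[_].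
  exact: tsupport_neq0.
have fB n x : `|f n x| <= B.
  have /andP[z0 z1] := space_cutoff01 SdS n.+1%:R x.
  by rewrite normrM (ger0_norm z0) (le_trans _ (psiB x))// ler_piMr.
have fcvg x : f n x @[n --> \oo] --> psi x.
  rewrite -[X in _ --> X]mulr1; apply: cvgM; first exact: cvg_cst.
  exact: (space_cutoff_cvg SdS).
have mf n : measurable_fun setT (f n) by apply: smooth_measurable; case: (Cf n).
have inc n : \int[restart rho0 rho t]_x f n x - \int[restart rho0 rho s]_x f n x
    <= (C + E * n.+1%:R^-1) * (t - s).
  apply: (compact_increment Hrho muK K0 T0 rhoK SdS) => //.
    by rewrite addr_ge0// mulr_ge0// invr_ge0.
  apply: ae_mono driftC => u dC su x; have {dC su}[rK dC] := dC su.
  have [Cz _] := @space_cutoff_compact_smooth R d S dS SdS n.+1%:R (ltr0Sn _ n).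
  have -> : drift mu (rho u) (f n) x = space_cutoff S n.+1%:R x * drift mu (rho u) psi x +
      psi x * drift mu (rho u) (space_cutoff S n.+1%:R) x.
    rewrite /drift /dot !mulr_sumr -big_split; apply: eq_bigr => i _ /=.
    have d1 := class_C_is_derive x (delta_mx 0 i) (Cpsi 1%N).
    have d2 := class_C_is_derive x (delta_mx 0 i) (Cz 1%N).
    have d12 := @is_deriveM R V _ _ x _ _ _ d1 d2.
    rewrite (grad_is_derive d12) !mxE /GRing.scale/=; ring.
  have /andP[z0 z1] := space_cutoff01 SdS n.+1%:R x.
  apply: lerD.
    by rewrite (le_trans (ler_wpM2l z0 (dC x)))// ler_piMl.
  rewrite (le_trans (ler_norm _))// normrM /E -!mulrA ler_pM//.
  have := drift_le muK K0 rK (fun i => space_cutoff_grad SdS x i (ltr0Sn _ n) dSN).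
  by rewrite !mulrA.
have Ec : (fun n => \int[restart rho0 rho t]_x f n x - \int[restart rho0 rho s]_x f n x -
    E * (t - s) * n.+1%:R^-1) @ \oo -->
    \int[restart rho0 rho t]_x psi x - \int[restart rho0 rho s]_x psi x - E * (t - s) * 0.
  apply: cvgB.
    by apply: cvgB; apply: bounded_cvg_Rintegral mf fB fcvg.
  by apply: cvgMr; exact: cvg_harmonic.
rewrite mulr0 subr0 in Ec.
apply: (cvgr_to_le Ec); apply: nearW => n.
by rewrite lerBlDr mulrAC -mulrDl; exact: inc.
Qed.

End bounded_increment.

(** * Smoothness of convolutions *)

Section convol_smooth.
Context {R : realType} {d : nat}.
Notation V := 'rV[R]_d.
Variable m : probability V R.

Lemma convol_continuous (k : V -> R) B : continuous k -> (forall x, `|k x| <= B) ->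
  continuous (convol m k).
Proof.
move=> ck kB x; apply: (@cvgrPdist_lt _ _ _ (nbhs x) _ _ _).2 => e e0.
apply: contrapT => nx.
have mk : measurable_fun setT k by exact: continuous_measurable_mx.
have ex n : exists y, `|x - y| < n.+1%:R^-1 /\ e <= `|convol m k x - convol m k y|.
  apply: contrapT => /forallNP ny; apply: nx.
  apply/nbhs_ballP; exists n.+1%:R^-1; first by rewrite /= invr_gt0.
  move=> y; rewrite -ball_normE/= => xy; rewrite ltNge; apply/negP => ey.
  by apply: (ny y).
have /choice[y yP] := ex.
have yx : y n @[n --> \oo] --> x.
  apply/cvgrPdist_lt => r r0.
  have : harmonic n @[n --> \oo] --> (0 : R) by exact: cvg_harmonic.
  move=> /cvgrPdist_lt/(_ r r0); apply: filterS => n.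
  rewrite sub0r normrN ger0_norm ?harmonic_ge0// => nr.
  by apply: lt_trans nr; have [] := yP n.
have : convol m k (y n) @[n --> \oo] --> convol m k x.
  apply: (@bounded_cvg_Rintegral _ _ _ _ _ _ B).
  - by move=> n; exact: measurable_convol_kernel.
  - by move=> n z; exact: kB.
  - move=> z; apply: continuous_cvg; first exact: ck.
    by apply: cvgB => //; exact: cvg_cst.
move=> /cvgrPdist_lt/(_ e e0)[n _ /(_ n (leqnn _)) /=].
by rewrite ltNge; have [_ ->] := yP n.
Qed.

Lemma is_derive_convol (k : V -> R) x v : compact_smooth k ->
  is_derive x v (convol m k) (convol m (fun z => 'D_v k z) x).
Proof.
move=> kC; have [B _ kB] := compact_smooth_bounded kC.
have [B' B'0 dkB] := compact_smooth_bounded (compact_smooth_derive v kC).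
have mk : measurable_fun setT k by apply: smooth_measurable; case: kC.
apply/is_derive_line.
pose f (h : R) (y : V) := k (h *: v + x - y).
have df h y : is_derive (h : R) 1 (f^~ y) ('D_v k (h *: v + x - y)).
  have dk := class_C_is_derive (h *: v + x - y) v ((proj1 kC) 1%N).
  apply/is_derive_line.
  have /is_derive_line := dk.
  rewrite (_ : (fun _ => _) = (fun h0 : R => f (h0 *: (1 : R^o) + h) y))//.
  apply/funext => t; rewrite /f; congr k.
  by rewrite [_%:A]mulr1 scalerDl !addrA.
have p1 h y : partial1of2 f h y = 'D_v k (h *: v + x - y).
  by rewrite partial1of2E; have d0 := df h y; rewrite derive_val.
have I0 : (`]-1, 1[%classic : set R) 0 by rewrite /= in_itv/= ltrN10 ltr01.
have intf : forall h, `]-1, 1[%classic h -> m.-integrable setT (EFin \o f h).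
  move=> t _; apply: (@bounded_integrable _ _ _ _ _ B) => [|y]; last exact: kB.
  exact: (@measurable_convol_kernel _ _ k (t *: v + x)).
have derf : forall h y, `]-1, 1[%classic h -> setT y -> derivable (f^~ y) h 1.
  by move=> u z _ _; have [] := df u z.
have G0 (y : V) : 0 <= B' by exact: ltW.
have Gub : forall h y, `]-1, 1[%classic h -> setT y -> `|partial1of2 f h y| <= B'.
  by move=> w y _ _; rewrite p1; exact: dkB.
have iG : m.-integrable setT (EFin \o fun=> B') by exact: integrable_cstr.
have D1 := derivable_under_integral measurableT I0 intf derf G0 iG Gub.
have D2 := differentiation_under_integral measurableT I0 intf derf G0 iG Gub.
apply: DeriveDef; first exact: D1.
rewrite -derive1E [LHS]D2; apply: eq_Rintegral => y _.
by rewrite p1 scale0r add0r.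
Qed.

Lemma class_C_convol j (k : V -> R) : compact_smooth k -> class_C j (convol m k).
Proof.
elim: j k => [|j IH] k kC; have [B _ kB] := compact_smooth_bounded kC.
  by split=> //; apply: (convol_continuous _ kB); exact: (class_C0 ((proj1 kC) 0%N)).
apply: (@class_C_step _ _ _ _ (fun v => convol m (fun z => 'D_v k z))).
- by apply: (convol_continuous _ kB); exact: (class_C0 ((proj1 kC) 0%N)).
- by move=> x v; exact: is_derive_convol.
- by move=> v; apply: IH; exact: compact_smooth_derive.
Qed.

Lemma convol_smooth (k : V -> R) : compact_smooth k -> smooth (convol m k).
Proof. by move=> kC j; exact: class_C_convol. Qed.

End convol_smooth.

(** * The truncated Coulomb kernel *)

Section kernel.
Context {R : realType} {d : nat}.
Notation V := 'rV[R]_d.+1.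
Notation c := (force_cst d.+1 : R).

Variables (e : R) (P f : R -> R).
Hypotheses (e0 : 0 < e) (Pf : radial_profile d.+1 (e ^+ 2) 1 P f).

(** The Coulomb kernel smoothed near 0 and cut off at distance of order 1. *)
Definition cut_kernel (z : V) : R := c * (P 2 - P (dot z z)).

Lemma cut_kernel_ge0 z : 0 <= cut_kernel z.
Proof.
rewrite mulr_ge0 ?(ltW force_cst_gt0)// subr_ge0.
have [z2|/ltW z2] := leP (dot z z) 2; first exact: (radial_profile_ndecr Pf).
by rewrite (@radial_profile_cst _ _ _ _ _ _ Pf (dot z z)) -?(natrD _ 1 1)//.
Qed.

Lemma cut_kernel_far z : 2 <= dot z z -> cut_kernel z = 0.
Proof.
move=> z2; rewrite /cut_kernel.
rewrite (@radial_profile_cst _ _ _ _ _ _ Pf (dot z z)) -?(natrD _ 1 1)//.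
by rewrite subrr mulr0.
Qed.

Lemma cut_kernelN z : cut_kernel (- z) = cut_kernel z.
Proof.
rewrite /cut_kernel; congr (_ * (_ - P _)).
by apply: eq_bigr => i _; rewrite !mxE mulrNN.
Qed.

Lemma cut_kernel_compact_smooth : compact_smooth cut_kernel.
Proof.
have [[CP _] _ _ _ _] := Pf; split.
  move=> k; apply: class_CM; first exact: class_C_cst.
  rewrite (_ : (fun _ => _) = (fun z => P 2 + -1 * P (dot z z))).
    apply: class_CD; first exact: class_C_cst.
    apply: class_CM; first exact: class_C_cst.
    exact: (@smooth_radial R d.+1 P CP k).
  by apply/funext => z; rewrite mulN1r.
have cB := @compact_norm_ball R d.+1 2.
apply: (compact_tsupport_sub cB) => x.
apply: contra_neqP => /= /negP; rewrite -ltNge => lx.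
apply: cut_kernel_far; rewrite -(sqr_sqrtr (dot_ge0 x)).
have : 2 ^+ 2 <= enorm x ^+ 2.
  rewrite lerXn2r ?nnegrE ?enorm_ge0// (le_trans (ltW lx))//.
  exact: norm_le_enorm.
by apply: le_trans; rewrite -natrX ler_nat.
Qed.

Lemma cut_kernel_le z : z != 0 -> cut_kernel z <= 2 * c * singular 2 z.
Proof.
move=> z0; have c0 := @force_cst_gt0 R d.
have [z2|z2] := leP 2 (dot z z).
  by rewrite cut_kernel_far// mulr_ge0 ?singular_ge0// mulr_ge0// ltW.
have dz : 0 < dot z z by move: z0; rewrite -enorm_gt0 sqrtr_gt0.
have en2 : enorm z < 2.
  rewrite -(@ltr_pXn2r _ 2) ?nnegrE ?enorm_ge0// sqr_sqrtr ?dot_ge0//.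
  by rewrite (lt_trans z2)// -natrX ltr_nat.
rewrite /singular (le_lt_trans (norm_le_enorm z) en2) mulr1.
have := radial_profile_tail Pf (ltn0Sn d) dz (ltW z2) => /= H.
rewrite /cut_kernel (mulrC 2) -mulrA ler_pM2l// (le_trans H)//.
apply: ler_pM; rewrite ?sqrtr_ge0 ?invr_ge0 ?exprn_ge0 ?sqrtr_ge0//.
  have /ltW : Num.sqrt (2 : R) < Num.sqrt (2 ^+ 2) by rewrite ltr_sqrt -natrX ?ltr_nat ?ltr0n.
  by rewrite sqrtr_sqr ger0_norm.
exact: enormVX_le.
Qed.

Lemma cut_kernel_derive z i :
  is_derive z (delta_mx 0 i) cut_kernel (- (c * (2 * z 0 i * f (dot z z)))).
Proof.
have [_ dP _ _ _] := Pf.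
have dr := @is_derive_radial R d.+1 P z (delta_mx 0 i) _ (dP (dot z z)).
have ds := @is_deriveB R V R^o (cst (P 2)) _ z _ 0 _ (is_derive_cst _ _ _) dr.
have dk := @is_deriveZ R V R^o _ c z _ _ ds.
apply: (is_derive_eq dk); rewrite dot_delta /GRing.scale/=; ring.
Qed.

(** The smoothed force differs from the true one by an integrable
    singularity at scale e and by a bounded tail. *)
Lemma cut_kernel_derive_force z i :
  `|'D_(delta_mx 0 i) cut_kernel z + force z i| <= c * singular e z + c.
Proof.
have c0 := @force_cst_gt0 R d; have dk := cut_kernel_derive z i.
rewrite derive_val.
have S0 := singular_ge0 e z; have cS0 : 0 <= c * singular e z by rewrite mulr_ge0// ltW.
have [zE|z0] := eqVneq z 0.
  have zi : z 0 i = 0 by rewrite zE mxE.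
  by rewrite /force zi !(mulr0, mul0r) oppr0 addr0 normr0 addr_ge0// ltW.
have en0 : 0 < enorm z by rewrite enorm_gt0.
have dz : 0 < dot z z by move: en0; rewrite sqrtr_gt0.
have dzE : dot z z = enorm z ^+ 2 by rewrite sqr_sqrtr// ltW.
have [_ _ [f0 /(_ _ dz) fle] fE _] := Pf.
have [/fE fE'|nmid] := boolP (e ^+ 2 <= dot z z <= 1).
  rewrite (_ : - _ + _ = 0) ?normr0 ?addr_ge0 ?(ltW c0)//.
  by rewrite fE' /force -/(enorm z); move: (enorm z ^- d.+1) => X; field.
have le_force : `|- (c * (2 * z 0 i * f (dot z z))) + force z i| <= `|force z i|.
  rewrite (_ : - _ + _ = (1 - 2 * f (dot z z) * enorm z ^+ d.+1) * force z i); last first.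
    have X0 : enorm z ^+ d.+1 != 0 by rewrite expf_neq0// gt_eqF.
    by rewrite /force; move: (enorm z ^+ d.+1) X0 => X X0; field.
  rewrite normrM ler_piMl// ler_norml.
  have : 0 <= 2 * f (dot z z) * enorm z ^+ d.+1 <= 1.
    rewrite mulr_ge0 ?mulr_ge0 ?exprn_ge0 ?enorm_ge0//=.
    rewrite -ler_pdivlMr ?exprn_gt0// div1r.
    by have := fle; rewrite -/(enorm z) ler_pdivlMl//.
  by move=> /andP[? ?]; apply/andP; split; lra.
apply: (le_trans le_force); apply: (le_trans (force_le_enorm z i)).
move: nmid; rewrite negb_and -!ltNge dzE => /orP[ze|z1].
  rewrite -[leLHS]addr0 lerD ?(ltW c0)// ler_pM2l//.
  have en_e : enorm z < e.
    by rewrite -(@ltr_pXn2r _ 2) ?nnegrE ?enorm_ge0// ltW.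
  rewrite /singular (le_lt_trans (norm_le_enorm z) en_e) mulr1.
  exact: enormVX_le.
rewrite -[leLHS]add0r lerD// ler_piMr ?(ltW c0)// invf_le1 ?exprn_gt0//.
rewrite exprn_ege1//.
by rewrite -(@ler_pXn2r _ 2) ?nnegrE ?enorm_ge0// expr1n ltW.
Qed.

End kernel.

(** * The Lyapunov functional *)

Lemma ae_and (R : realType) (dT : measure_display) (T : measurableType dT)
  (m : {measure set T -> \bar R}) (P Q : T -> Prop) :
  (\forall x \ae m, P x) -> (\forall x \ae m, Q x) -> \forall x \ae m, P x /\ Q x.
Proof.
move=> nP nQ; apply: negligibleS (negligibleU nP nQ) => x /= /not_andP.
by move=> [nPx|nQx]; [left|right].
Qed.

Section energy.
Context {R : realType} {d : nat}.
Notation V := 'rV[R]_d.+1.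
Notation leb := (@lebesgue_measure R).
Notation c := (force_cst d.+1 : R).

Lemma ball_regular_le (m : probability V R) K K' : ball_regular m K -> K <= K' ->
  ball_regular m K'.
Proof.
move=> mK KK' x r r0; rewrite (le_trans (mK x r r0))// lee_fin ler_wpM2r//.
by rewrite exprn_ge0// ltW.
Qed.

Variables (mu rho0 : probability V R) (rho : R -> probability V R) (K T : R).
Hypotheses (Hrho : weak_solution mu rho0 rho) (muK : ball_regular mu K) (K0 : 0 <= K).
Hypotheses (T0 : 0 < T)
  (rhoK : \forall t \ae leb, 0 <= t <= T -> ball_regular (rho t) K).
Variables (S dS : R -> R).
Hypothesis SdS : smooth_step S dS.
Notation r := (restart rho0 rho).

Lemma ae_regular_gt0 : \forall u \ae leb, 0 <= u <= T -> ball_regular (rho u) K /\ 0 < u.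
Proof.
have n0 : \forall u \ae leb, u != 0.
  exists [set 0]; split; first exact: measurable_set1.
    exact: lebesgue_measure_set1.
  by move=> u /= /negP/negPn/eqP.
apply: ae_mono (ae_and rhoK n0) => u [uK u0] /andP[u0' uT].
by split; [apply: uK; rewrite u0'|rewrite lt0r u0].
Qed.

(** A mass that moves at bounded speed changes its convolution with a smooth
    kernel at a bounded rate. *)
Lemma convol_lipschitz (k : V -> R) : compact_smooth k ->
  exists2 L, 0 <= L & forall x s t, 0 <= s -> s <= t -> t < T ->
    `|convol (r t) k x - convol (r s) k x| <= L * (t - s).
Proof.
move=> kC; have [D D0 kD] := compact_smooth_grad_bounded kC.
have L0 : 0 <= d.+1%:R * (@speed R d K * D).
  by rewrite mulr_ge0// mulr_ge0 ?speed_ge0// ltW.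
exists (d.+1%:R * (@speed R d K * D)) => // x s t s0.
rewrite le_eqVlt => /predU1P[->|st] tT; first by rewrite !subrr normr0 mulr0.
have inc (j : V -> R) : compact_smooth j -> (forall x i, `|grad j x 0 i| <= D) ->
    \int[r t]_y j y - \int[r s]_y j y <= d.+1%:R * (@speed R d K * D) * (t - s).
  move=> jC jD; apply: (compact_increment Hrho muK K0 T0 rhoK SdS) => //.
  apply: ae_mono rhoK => u uK /andP[su ut] y.
  rewrite (le_trans (ler_norm _))// (drift_le muK K0 _ (jD y))//.
  by apply: uK; rewrite (le_trans s0 su) (le_trans ut (ltW tT)).
have jC := compact_smooth_translate x kC.
have dj y i : is_derive y (delta_mx 0 i) (fun y => k (x - y)) ('D_(- delta_mx 0 i) k (x - y)).
  apply: is_derive_reflect; exact: (class_C_is_derive _ _ ((proj1 kC) 1%N)).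
have Dopp y i : 'D_(- delta_mx 0 i) k y = - 'D_(delta_mx 0 i) k y.
  have /is_derive_line dk := class_C_is_derive y (delta_mx 0 i) ((proj1 kC) 1%N).
  have dN : is_derive y (- delta_mx 0 i) k (- 'D_(delta_mx 0 i) k y).
    apply/is_derive_line.
    have := @is_derive1_comp R (fun h : R => k (h *: delta_mx 0 i + y)) -%R 0
      ('D_(delta_mx 0 i) k y) (-1).
    rewrite oppr0 mulrN1 => /(_ dk (is_deriveNid _ _)).
    congr (is_derive _ _ _ _); apply/funext => h /=.
    by rewrite scaleNr scalerN.
  by rewrite derive_val.
have jD y i : `|grad (fun y => k (x - y)) y 0 i| <= D.
  by rewrite (grad_is_derive (dj y i)) Dopp normrN; have := kD (x - y) i; rewrite mxE.
have jND y i : `|grad (fun y => - k (x - y)) y 0 i| <= D.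
  have dN := @is_deriveN R V R^o _ y _ _ (dj y i).
  by rewrite (grad_is_derive dN) normrN -(grad_is_derive (dj y i)).
have := inc _ jC jD; have := inc _ (compact_smoothN jC) jND.
have ik (m : probability V R) : m.-integrable setT (EFin \o (fun y : V => k (x - y))).
  have [B _ kB] := compact_smooth_bounded jC.
  by apply: (@bounded_integrable _ _ _ _ _ B) => //; apply: smooth_measurable; case: jC.
have EN (m : probability V R) : \int[m]_y (- k (x - y)) = - convol m k x.
  rewrite /convol -mulN1r -(RintegralZl _ measurableT (ik m)).
  by apply: eq_Rintegral => y _; rewrite mulN1r.
rewrite !EN -/(convol (r t) k x) -/(convol (r s) k x) ler_norml => H1 H2.
by apply/andP; split; lra.
Qed.

Lemma convol_add (m : probability V R) (k k' : V -> R) x :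
  m.-integrable setT (EFin \o (fun y : V => k (x - y))) ->
  m.-integrable setT (EFin \o (fun y : V => k' (x - y))) ->
  convol m (fun z => k z + k' z) x = convol m k x + convol m k' x.
Proof. by move=> ik ik'; rewrite /convol RintegralD. Qed.

Section kernel_scale.
Variables (e : R) (P f : R -> R).
Hypotheses (e0 : 0 < e) (Pf : radial_profile d.+1 (e ^+ 2) 1 P f).
Hypothesis eK : 2 ^+ d.+1 * K * e <= 1.
Notation G := (@cut_kernel R d P).
Notation dG i := (fun z : V => 'D_(delta_mx 0 i) G z).

(** The scale e is so small that the smoothing changes the force by at most c;
    the cutoff at distance 1 changes it by c as well. *)
Lemma kernel_force_remainder (m : probability V R) x i : ball_regular m K ->
  `|convol m (dG i) x + convol m (fun z => force z i) x| <= 2 * c.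
Proof.
move=> mK; have c0 := @force_cst_gt0 R d.
have GC := cut_kernel_compact_smooth Pf.
have dGC := compact_smooth_derive (delta_mx 0 i) GC.
have mdG : measurable_fun setT (dG i) by apply: smooth_measurable; case: dGC.
have [B _ dGB] := compact_smooth_bounded dGC.
have [iF _] := convol_force mK K0 i x.
have idG := @convol_integrable _ _ m (dG i) B x mdG dGB.
rewrite -(convol_add idG iF).
have mdGF : measurable_fun setT (fun z => dG i z + force z i).
  by apply: measurable_funD => //; exact: measurable_force.
have [_] := @convol_singular _ _ m K mK K0 _ e c c x mdGF e0 (ltW c0)
  (fun z => cut_kernel_derive_force e0 Pf z i).
move=> /le_trans; apply; rewrite mulr_natl mulr2n lerD2r.
by rewrite ler_piMr// ltW.
Qed.

Variables (phi : V -> R) (B : R).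
Hypotheses (Cphi : smooth phi) (phiB : forall x, `|phi x| <= B)
  (dphi1 : forall x i, `|grad phi x 0 i| <= 1).

(** Up to the self energy of mu this is the discrepancy for the truncated kernel,
    perturbed by an observable phi with bounded gradient. *)
Definition lyapunov (m : probability V R) : R :=
  2^-1 * \int[m]_x convol m G x - \int[m]_x convol mu G x + \int[m]_x phi x.

(** This is h^2 / 4 summed over the coordinates, with h as below. *)
Definition growth_rate : R := d.+1%:R * ((4 * c + 2) ^+ 2 / 4).

Lemma growth_rate_ge0 : 0 <= growth_rate.
Proof. by rewrite mulr_ge0// divr_ge0// sqr_ge0. Qed.

(** The increment of the quadratic functional is that of a linear one, psi,
    obtained by averaging the potentials at the two end times. Over a short time
    the gradient of psi is - v + h, where v is the velocity and h a bounded error,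
    and v . (- v + h) = - |v|^2 + v . h is at most |h|^2 / 4. The estimate holds at
    almost every single time, so that the energy dissipation need not be
    integrated. *)
Lemma lyapunov_increment : exists2 de, 0 < de &
  forall s t, 0 <= s -> s < t -> t < T -> t - s <= de ->
    lyapunov (r t) - lyapunov (r s) <= growth_rate * (t - s).
Proof.
have c0 := @force_cst_gt0 R d.
have GC := cut_kernel_compact_smooth Pf.
have [BG BG0 GB] := compact_smooth_bounded GC.
have mG : measurable_fun setT G by apply: smooth_measurable; case: GC.
have dGC i := compact_smooth_derive (delta_mx 0 i) GC.
have /choice[L LP] i : exists L, 0 <= L /\ forall x s t, 0 <= s -> s <= t -> t < T ->
    `|convol (r t) (dG i) x - convol (r s) (dG i) x| <= L * (t - s).
  by have [l l0 lP] := convol_lipschitz (dGC i); exists l.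
pose LL := 1 + \sum_i `|L i|.
have LL0 : 0 < LL by rewrite ltr_pwDl// sumr_ge0.
have LiLL i : L i <= LL.
  rewrite /LL (bigD1 i)//= (le_trans (ler_norm _))//.
  rewrite addrA [1 + _]addrC -addrA lerDl addr_ge0// sumr_ge0//.
(* In this time the convolution of rho with each derivative of G moves by at
   most 1. *)
exists LL^-1; first by rewrite invr_gt0.
move=> s t s0 st tT tsde.
pose psi x := 2^-1 * (convol (r t) G x + convol (r s) G x) - convol mu G x + phi x.
have CG m : smooth (convol m G) by exact: convol_smooth.
have Cpsi : smooth psi.
  move=> j; apply: class_CD => //.
  rewrite (_ : (fun _ => _) = (fun x => 2^-1 * (convol (r t) G x + convol (r s) G x)
    + -1 * convol mu G x)); last by apply/funext => x; rewrite mulN1r.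
  apply: class_CD; apply: class_CM; first exact: class_C_cst.
  - by apply: class_CD; exact: CG.
  - exact: class_C_cst.
  - exact: CG.
have GmB m x : `|convol m G x| <= BG by exact: convol_norm_le.
have iG (m m' : probability V R) : m.-integrable setT (EFin \o convol m' G).
  by apply: (@bounded_integrable _ _ _ _ _ BG) => //; exact: measurable_convol.
have iphi (m : probability V R) : m.-integrable setT (EFin \o phi).
  by apply: (@bounded_integrable _ _ _ _ _ B) => //; exact: smooth_measurable.
have psiE (m : probability V R) : \int[m]_x psi x =
    2^-1 * (\int[m]_x convol (r t) G x + \int[m]_x convol (r s) G x)
    - \int[m]_x convol mu G x + \int[m]_x phi x.
  have i1 := integrable_addr (iG m (r t)) (iG m (r s)).
  have i2 := integrable_mulr 2^-1 i1.
  have i3 := integrable_subr i2 (iG m mu).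
  rewrite /psi (RintegralD measurableT i3 (iphi m)) (RintegralB measurableT i2 (iG m mu)).
  by rewrite (RintegralZl _ measurableT i1) (RintegralD measurableT (iG m (r t)) (iG m (r s))).
have psi_diff : lyapunov (r t) - lyapunov (r s) = \int[r t]_x psi x - \int[r s]_x psi x.
  rewrite !psiE /lyapunov (convol_sym (r t) (r s) mG GB (cut_kernelN P)); lra.
rewrite psi_diff.
apply: (bounded_increment Hrho muK K0 T0 rhoK SdS (B := BG + BG + B)) => //.
- exact: growth_rate_ge0.
- move=> x; rewrite (le_trans (ler_normD _ _))// lerD//.
  rewrite (le_trans (ler_normB _ _))// lerD//.
  rewrite normrM gtr0_norm ?invr_gt0//.
  have := ler_normD (convol (r t) G x) (convol (r s) G x).
  have := GmB (r t) x; have := GmB (r s) x; lra.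
apply: ae_mono ae_regular_gt0 => u uK /andP[su ut].
have {uK}[uK u0] : ball_regular (rho u) K /\ 0 < u.
  by apply: uK; rewrite (le_trans s0 su) (le_trans ut (ltW tT)).
split=> // x.
have ruE : r u = rho u by rewrite /restart leNgt u0.
have -> : growth_rate = \sum_(i < d.+1) ((4 * c + 2) ^+ 2 / 4).
  by rewrite /growth_rate sumr_const card_ord mulr_natl.
rewrite /drift /dot; apply: ler_sum => i _.
pose F m := convol m (fun z : V => force z i) x.
pose g m := convol m (dG i) x.
have gradE : grad psi x 0 i = 2^-1 * (g (r t) + g (r s)) - g mu + grad phi x 0 i.
  have dm m : is_derive x (delta_mx 0 i) (convol m G) (g m) by exact: is_derive_convol.
  have d1 := @is_deriveD R V R^o _ _ x _ _ _ (dm (r t)) (dm (r s)).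
  have d2 := @is_deriveZ R V R^o _ 2^-1 x _ _ d1.
  have d3 := @is_deriveB R V R^o _ _ x _ _ _ d2 (dm mu).
  have d4 := @is_deriveD R V R^o _ _ x _ _ _ d3
    (class_C_is_derive x (delta_mx 0 i) (Cphi 1%N)).
  by rewrite (grad_is_derive d4) [in RHS]mxE.
rewrite gradE (velocityE x i uK muK K0) -/(F (rho u)) -/(F mu).
have q1 : `|g (rho u) + F (rho u)| <= 2 * c by exact: kernel_force_remainder.
have q2 : `|g mu + F mu| <= 2 * c by exact: kernel_force_remainder.
have q3 := dphi1 x i.
have lip a b : 0 <= a -> a <= b -> b < T -> b - a <= LL^-1 -> `|g (r b) - g (r a)| <= 1.
  move=> a0 ab bT bade; have [Li0 /(_ x a b a0 ab bT) H] := LP i.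
  rewrite (le_trans H)// (@le_trans _ _ (LL * LL^-1))//; last by rewrite divff ?gt_eqF.
  by rewrite ler_pM ?subr_ge0.
have q4 : `|g (r t) - g (rho u)| <= 1.
  by rewrite -ruE; apply: lip => //; [exact: ltW|lra].
have q5 : `|g (r s) - g (rho u)| <= 1.
  by rewrite distrC -ruE; apply: lip => //; [lra|lra].
move: q1 q2 q3 q4 q5; move: (g (rho u)) (F (rho u)) (g mu) (F mu) (g (r t)) (g (r s)).
move: (grad phi x 0 i) => p gu Fu gm Fm gt gs; rewrite !ler_norml.
move=> /andP[? ?] /andP[? ?] /andP[? ?] /andP[? ?] /andP[? ?].
pose v := Fu - Fm; pose h := 2^-1 * (gt + gs) - gm + p + v.
(* Two force remainders, each at most 2 c, the delay in time and phi. *)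
have hle : h ^+ 2 <= (4 * c + 2) ^+ 2.
  rewrite -real_normK ?num_real// lerXn2r ?nnegrE// ?addr_ge0 ?mulr_ge0 ?(ltW c0)//.
  by rewrite ler_norml /h /v; apply/andP; split; lra.
have -> : (Fu - Fm) * (2^-1 * (gt + gs) - gm + p) = v * h - v ^+ 2.
  by rewrite /h /v; ring.
have : 0 <= (v - h / 2) ^+ 2 by exact: sqr_ge0.
have -> : (v - h / 2) ^+ 2 = v ^+ 2 - v * h + h ^+ 2 / 4 by field.
lra.
Qed.

(** Summation over a subdivision into short steps. *)
Lemma lyapunov_growth t : 0 <= t -> t < T ->
  lyapunov (r t) - lyapunov rho0 <= growth_rate * t.
Proof.
move=> t0 tT; have [de de0 inc] := lyapunov_increment.
have r0 : r 0 = rho0 by rewrite /restart lexx.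
have [->|tn0] := eqVneq t 0; first by rewrite r0 subrr mulr0.
have tp : 0 < t by rewrite lt0r tn0.
pose n := (Num.bound (t / de)).+1; pose q := t / n%:R.
have n0 : 0 < n%:R :> R by rewrite ltr0n.
have q0 : 0 < q by rewrite divr_gt0.
have qde : q <= de.
  rewrite ler_pdivrMr// mulrC -ler_pdivrMr//.
  have td0 : 0 <= t / de by rewrite divr_ge0// ltW.
  by rewrite (le_trans (ltW (archi_boundP td0)))// ler_nat.
have chain k : (k <= n)%N ->
    lyapunov (r (k%:R * q)) - lyapunov rho0 <= growth_rate * (k%:R * q).
  elim: k => [|k IH] kn; first by rewrite !mul0r r0 subrr mulr0.
  have kq : k.+1%:R * q - k%:R * q = q by rewrite -mulrBl -natrB// subSnn mul1r.
  have := IH (ltnW kn).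
  have := inc (k%:R * q) (k.+1%:R * q); rewrite kq => /(_ _ _ _ qde) H.
  have {H} : lyapunov (r (k.+1%:R * q)) - lyapunov (r (k%:R * q)) <= growth_rate * q.
    apply: H; first by rewrite mulr_ge0// ltW.
      by rewrite ltr_pM2r// ltr_nat.
    apply: le_lt_trans tT; rewrite /q mulrA ler_pdivrMr// mulrC ler_pM2l//.
    by rewrite ler_nat.
  have -> : growth_rate * (k.+1%:R * q) = growth_rate * (k%:R * q) + growth_rate * q.
    by rewrite -natr1; ring.
  lra.
by have := chain n (leqnn _); rewrite /q mulrCA divff ?mulr1// gt_eqF.
Qed.

End kernel_scale.
End energy.

(** * Growth of bounded observables *)

Section moment.
Context {R : realType} {d : nat}.
Notation V := 'rV[R]_d.+1.
Notation leb := (@lebesgue_measure R).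
Notation c := (force_cst d.+1 : R).

(** The bound on the potential of the truncated kernel comes from its
    singularity, uniformly in the truncation scale. *)
Definition potential_bound (K : R) : R := 2 * c * (2 ^+ d.+1 * K * 2).

Lemma cut_kernel_convol_le (m : probability V R) K e (P f : R -> R) x :
  ball_regular m K -> 0 <= K -> 0 < e -> radial_profile d.+1 (e ^+ 2) 1 P f ->
  convol m (@cut_kernel R d P) x <= potential_bound K.
Proof.
move=> mK K0 e0 Pf; have c0 := @force_cst_gt0 R d.
pose k z := Num.min (@cut_kernel R d P z) (2 * c * singular 2 z).
have GC := cut_kernel_compact_smooth Pf.
have mk : measurable_fun setT k.
  apply: measurable_minr; first by apply: smooth_measurable; case: GC.
  apply: measurable_funM; first exact: measurable_cst.
  exact: measurable_singular.
have S0 z : 0 <= 2 * c * @singular R d 2 z.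
  by rewrite mulr_ge0 ?singular_ge0// mulr_ge0// ltW.
have kS z : `|k z| <= 2 * c * singular 2 z + 0.
  rewrite addr0 ger0_norm ?ge_min ?lexx ?orbT//.
  by rewrite le_min (cut_kernel_ge0 Pf) S0.
have c20 : 0 <= 2 * c by rewrite mulr_ge0// ltW.
have [ik kle] := convol_singular mK K0 x mk (ltr0Sn _ 1) c20 kS.
have [_ ->] : m.-integrable setT (EFin \o (fun y : V => @cut_kernel R d P (x - y))) /\
    convol m (@cut_kernel R d P) x = convol m k x.
  apply: (convol_off0 mK K0 ik) => z z0.
  by rewrite /k; apply/esym/min_idPl; exact: (cut_kernel_le Pf).
by rewrite (le_trans (ler_norm _))// (le_trans kle)// addr0.
Qed.

(** The truncated energies are nonnegative, and those involving mu or the initial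
    datum are bounded in terms of K. So the growth of the Lyapunov functional
    bounds that of phi. The bound on the density of the solution up to time t
    only affects the truncation scale, which has disappeared from the result. *)
Lemma moment_bound (mu rho0 : probability V R)
  (rho : R -> probability V R) (K B t : R) (phi : V -> R) (S dS : R -> R) :
  smooth_step S dS -> weak_solution mu rho0 rho ->
  ball_regular mu K -> ball_regular rho0 K -> 0 <= K -> 0 <= t ->
  smooth phi -> (forall x, `|phi x| <= B) ->
  (forall x i, `|grad phi x 0 i| <= 1) ->
  \int[restart rho0 rho t]_x phi x <=
    \int[rho0]_x phi x + @growth_rate R d * t + 2 * potential_bound K.
Proof.
move=> SdS Hrho muK rho0K K0 t0 Cphi phiB dphi1; have c0 := @force_cst_gt0 R d.
pose T := t + 1.
have T0 : 0 < T by rewrite ltr_wpDl.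
have tT : t < T by rewrite ltrDl.
have [_ /(_ T T0)[M rhoM] _] := Hrho.
pose K' := Num.max K (Num.max M 0 * 2 ^+ d.+1).
have K'0 : 0 <= K' by rewrite le_max K0.
have muK' : ball_regular mu K'.
  by apply: (ball_regular_le muK); rewrite le_max lexx.
have rhoK' : \forall u \ae leb, 0 <= u <= T -> ball_regular (rho u) K'.
  apply: ae_mono rhoM => u uM /uM/Linfty_le_regular uK.
  by apply: (ball_regular_le uK); rewrite le_max lexx orbT.
pose X := 2 ^+ d.+1 * K' + 1.
have X0 : 0 < X by rewrite ltr_wpDl// mulr_ge0// exprn_ge0.
have e0 : 0 < X^-1 by rewrite invr_gt0.
have eK : 2 ^+ d.+1 * K' * X^-1 <= 1.
  by rewrite ler_pdivrMr// mul1r /X lerDl.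
have e20 : 0 < X^-1 ^+ 2 by rewrite exprn_gt0.
have [P [f Pf]] := radial_profile_exists d.+1 1 SdS e20.
have := lyapunov_growth Hrho muK' K'0 T0 rhoK' SdS e0 Pf eK Cphi phiB dphi1 t0 tT.
rewrite /lyapunov; set G := cut_kernel P.
have GC : compact_smooth G := cut_kernel_compact_smooth Pf.
have [BG BG0 GB] := compact_smooth_bounded GC.
have mG : measurable_fun setT G by apply: smooth_measurable; case: GC.
have iG (m m' : probability V R) : m.-integrable setT (EFin \o convol m' G).
  apply: (@bounded_integrable _ _ _ _ _ BG); first exact: measurable_convol.
  by move=> x; exact: convol_norm_le.
have G0 (m : probability V R) x : 0 <= convol m G x.
  by apply: Rintegral_ge0 => y _; exact: (cut_kernel_ge0 Pf).
have I0 (m m' : probability V R) : 0 <= \int[m]_x convol m' G x.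
  by apply: Rintegral_ge0 => y _; exact: G0.
have I1 (m m' : probability V R) : ball_regular m' K ->
    \int[m]_x convol m' G x <= potential_bound K.
  move=> m'K; apply: Rintegral_le => // x.
  exact: (cut_kernel_convol_le _ m'K K0 e0 Pf).
set r := restart rho0 rho t.
have := I0 rho0 rho0; have := I0 r r; have := I1 r mu muK; have := I0 rho0 mu.
have := I1 rho0 rho0 rho0K; lra.
Qed.
End moment.

(** * Bounds on the Coulomb kernel *)

Section coulomb_bounds.
Context {R : realType}.

Lemma measurable_coulomb d : measurable_fun setT (@coulomb R d.+1).
Proof.
have me := @measurable_enorm R d.
case: d me => [|[|d]] me; rewrite /coulomb.
- rewrite (_ : (fun _ => _) = (fun x : 'rV[R]_1 => - 2^-1 * enorm x)).
    by apply: measurable_funM => //; exact: measurable_cst.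
  by apply/funext => x; rewrite mulNr mulrC.
- rewrite (_ : (fun _ => _) = (fun x : 'rV[R]_2 => - (2 * pi)^-1 * ln (enorm x))).
    apply: measurable_funM; first exact: measurable_cst.
    exact: (measurableT_comp (@measurable_ln R)).
  by apply/funext => x; rewrite mulNr.
- apply: measurable_funM; first exact: measurable_cst.
  apply: measurable_funV => [x|]; first by rewrite exprn_ge0// enorm_ge0.
  by apply: measurable_funX.
Qed.

Lemma coulombN d (z : 'rV[R]_d.+1) : coulomb (- z) = coulomb z.
Proof. by case: d z => [|[|d]] z; rewrite /coulomb enormN. Qed.

(** Both one-sided bounds hold at 0 as well, where the kernel takes the value 0. *)
Lemma coulomb_bounds d : exists2 C, 0 <= C &
  (forall z : 'rV[R]_d.+1, coulomb z <= C * (1 + singular 1 z)) /\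
  (forall z : 'rV[R]_d.+1, - (C * (1 + `|z|)) <= coulomb z).
Proof.
case: d => [|[|d]].
- exists 2^-1; first by rewrite invr_ge0.
  split=> z; rewrite /coulomb.
    have s0 := singular_ge0 1 z; have e0 := enorm_ge0 z.
    apply: (@le_trans _ _ 0); first by rewrite oppr_le0 divr_ge0.
    by rewrite mulr_ge0 ?invr_ge0// addr_ge0.
  rewrite lerN2 mulrC ler_pM2l ?invr_gt0//.
  by rewrite (le_trans (enorm_le_norm z))// mul1r lerDr.
- have p0 := @pi_gt0 R; have c0 : 0 < (2 * pi)^-1 :> R by rewrite invr_gt0 mulr_gt0.
  exists ((2 * pi)^-1 * 2); first by rewrite mulr_ge0// ltW.
  split=> z; rewrite /coulomb.
    have s0 := singular_ge0 1 z.
    rewrite -mulrN -mulrA ler_pM2l//.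
    have [->|z0] := eqVneq z 0.
      rewrite enorm0.
      by rewrite ln0// oppr0 mulr_ge0// addr_ge0// singular_ge0.
    have e0 : 0 < enorm z by rewrite enorm_gt0.
    have := enormVX_singular z (@ltr01 R); rewrite expr1 expr1n invr1.
    have : - ln (enorm z) <= (enorm z)^-1.
      by rewrite -lnV ?posrE// ltW// ln_sublinear// invr_gt0.
    lra.
  rewrite lerN2 -mulrA ler_pM2l//.
  have [->|z0] := eqVneq z 0.
    rewrite enorm0.
    by rewrite ln0// mulr_ge0// addr_ge0.
  have e0 : 0 < enorm z by rewrite enorm_gt0.
  have := enorm_le_norm z; have : ln (enorm z) < enorm z by exact: ln_sublinear.
  lra.
- pose b : R := ((d.+1)%:R * sphere_area d.+3)^-1.
  have b0 : 0 < b by rewrite invr_gt0 mulr_gt0 ?ltr0n// sphere_area_gt0.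
  exists (b * 2); first by rewrite mulr_ge0// ltW.
  have gE (z : 'rV[R]_d.+3) : coulomb z = b * enorm z ^- d.+1 by [].
  have g0 (z : 'rV[R]_d.+3) : 0 <= coulomb z.
    by rewrite gE mulr_ge0 ?(ltW b0)// invr_ge0 exprn_ge0 ?enorm_ge0.
  split=> z; last first.
    apply: le_trans (g0 z); rewrite oppr_le0.
    by rewrite mulr_ge0 ?addr_ge0// mulr_ge0// ltW.
  rewrite gE -mulrA ler_pM2l//.
  have s0 := singular_ge0 1 z.
  have [->|z0] := eqVneq z 0.
    rewrite enorm0.
    by rewrite expr0n/= invr0 mulr_ge0// addr_ge0// singular_ge0.
  have e0 : 0 < enorm z by rewrite enorm_gt0.
  have := enormVX_singular z (@ltr01 R); rewrite expr1n invr1.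
  have : enorm z ^- d.+1 <= 1 + enorm z ^- d.+2.
    have [z1|z1] := leP (enorm z) 1.
      rewrite ler_wpDl// lef_pV2 ?posrE ?exprn_gt0// [leLHS]exprS ler_piMl//.
      by rewrite exprn_ge0// ltW.
    rewrite ler_wpDr ?invr_ge0 ?exprn_ge0 ?(ltW e0)// invf_le1 ?exprn_gt0//.
    by rewrite exprn_ege1// ltW.
  lra.
Qed.

End coulomb_bounds.

(** * Interaction energies *)

Section interaction.
Context {R : realType} {d : nat}.
Notation V := 'rV[R]_d.+1.
Notation g := (@coulomb R d.+1).
Implicit Types p q : probability V R.

Definition moment (p : probability V R) (a : V) : R := \int[p]_x `|x - a|.

Definition tame p (a : V) (K : R) :=
  [/\ ball_regular p K, 0 <= K & p.-integrable setT (EFin \o (fun x : V => `|x - a|))].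

Definition interaction p q : R := \int[p]_x convol q g x.

Variables (C : R) (a : V).
Hypotheses (C0 : 0 <= C) (g_ub : forall z : V, g z <= C * (1 + singular 1 z))
  (g_lb : forall z : V, - (C * (1 + `|z|)) <= g z).

Lemma coulomb_norm_le (x y : V) :
  `|g (x - y)| <= C * (1 + singular 1 (x - y) + (`|x - a| + `|y - a|)).
Proof.
have s0 := singular_ge0 1 (x - y).
have xy : `|x - y| <= `|x - a| + `|y - a|.
  by rewrite (distrC y a) ler_distD.
have u0 : 0 <= `|x - y| by [].
rewrite ler_norml; apply/andP; split.
  apply: le_trans (g_lb _); rewrite lerN2 ler_wpM2l//; lra.
by apply: (le_trans (g_ub _)); rewrite ler_wpM2l//; lra.
Qed.

Section single.
Variables (q : probability V R) (K : R).
Hypothesis qK : tame q a K.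

Lemma majorant_integral x :
  q.-integrable setT
    (EFin \o (fun y : V => C * (1 + singular 1 (x - y) + (`|x - a| + `|y - a|)))) /\
  \int[q]_y (C * (1 + singular 1 (x - y) + (`|x - a| + `|y - a|))) <=
    C * (1 + 2 ^+ d.+1 * K + (`|x - a| + moment q a)).
Proof.
have [qr K0 iq] := qK; have [iS Sle] := singular_integrable qr K0 x ltr01.
have i1 := integrable_addr (integrable_cstr q 1) iS.
have i2 := integrable_addr (integrable_cstr q `|x - a|) iq.
have i3 := integrable_addr i1 i2; split; first exact: integrable_mulr.
rewrite (RintegralZl _ measurableT i3) ler_wpM2l// (RintegralD measurableT i1 i2).
rewrite (RintegralD measurableT (integrable_cstr q 1) iS).
rewrite (RintegralD measurableT (integrable_cstr q `|x - a|) iq) !Rintegral_cst1.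
by rewrite mulr1 in Sle; rewrite lerD// lerD.
Qed.

Lemma coulomb_integrable x :
  q.-integrable setT (EFin \o (fun y : V => g (x - y))).
Proof.
have [iM _] := majorant_integral x.
apply: (dominated_integrable _ _ iM) => [|y]; last exact: coulomb_norm_le.
exact: (measurable_convol_kernel _ (@measurable_coulomb R d)).
Qed.

Lemma convol_coulomb_ub x : convol q g x <= C * (1 + 2 ^+ d.+1 * K).
Proof.
have [qr K0 _] := qK; have [iS Sle] := singular_integrable qr K0 x ltr01.
have i1 := integrable_addr (integrable_cstr q 1) iS.
apply: (@le_trans _ _ (\int[q]_y (C * (1 + singular 1 (x - y))))).
  apply: le_Rintegral => //; [exact: coulomb_integrable|exact: integrable_mulr].
rewrite (RintegralZl _ measurableT i1) ler_wpM2l//.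
rewrite (RintegralD measurableT (integrable_cstr q 1) iS) Rintegral_cst1 lerD2l.
by rewrite mulr1 in Sle.
Qed.

Lemma convol_coulomb_lb x al be : 0 <= be ->
  (forall z : V, - (al + be * `|z|) <= g z) ->
  - (al + be * (`|x - a| + moment q a)) <= convol q g x.
Proof.
move=> be0 gl; have [_ _ iq] := qK.
have i2 := integrable_addr (integrable_cstr q `|x - a|) iq.
have i3 := integrable_mulr be i2.
have i4 := integrable_addr (integrable_cstr q al) i3.
have i5 := integrable_mulr (-1) i4.
apply: (@le_trans _ _ (\int[q]_y (-1 * (al + be * (`|x - a| + `|y - a|))))).
  rewrite (RintegralZl _ measurableT i4) mulN1r.
  rewrite (RintegralD measurableT (integrable_cstr q al) i3).
  rewrite (RintegralZl _ measurableT i2).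
  by rewrite (RintegralD measurableT (integrable_cstr q `|x - a|) iq) !Rintegral_cst1.
apply: le_Rintegral => //; first exact: coulomb_integrable.
move=> y _; rewrite mulN1r; apply: le_trans (gl _); rewrite lerN2 lerD2l ler_wpM2l//.
by rewrite (distrC y a) ler_distD.
Qed.

End single.

Section pair.
Variables (p q : probability V R) (Kp Kq : R).
Hypotheses (pK : tame p a Kp) (qK : tame q a Kq).

Lemma convol_coulomb_integrable : p.-integrable setT (EFin \o convol q g).
Proof.
have [_ _ ip] := pK; have [_ Kq0 iq] := qK.
have i1 := integrable_addr ip (integrable_cstr p (moment q a)).
have i2 := integrable_mulr C
  (integrable_addr (integrable_cstr p (1 + 2 ^+ d.+1 * Kq)) i1).
apply: (dominated_integrable _ _ i2) => [|x].
  exact: (measurable_convol _ (@measurable_coulomb R d)).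
have m0 : 0 <= moment q a by apply: Rintegral_ge0.
have x0 : 0 <= `|x - a| by [].
have K0 : 0 <= 2 ^+ d.+1 * Kq by rewrite mulr_ge0// exprn_ge0.
rewrite ler_norml; apply/andP; split.
  have g_lb' z : - (C + C * `|z|) <= g z by rewrite -{1}[C]mulr1 -mulrDr.
  apply: le_trans (convol_coulomb_lb qK x C0 g_lb'); rewrite lerN2.
  by rewrite -[X in X + _ <= _]mulr1 -mulrDr ler_wpM2l//; lra.
by apply: (le_trans (convol_coulomb_ub qK x)); rewrite ler_wpM2l//; lra.
Qed.

Lemma interaction_ub : interaction p q <= C * (1 + 2 ^+ d.+1 * Kq).
Proof.
apply: Rintegral_le; first exact: convol_coulomb_integrable.
exact: convol_coulomb_ub qK.
Qed.

Lemma interaction_lb al be : 0 <= be ->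
  (forall z : V, - (al + be * `|z|) <= g z) ->
  - (al + be * (moment p a + moment q a)) <= interaction p q.
Proof.
move=> be0 gl; have [_ _ ip] := pK.
have i1 := integrable_addr ip (integrable_cstr p (moment q a)).
have i2 := integrable_mulr be i1.
have i3 := integrable_addr (integrable_cstr p al) i2.
have i4 := integrable_mulr (-1) i3.
apply: (@le_trans _ _ (\int[p]_x (-1 * (al + be * (`|x - a| + moment q a))))).
  rewrite (RintegralZl _ measurableT i3) mulN1r.
  rewrite (RintegralD measurableT (integrable_cstr p al) i2).
  rewrite (RintegralZl _ measurableT i1).
  by rewrite (RintegralD measurableT ip (integrable_cstr p _)) !Rintegral_cst1.
apply: le_Rintegral => //; first exact: convol_coulomb_integrable.
by move=> x _; rewrite mulN1r; exact: (convol_coulomb_lb qK x be0 gl).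
Qed.

Lemma interaction_sym : interaction p q = interaction q p.
Proof.
have [_ _ ip] := pK.
have i1 := integrable_addr ip (integrable_cstr p (moment q a)).
have i2 := integrable_mulr C
  (integrable_addr (integrable_cstr p (1 + 2 ^+ d.+1 * Kq)) i1).
apply: (convol_exchange (@measurable_coulomb R d) (@coulombN R d)
  (coulomb_integrable pK) (coulomb_integrable qK) i2) => x.
have [iM Mle] := majorant_integral qK x; apply: le_trans Mle.
apply: le_Rintegral => //; first exact: integrable_norm (coulomb_integrable qK x).
by move=> y _; exact: coulomb_norm_le.
Qed.

End pair.

Lemma MMD2E p q Kp Kq : tame p a Kp -> tame q a Kq ->
  MMD2 p q = (2^-1 * (interaction p p + interaction q q) - interaction p q)%:E.
Proof.
move=> pK qK.
have inner m K x : tame m a K -> (\int[m]_y (g (x - y))%:E)%E = (convol m g x)%:E.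
  move=> mK; rewrite fineK//; apply: integrable_fin_num => //.
  exact: coulomb_integrable mK x.
have pot x : potential p q x = (convol p g x - convol q g x)%:E.
  by rewrite /potential (inner _ _ x pK) (inner _ _ x qK).
have I m K : tame m a K -> (\int[m]_x potential p q x)%E =
    (interaction m p - interaction m q)%:E.
  move=> mK; under eq_integral do rewrite pot.
  have ip := convol_coulomb_integrable mK pK.
  have iq := convol_coulomb_integrable mK qK.
  have ipq := integrable_subr ip iq.
  rewrite -(fineK (integrable_fin_num measurableT ipq)); congr _%:E.
  exact: (RintegralB measurableT ip iq).
rewrite /MMD2 (I _ _ pK) (I _ _ qK) (interaction_sym qK pK) -EFinB -EFinM.
by congr _%:E; field.
Qed.

End interaction.

(** * Moments *)

Section integrals_ae.
Context {R : realType} (dT : measure_display) (T : measurableType dT).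
Variable m : probability T R.
Implicit Types f : T -> R.

Lemma truncated_integral f (k : R) : measurable_fun setT f -> (forall x, 0 <= f x) ->
  (forall n, \int[m]_x Num.min (f x) n.+1%:R <= k) ->
  m.-integrable setT (EFin \o f) /\ \int[m]_x f x <= k.
Proof.
move=> mf f0 fk.
pose h n x := Num.min (f x) n.+1%:R.
have h0 n x : 0 <= h n x by rewrite le_min f0 ler0n.
have mh n : measurable_fun setT (h n).
  by apply: measurable_minr => //; exact: measurable_cst.
have ih n : m.-integrable setT (EFin \o h n).
  apply: (@bounded_integrable _ _ _ _ _ n.+1%:R) => // x.
  by rewrite ger0_norm// ge_min lexx orbT.
have hlim x : (h n x)%:E @[n --> \oo] --> (f x)%:E.
  apply: cvg_near_cst; have := @nbhs_infty_gtr R (f x).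
  apply: filterS => n xn; congr EFin; apply/min_idPl.
  by rewrite (le_trans (ltW xn))// ler_nat.
have le : (\int[m]_x (f x)%:E <= k%:E)%E.
  have E : (\int[m]_x (f x)%:E = \int[m]_x limn (fun n => (h n x)%:E))%E.
    by apply: eq_integral => x _; rewrite (cvg_lim _ (hlim x)).
  rewrite E monotone_convergence//.
  - apply: lime_le.
      apply: ereal_nondecreasing_is_cvgn => i j ij; apply: ge0_le_integral => //.
      + by move=> x _; rewrite lee_fin.
      + exact/measurable_EFinP.
      + exact/measurable_EFinP.
      + move=> x _; rewrite lee_fin le_min /h ge_min lexx/= ge_min.
        by rewrite ler_nat ltnS ij orbT.
    apply: nearW => n; rewrite -(fineK (integrable_fin_num measurableT (ih n))) lee_fin.
    exact: fk.
  - by move=> n; exact/measurable_EFinP.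
  - by move=> n x _; rewrite lee_fin.
  - move=> x _ i j ij; rewrite lee_fin le_min /h ge_min lexx/= ge_min.
    by rewrite ler_nat ltnS ij orbT.
have [|i1 i2] := @Rintegral_norm_le_nneg R _ _ m f k mf.
  by under eq_integral do rewrite ger0_norm//.
split=> //; apply: le_trans i2; rewrite le_eqVlt; apply/orP; left; apply/eqP.
by apply: eq_Rintegral => x _; rewrite ger0_norm.
Qed.

Lemma Rintegral_ge_ae f (b : R) : m.-integrable setT (EFin \o f) ->
  (\forall x \ae m, b <= f x) -> b <= \int[m]_x f x.
Proof.
move=> fi fb; rewrite -[leLHS](Rintegral_cst1 m).
apply: (@le_Rintegral_ae _ _ _ m setT _ _ `|b|) => //.
  by rewrite -ge0_fin_numE// fin_num_measure.
apply: ae_mono fb => x bf _; rewrite bf andbT.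
by have := ler_norm (- b); rewrite normrN lerNl.
Qed.

Lemma Rintegral_le_ae f (b : R) : m.-integrable setT (EFin \o f) ->
  (\forall x \ae m, f x <= b) -> \int[m]_x f x <= b.
Proof.
move=> fi fb; have iN := integrable_mulr (-1) fi.
have := @Rintegral_ge_ae (fun x => -1 * f x) (- b) iN.
rewrite (RintegralZl _ measurableT fi) mulN1r lerN2; apply.
by apply: ae_mono fb => x; rewrite mulN1r lerN2.
Qed.

Lemma integrable_ae_bounded f (b : R) : measurable_fun setT f -> (forall x, 0 <= f x) ->
  0 <= b -> (\forall x \ae m, f x <= b) -> m.-integrable setT (EFin \o f).
Proof.
move=> mf f0 b0 fb; have [|//] := @Rintegral_norm_le_nneg R _ _ m f b mf.
rewrite -[leRHS](integral_cst1 m); apply: ae_ge0_le_integral => //.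
- by apply/measurable_EFinP; exact: measurableT_comp.
- by apply: ae_mono fb => x xb _; rewrite lee_fin ger0_norm.
Qed.

End integrals_ae.

Section moments.
Context {R : realType} {d : nat}.
Notation V := 'rV[R]_d.+1.

Lemma measurable_dist (a : V) : measurable_fun setT (fun x : V => `|x - a|).
Proof.
apply: continuous_measurable_mx => x.
apply: (@continuous_comp V V R (fun x : V => x - a) (fun y : V => `|y|)).
  by apply: continuousB => //; exact: cst_continuous.
exact: norm_continuous.
Qed.

(** The profile is 1-Lipschitz as a function of the position, because its
    density is at most half the inverse square root. *)
Lemma profile_around (a : V) b P f : radial_profile 1 1 b P f ->
  let phi (x : V) := P (dot (x - a) (x - a)) in
  [/\ smooth phi, forall x, `|phi x| <= P (b + 1),
      forall x i, `|grad phi x 0 i| <= 1 &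
      forall x, 0 <= phi x <= d.+1%:R * `|x - a|].
Proof.
move=> Pf phi; have [[CP _] dP [f0 fle] _ _] := Pf.
have P0 u : 0 <= P u := radial_profile_ge0 Pf u ltr01.
split=> [|x|x i|x].
- exact: (smooth_translate a (@smooth_radial R d.+1 P CP)).
- rewrite ger0_norm ?P0//.
  have [ub|/ltW ub] := leP (dot (x - a) (x - a)) (b + 1).
    exact: (radial_profile_ndecr Pf).
  by rewrite /phi (radial_profile_cst Pf ub).
- set z := x - a.
  have D : is_derive x (delta_mx 0 i) phi (f (dot z z) * (2 * dot z (delta_mx 0 i))).
    apply: (@is_derive_translate _ _ (fun x => P (dot x x))).
    exact: is_derive_radial.
  rewrite (grad_is_derive D) dot_delta.
  have [z0|z0] := eqVneq z 0; first by rewrite z0 mxE !mulr0 normr0.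
  have e0 : 0 < enorm z by rewrite enorm_gt0.
  have u0 : 0 < dot z z by rewrite -sqrtr_gt0.
  have zi : `|z 0 i| <= enorm z.
    by rewrite (le_trans (coord_norm_le z i))// norm_le_enorm.
  rewrite !normrM (ger0_norm (f0 _)) (ger0_norm (ler0n _ 2)).
  apply: (@le_trans _ _ (2^-1 * (enorm z)^-1 * (2 * enorm z))).
    apply: ler_pM; [exact: f0|by []| |by rewrite ler_pM2l].
    by have := fle _ u0; rewrite expr1.
  by rewrite le_eqVlt; apply/orP; left; apply/eqP; field; rewrite gt_eqF.
- rewrite P0/= (le_trans _ (enorm_le_norm _))//.
  by apply: (radial_profile1_le Pf) => //; exact: dot_ge0.
Qed.

(** The truncated distances of the moment estimate exhaust the distance. *)
Lemma moment_of_profiles (S dS : R -> R) (p : probability V R) (a : V) (k : R) :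
  smooth_step S dS ->
  (forall b P f, radial_profile 1 1 b P f ->
     \int[p]_x P (dot (x - a) (x - a)) <= k) ->
  p.-integrable setT (EFin \o (fun x : V => `|x - a|)) /\ moment p a <= k + 1.
Proof.
move=> SdS Pk; apply: truncated_integral => //; first exact: measurable_dist.
move=> n; pose b : R := n.+1%:R ^+ 2.
have b1 : 1 <= b by rewrite exprn_ege1// ler1n.
have [P [f Pf]] := radial_profile_exists 1 b SdS (@ltr01 R).
have [CPa PB _ _] := profile_around a Pf.
have iP : p.-integrable setT (EFin \o (fun x : V => P (dot (x - a) (x - a)))).
  by apply: (@bounded_integrable _ _ _ _ _ (P (b + 1))) => //; exact: smooth_measurable.
apply: (@le_trans _ _ (\int[p]_x (P (dot (x - a) (x - a)) + 1))); last first.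
  rewrite (RintegralD measurableT iP (integrable_cstr p 1)) Rintegral_cst1 lerD2r.
  exact: Pk Pf.
apply: le_Rintegral => //.
- apply: (@bounded_integrable _ _ _ _ _ n.+1%:R) => [|x].
    apply: measurable_minr; first exact: measurable_dist.
    exact: measurable_cst.
  by rewrite ger0_norm ?le_min ?normr_ge0 ?ler0n// ge_min lexx orbT.
- exact: integrable_addr iP (integrable_cstr p 1).
move=> x _; set u := dot (x - a) (x - a).
have xu : `|x - a| <= Num.sqrt u by exact: norm_le_enorm.
have P0 : 0 <= P u by exact: (radial_profile_ge0 Pf).
have u0 : 0 <= u by exact: dot_ge0.
rewrite ge_min; have [u1|u1] := leP u 1.
  have : Num.sqrt u <= 1 by rewrite -sqrtr1 ler_sqrt.
  by move=> su; apply/orP; left; lra.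
have [ub|ub] := leP u b.
  have := radial_profile1_ge Pf (_ : 1 <= u <= b).
  by rewrite (ltW u1) ub => /(_ isT) H; apply/orP; left; lra.
have := radial_profile1_ge Pf (_ : 1 <= b <= b).
rewrite b1 lexx => /(_ isT); rewrite sqrtr_sqr ger0_norm// => H.
have := radial_profile_ndecr Pf (ltW ub) => H2.
by apply/orP; right; lra.
Qed.

Lemma supported_moment (p : probability V R) (a a' : V) (A : R) : 0 <= A ->
  (\forall x \ae p, `|x - a| <= A) ->
  p.-integrable setT (EFin \o (fun x : V => `|x - a'|)) /\
  moment p a' <= A + `|a - a'|.
Proof.
move=> A0 pA; have H : \forall x \ae p, `|x - a'| <= A + `|a - a'|.
  apply: ae_mono pA => x xA.
  by rewrite (le_trans (ler_distD a x a'))// lerD2r.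
have i : p.-integrable setT (EFin \o (fun x : V => `|x - a'|)).
  apply: (integrable_ae_bounded (b := A + `|a - a'|)) => //; first exact: measurable_dist.
  by rewrite addr_ge0.
by split=> //; exact: Rintegral_le_ae.
Qed.

Lemma supported_of_compact (p : probability V R) : compactly_supported p ->
  exists2 A, 0 < A & \forall x \ae p, `|x - 0| <= A.
Proof.
move=> [K cK pK]; have [A A0 KA] := compact_norm_le cK; exists A => //.
exists (~` K); split.
- apply: measurableC; rewrite -(setCK K); apply: measurableC; apply: open_measurable_mx.
  by apply: closed_openC; apply: compact_closed => //; exact: norm_hausdorff.
- exact: pK.
- by move=> x /= xA Kx; apply: xA; rewrite subr0; exact: KA.
Qed.

Lemma supported_of_density (p : probability V R) (theta : V -> R) (a : V) A :
  is_density p (fun x => theta (x - a)) -> (forall x, theta x != 0 -> `|x| <= A) ->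
  \forall x \ae p, `|x - a| <= A.
Proof.
move=> [mt t0 pE] tA.
have mE : measurable [set x : V | A < `|x - a|].
  rewrite -[X in measurable X]setTI.
  have := @measurable_fun_ltr _ _ _ setT (cst A) (fun x : V => `|x - a|)
    (@measurable_cst _ _ _ _ _ _) (measurable_dist a) measurableT [set true].
  by apply.
exists [set x | A < `|x - a|]; split=> //; last by move=> x /= /negP; rewrite -ltNge.
rewrite pE// (eq_integral (cst 0%E)) ?integral0// => x /[!inE]/= Ax.
congr EFin; apply/eqP; apply: contraTT Ax => /tA; rewrite -leNgt//.
Qed.

Lemma regular_of_density (p : probability V R) (theta : V -> R) (a : V) B :
  is_density p (fun x => theta (x - a)) -> (forall x, `|theta x| <= B) ->
  ball_regular p (Num.max B 0 * 2 ^+ d.+1).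
Proof.
move=> pd tB; apply: Linfty_le_regular; exists (fun x => theta (x - a)) => //.
rewrite unlock; case: ifPn => _.
  by apply/ess_supP; apply: nearW => x; rewrite /= lee_fin.
by rewrite lee_fin (le_trans _ (tB 0)).
Qed.

End moments.

(** * Confinement and the far field *)

Section confinement.
Context {R : realType} {d : nat}.
Notation V := 'rV[R]_d.+1.

Definition confinement (A K t : R) : R :=
  d.+1%:R * A + @growth_rate R d * t + 2 * @potential_bound R d K + 1.

(** The bound is uniform in the centre a: the datum only enters through its
    radius A and the bound K on its density. *)
Lemma weak_solution_confined (S dS : R -> R) (mu rho0 : probability V R)
  (rho : R -> probability V R) (a : V) (A K t : R) :
  smooth_step S dS -> weak_solution mu rho0 rho ->
  ball_regular mu K -> ball_regular rho0 K -> 0 <= K ->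
  (\forall x \ae rho0, `|x - a| <= A) -> 0 < t ->
  (rho t).-integrable setT (EFin \o (fun x : V => `|x - a|)) /\
  moment (rho t) a <= confinement A K t.
Proof.
move=> SdS Hrho muK rho0K K0 rho0A t0.
apply: (moment_of_profiles SdS) => b P f Pf.
have [Cphi phiB dphi phile] := profile_around a Pf.
have := moment_bound SdS Hrho muK rho0K K0 (ltW t0) Cphi phiB dphi.
rewrite /restart (leNgt t) t0/= => /le_trans; apply; rewrite !lerD2r.
apply: Rintegral_le_ae.
  by apply: (@bounded_integrable _ _ _ _ _ _ _ phiB); exact: smooth_measurable.
apply: ae_mono rho0A => x xA; have /andP[_ /le_trans] := phile x; apply.
by rewrite ler_wpM2l.
Qed.

Lemma confinement_le A K t t' : t <= t' -> confinement A K t <= confinement A K t'.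
Proof.
by move=> tt'; rewrite !lerD2r lerD2l ler_wpM2l// growth_rate_ge0.
Qed.

Lemma confinement_ge0 A K t : 0 <= A -> 0 <= K -> 0 <= t -> 0 <= confinement A K t.
Proof.
move=> A0 K0 t0; have c0 := @force_cst_gt0 R d.
have g0 := @growth_rate_ge0 R d.
by rewrite !(addr_ge0, mulr_ge0, exprn_ge0)// ltW.
Qed.

End confinement.

Section far.
Context {R : realType} {d : nat}.
Notation V := 'rV[R]_d.+1.
Notation g := (@coulomb R d.+1).
Variables (C A l Gam kap Km Kr : R) (a : V) (r mu : probability V R).
Hypotheses (C0 : 0 <= C) (g_ub : forall z : V, g z <= C * (1 + singular 1 z))
  (g_lb : forall z : V, - (C * (1 + `|z|)) <= g z).
Hypotheses (muA : \forall x \ae mu, `|x - 0| <= A) (A0 : 0 < A).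
Hypotheses (al : `|a| = l) (Al : 4 * A <= l).
Hypotheses (muK : tame mu a Km) (rK : tame r a Kr) (rkap : moment r a <= kap).
Hypothesis g_far : forall z : V, l / 4 <= `|z| -> g z <= Gam.

(** Most of a measure confined around a is far from the support of mu, and by
    the Markov inequality the rest contributes little. *)
Lemma interaction_far :
  interaction r mu <= Gam + (C * (1 + 2 ^+ d.+1 * Km) + `|Gam|) * (2 / l * kap).
Proof.
have l0 : 0 < l by apply: lt_le_trans Al; rewrite mulr_gt0.
have [mur Km0 _] := muK; have [_ _ ir] := rK.
set C3 := C * _.
have C30 : 0 <= C3 by rewrite mulr_ge0// addr_ge0// mulr_ge0// exprn_ge0.
have CG0 : 0 <= C3 + `|Gam| by rewrite addr_ge0.
have near x : `|x - a| <= l / 2 -> convol mu g x <= Gam.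
  move=> xa; apply: Rintegral_le_ae.
    exact: (coulomb_integrable C0 g_ub g_lb muK).
  apply: ae_mono muA => y; rewrite subr0 => yA; apply: g_far.
  have : `|a| <= `|x - y| + (`|y| + `|x - a|).
    rewrite -[X in `|X| <= _](_ : (x - y) + (y - (x - a)) = a).
      by rewrite (le_trans (ler_normD _ _))// lerD2l ler_normB.
    by rewrite addrA subrK opprB addrC subrK.
  by rewrite al; have := Al; lra.
have pt x : convol mu g x <= Gam + (C3 + `|Gam|) * (2 / l) * `|x - a|.
  have [xa|xa] := leP `|x - a| (l / 2).
    apply: (le_trans (near x xa)); rewrite lerDl mulr_ge0// mulr_ge0// divr_ge0//.
    exact: ltW.
  apply: (le_trans (convol_coulomb_ub C0 g_ub g_lb muK x)); rewrite -/C3.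
  have x1 : 1 <= 2 / l * `|x - a|.
    by rewrite mulrAC ler_pdivlMr// mul1r; lra.
  have := ler_wpM2l CG0 x1; rewrite mulr1 mulrA.
  have := ler_norm (- Gam); rewrite normrN; lra.
have i1 := integrable_mulr ((C3 + `|Gam|) * (2 / l)) ir.
have i2 := integrable_addr (integrable_cstr r Gam) i1.
apply: (@le_trans _ _ (\int[r]_x (Gam + (C3 + `|Gam|) * (2 / l) * `|x - a|))).
  apply: le_Rintegral => //; exact: (convol_coulomb_integrable C0 g_ub g_lb rK muK).
rewrite (RintegralD measurableT (integrable_cstr r Gam) i1) Rintegral_cst1.
rewrite (RintegralZl _ measurableT ir) lerD2l [leRHS]mulrA ler_wpM2l//.
by rewrite mulr_ge0// divr_ge0// ltW.
Qed.

End far.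

(** * The gap *)

(** Whatever the level kap of confinement, there is a datum so distant that every
    measure confined near its centre a retains a fraction k0 of its discrepancy. *)
Definition has_relative_gap (R : realType) d (mu : probability 'rV[R]_d.+1 R)
    (rho0 : 'rV[R]_d.+1 -> probability 'rV[R]_d.+1 R) (k0 : R) : Prop :=
  forall kap, 0 <= kap -> exists (a : 'rV[R]_d.+1) (U : R),
    [/\ 0 < U, (MMD2 (rho0 a) mu <= U%:E)%E &
      forall (r : probability 'rV[R]_d.+1 R) Kr, tame r a Kr -> moment r a <= kap ->
        ((k0 * U)%:E < MMD2 r mu)%E].

Section gap.
Context {R : realType} {d : nat}.
Notation V := 'rV[R]_d.+1.
Notation g := (@coulomb R d.+1).
Variables (C A K : R) (mu : probability V R) (rho0 : V -> probability V R).
Hypotheses (C0 : 0 <= C) (g_ub : forall z : V, g z <= C * (1 + singular 1 z))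
  (g_lb : forall z : V, - (C * (1 + `|z|)) <= g z).
Hypotheses (A0 : 0 < A) (K0 : 0 <= K).
Hypotheses (muA : \forall x \ae mu, `|x - 0| <= A) (muK : ball_regular mu K).
Hypotheses (rhoA : forall a, \forall x \ae rho0 a, `|x - a| <= A)
  (rhoK : forall a, ball_regular (rho0 a) K).

Definition self_energy_bound : R := C * (1 + 2 ^+ d.+1 * K).
Notation D := self_energy_bound.

Lemma self_energy_bound_ge0 : 0 <= D.
Proof. by rewrite mulr_ge0// addr_ge0// mulr_ge0// exprn_ge0. Qed.

Lemma mu_tame a : tame mu a K /\ moment mu a <= A + `|a|.
Proof.
have [i le] := supported_moment a (ltW A0) muA; split; first by split.
by rewrite sub0r normrN in le.
Qed.

Lemma rho0_tame a : tame (rho0 a) a K /\ moment (rho0 a) a <= A.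
Proof.
have [i le] := supported_moment a (ltW A0) (rhoA a); split; first by split.
by rewrite subrr normr0 addr0 in le.
Qed.

Lemma MMD2_initial_le a al be : 0 <= be ->
  (forall z : V, - (al + be * `|z|) <= g z) ->
  (MMD2 (rho0 a) mu <= (D + (al + be * (2 * A + `|a|)))%:E)%E.
Proof.
move=> be0 gl; have [mt mm] := mu_tame a; have [rt rm] := rho0_tame a.
rewrite (MMD2E C0 g_ub g_lb rt mt) lee_fin.
have := interaction_ub C0 g_ub g_lb rt rt; have := interaction_ub C0 g_ub g_lb mt mt.
rewrite -/D => mub rub.
have := interaction_lb C0 g_ub g_lb rt mt be0 gl.
have : be * (moment (rho0 a) a + moment mu a) <= be * (2 * A + `|a|).
  by rewrite ler_wpM2l//; lra.
lra.
Qed.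

Lemma const_mx_norm (l : R) : 0 <= l -> `|const_mx l : V| = l.
Proof.
move=> l0; apply/eqP; rewrite eq_le norm_le_coord//=; last first.
  by move=> i; rewrite mxE ger0_norm.
by have := coord_norm_le (const_mx l : V) 0; rewrite mxE (ger0_norm l0).
Qed.

(** At a large distance l between the datum and mu, the kernel between them is
    at least - (al + be * l) up to a constant, and at most Gam; its opposite is
    the variable part of the discrepancy. So the datum has discrepancy at most U,
    and a confined measure at least L - Gam up to the error of the far field. *)
Lemma gap_of_bounds (k0 : R) : (forall kap, 0 <= kap -> exists l al be Gam L U : R,
   [/\ 4 * A <= l /\ 0 <= be, forall z : V, - (al + be * `|z|) <= g z,
       forall z : V, l / 4 <= `|z| -> g z <= Gam,
       forall a (r : probability V R) Kr, tame r a Kr -> moment r a <= kap ->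
         L <= 2^-1 * (interaction r r + interaction mu mu) &
       [/\ 0 < U, D + (al + be * (2 * A + l)) <= U &
           k0 * U + Gam + (D + `|Gam|) * (2 / l * kap) < L]]) ->
  has_relative_gap mu rho0 k0.
Proof.
move=> H kap /H[l [al [be [Gam [L [U]]]]]] [[Al be0] gl gf Lle [U0 DU kU]].
have l0 : 0 < l by apply: lt_le_trans Al; rewrite mulr_gt0.
have nl := const_mx_norm (ltW l0).
exists (const_mx l), U; split=> //.
  by apply: (le_trans (MMD2_initial_le _ be0 gl)); rewrite nl lee_fin.
move=> r Kr rt rk; have [mt _] := mu_tame (const_mx l).
rewrite (MMD2E C0 g_ub g_lb rt mt) lte_fin.
have := interaction_far C0 g_ub g_lb muA A0 nl Al mt rt rk gf; rewrite -/D.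
have := Lle _ _ _ rt rk; lra.
Qed.

Lemma self_energy_ge kap a (r : probability V R) Kr : tame r a Kr -> moment r a <= kap ->
  - (C * (1 + kap + A)) <= 2^-1 * (interaction r r + interaction mu mu).
Proof.
move=> rt rk; have [mt mm] := mu_tame 0; rewrite normr0 addr0 in mm.
have gl' z : - (C + C * `|z|) <= g z by rewrite -{1}[C]mulr1 -mulrDr.
have := interaction_lb C0 g_ub g_lb rt rt C0 gl'.
have := interaction_lb C0 g_ub g_lb mt mt C0 gl'.
have := ler_wpM2l C0 rk; have := ler_wpM2l C0 mm.
lra.
Qed.

End gap.

Section gap_by_dimension.
Context {R : realType}.

(** Both discrepancies are of order l: the initial one is at most l / 2 up to a
    constant, and the kernel is at most - l / 8 at distance l / 4. *)
Lemma relative_gap_dim1 (A K : R) (mu : probability 'rV[R]_1 R)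
    (rho0 : 'rV[R]_1 -> probability 'rV[R]_1 R) :
  0 < A -> 0 <= K -> (\forall x \ae mu, `|x - 0| <= A) -> ball_regular mu K ->
  (forall a, \forall x \ae rho0 a, `|x - a| <= A) ->
  (forall a, ball_regular (rho0 a) K) ->
  has_relative_gap mu rho0 8^-1.
Proof.
move=> A0 K0 muA muK rhoA rhoK.
have [C C0 [g_ub g_lb]] := @coulomb_bounds R 0.
have D0 := @self_energy_bound_ge0 R 0 C K C0 K0; set D := self_energy_bound _ _ in D0.
have gE (z : 'rV[R]_1) : coulomb z = - (enorm z / 2) by [].
apply: (gap_of_bounds C0 g_ub g_lb A0 K0 muA muK rhoA rhoK) => kap kap0.
pose L := - (C * (1 + kap + A)).
have L0 : L <= 0 by rewrite oppr_le0 mulr_ge0// !addr_ge0// ltW.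
have Dk0 : 0 <= D * kap by exact: mulr_ge0.
(* The choice k0 = 1 / 8 leaves - l / 16, to exceed the other terms. *)
pose l := 16 * (D / 8 + A / 8 + 2 * (D * kap) + kap / 4 - L) + 4 * A + 1.
have l1 : 1 <= l by rewrite /l; lra.
have l0 : 0 < l by lra.
exists l, 0, 2^-1, (- (l / 8)), L, (D + A + l / 2); split.
- by split; [rewrite /l; lra|rewrite invr_ge0].
- move=> z; rewrite gE add0r lerN2 mulrC ler_pM2l ?invr_gt0//.
  by have := enorm_le_norm z; rewrite mul1r.
- by move=> z lz; rewrite gE; have := norm_le_enorm z; lra.
- move=> a r Kr rt rk; exact: (self_energy_ge C0 g_ub g_lb A0 K0 muA muK rt rk).
split; [lra|rewrite -/D; lra|].
rewrite normrN ger0_norm; last by rewrite divr_ge0// ltW.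
have -> : (D + l / 8) * (2 / l * kap) = 2 * (D * kap) * l^-1 + kap / 4.
  by field; rewrite gt_eqF.
have : 2 * (D * kap) * l^-1 <= 2 * (D * kap) * 1.
  by apply: ler_wpM2l; [exact: mulr_ge0|rewrite invf_le1].
have : 16 * (D / 8 + A / 8 + 2 * (D * kap) + kap / 4 - L) < l by rewrite /l; lra.
lra.
Qed.

(** Up to constants the initial discrepancy is at most (2 pi)^-1 ln l and that of
    a confined measure at least as much, since the distances differ by bounded
    factors; so any k0 < 1 would do. The affine minorant of the kernel comes from
    ln (u / l) <= u / l. *)
Lemma relative_gap_dim2 (A K : R) (mu : probability 'rV[R]_2 R)
    (rho0 : 'rV[R]_2 -> probability 'rV[R]_2 R) :
  0 < A -> 0 <= K -> (\forall x \ae mu, `|x - 0| <= A) -> ball_regular mu K ->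
  (forall a, \forall x \ae rho0 a, `|x - a| <= A) ->
  (forall a, ball_regular (rho0 a) K) ->
  has_relative_gap mu rho0 2^-1.
Proof.
move=> A0 K0 muA muK rhoA rhoK.
have [C C0 [g_ub g_lb]] := @coulomb_bounds R 1.
have D0 := @self_energy_bound_ge0 R 1 C K C0 K0; set D := self_energy_bound _ _ in D0.
have gE (z : 'rV[R]_2) : coulomb z = - ((2 * pi)^-1 * ln (enorm z)) by [].
have : 0 < (2 * pi)^-1 :> R by rewrite invr_gt0 mulr_gt0// pi_gt0.
move: gE; move: ((2 * pi)^-1) => b gE b0.
apply: (gap_of_bounds C0 g_ub g_lb A0 K0 muA muK rhoA rhoK) => kap kap0.
pose L := - (C * (1 + kap + A)).
have L0 : L <= 0 by rewrite oppr_le0 mulr_ge0// !addr_ge0// ltW.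
have ln40 : 0 <= ln 4 :> R by rewrite ln_ge0// ler1n.
(* The terms to be exceeded by (b / 2) ln l are gathered in Y. *)
pose Y := b * ln 4 + D / 2 + 3 * b / 2 + 2 * (D + b) * kap - L.
have Y0 : 0 <= Y.
  have : 0 <= b * ln 4 by exact: mulr_ge0 (ltW b0) ln40.
  have : 0 <= (D + b) * kap by rewrite mulr_ge0// addr_ge0// ltW.
  rewrite /Y; lra.
pose X := 4 * A + 4 + 2 * Y / b.
have X0 : 0 <= 2 * Y / b by rewrite divr_ge0 ?mulr_ge0// ltW.
have Xl : X < expR X.
  by have := expR_ge1Dx X; lra.
set l := expR X in Xl.
have lnl : ln l = X by rewrite expRK.
have l4 : 4 < l by move: Xl; rewrite /X; lra.
have l0 : 0 < l by lra.
have l4A : 4 * A < l by move: Xl; rewrite /X; lra.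
exists l, (b * ln l), (2 * b / l), (- (b * ln (l / 4))), L, (D + b * X + 3 * b); split.
- by split; [exact: ltW|rewrite divr_ge0 ?mulr_ge0// ltW].
- move=> z; rewrite gE lerN2 (_ : b * _ + _ = b * (ln l + 2 * `|z| / l)); last by ring.
  rewrite ler_pM2l//.
  have [->|z0] := eqVneq z 0.
    rewrite enorm0.
    by rewrite ln0// lnl normr0 mulr0 mul0r addr0 /X; lra.
  have e0 : 0 < enorm z by rewrite enorm_gt0.
  have u0 : 0 < enorm z / l by rewrite divr_gt0.
  have -> : ln (enorm z) = ln l + ln (enorm z / l).
    by rewrite -lnM ?posrE// mulrC divfK ?gt_eqF.
  rewrite lerD2l (le_trans (ltW (ln_sublinear u0)))// ler_pM2r ?invr_gt0//.
  exact: enorm_le_norm.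
- move=> z lz; rewrite gE lerN2 ler_pM2l//.
  have l40 : 0 < l / 4 by rewrite divr_gt0.
  have := le_trans lz (norm_le_enorm z) => le.
  by rewrite ler_ln// posrE// (lt_le_trans l40).
- move=> a r Kr rt rk; exact: (self_energy_ge C0 g_ub g_lb A0 K0 muA muK rt rk).
have bX0 : 0 <= b * X.
  by rewrite mulr_ge0 ?(ltW b0)// /X !addr_ge0// ltW// mulr_gt0.
rewrite -/D lnl; split; first lra.
- have -> : 2 * b / l * (2 * A + l) = 4 * A / l * b + 2 * b.
    by field; rewrite gt_eqF.
  have : 4 * A / l * b <= 1 * b.
    by rewrite ler_pM2r// ler_pdivrMr// mul1r ltW.
  lra.
rewrite ln_div ?posrE// lnl normrN.
have X4 : ln 4 <= X.
  apply: (@le_trans _ _ 4); first by apply/ltW; exact: ln_sublinear.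
  by rewrite /X; lra.
rewrite ger0_norm; last by rewrite mulr_ge0 ?(ltW b0)// subr_ge0.
have : (D + b * (X - ln 4)) * (2 / l * kap) <= (D + b) * l * (2 / l * kap).
  rewrite ler_wpM2r//; first by rewrite mulr_ge0// divr_ge0// ltW.
  have : b * (X - ln 4) <= b * l by rewrite ler_pM2l//; lra.
  have : D * 1 <= D * l by rewrite ler_wpM2l//; lra.
  lra.
rewrite (_ : (D + b) * l * _ = 2 * (D + b) * kap); last by field; rewrite gt_eqF.
have bX : b * X = b * (4 * A + 4) + 2 * Y.
  by rewrite /X; field; rewrite gt_eqF.
have : 0 < b * (4 * A + 4) by rewrite mulr_gt0// addr_gt0// mulr_gt0.
have : Y = b * ln 4 + D / 2 + 3 * b / 2 + 2 * (D + b) * kap - L by [].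
lra.
Qed.

(** The kernel is nonnegative and tends to 0 at infinity, so that the initial
    discrepancy is bounded, while a confined distant measure has almost no
    interaction with mu and leaves at least half of the self energy of mu. This
    self energy is positive as the kernel has a positive lower bound at the
    distances that occur in the support. *)
Lemma relative_gap_dim3 d (A K : R) (mu : probability 'rV[R]_d.+3 R)
    (rho0 : 'rV[R]_d.+3 -> probability 'rV[R]_d.+3 R) :
  0 < A -> 0 <= K -> (\forall x \ae mu, `|x - 0| <= A) -> ball_regular mu K ->
  (forall a, \forall x \ae rho0 a, `|x - a| <= A) ->
  (forall a, ball_regular (rho0 a) K) ->
  exists2 k0 : R, 0 < k0 & has_relative_gap mu rho0 k0.
Proof.
move=> A0 K0 muA muK rhoA rhoK.
have [C C0 [g_ub g_lb]] := @coulomb_bounds R d.+2.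
have D0 := @self_energy_bound_ge0 R d.+2 C K C0 K0; set D := self_energy_bound _ _ in D0.
pose b : R := ((d.+1)%:R * sphere_area d.+3)^-1.
have b0 : 0 < b by rewrite invr_gt0 mulr_gt0 ?ltr0n// sphere_area_gt0.
have gE (z : 'rV[R]_d.+3) : coulomb z = b * enorm z ^- d.+1 by [].
have g0 (z : 'rV[R]_d.+3) : 0 <= coulomb z.
  by rewrite gE mulr_ge0 ?(ltW b0)// invr_ge0 exprn_ge0 ?enorm_ge0.
pose e := b * (d.+3%:R * (2 * A)) ^- d.+1.
have dA0 : 0 < d.+3%:R * (2 * A) by rewrite !mulr_gt0.
have e0 : 0 < e by rewrite mulr_gt0// invr_gt0 exprn_gt0.
have [mt _] := mu_tame A0 K0 muA muK 0.
have mue : e <= interaction mu mu.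
  apply: Rintegral_ge_ae; first exact: (convol_coulomb_integrable C0 g_ub g_lb mt mt).
  apply: ae_mono (muA) => x; rewrite subr0 => xA.
  apply: Rintegral_ge_ae; first exact: (coulomb_integrable C0 g_ub g_lb mt).
  have yx : \forall y \ae mu, y <> x.
    exists [set x]; split; [exact: measurable_point|exact: (regular_point muK K0)|].
    by move=> y /= /contrapT.
  apply: ae_mono (ae_and muA yx) => y; rewrite subr0 => -[yA /eqP]; rewrite eq_sym => xy.
  have z0 : 0 < enorm (x - y) by rewrite enorm_gt0 subr_eq0.
  rewrite gE ler_pM2l// lef_pV2 ?posrE ?exprn_gt0// lerXn2r ?nnegrE ?(ltW z0) ?(ltW dA0)//.
  rewrite (le_trans (enorm_le_norm _))// ler_pM2l//.
  by rewrite (le_trans (ler_normB _ _))//; lra.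
exists (e / (4 * (D + 1))); first by rewrite divr_gt0// mulr_gt0// ltr_wpDl.
apply: (gap_of_bounds C0 g_ub g_lb A0 K0 muA muK rhoA rhoK) => kap kap0.
(* The terms that vanish as l grows are at most Y / l. *)
pose Y := 4 * b + (D + 4 * b) * (2 * kap).
have Y0 : 0 <= Y.
  have : 0 <= (D + 4 * b) * (2 * kap) by apply: mulr_ge0; lra.
  rewrite /Y; lra.
pose l := 4 * A + 4 + 4 * Y / e.
have Ye : 0 <= 4 * Y / e by apply: divr_ge0 (ltW e0); apply: mulr_ge0.
have l4 : 4 <= l by rewrite /l; lra.
have l0 : 0 < l by lra.
exists l, 0, 0, (4 * b / l), (e / 2), (D + 1); split.
- by split=> //; rewrite /l; lra.
- by move=> z; rewrite mul0r addr0 oppr0.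
- move=> z lz; rewrite gE.
  have l40 : 0 < l / 4 by rewrite divr_gt0.
  have le := le_trans lz (norm_le_enorm z).
  have -> : 4 * b / l = b * (l / 4)^-1 by field; rewrite gt_eqF.
  have z0 : 0 < enorm z by exact: lt_le_trans le.
  rewrite ler_pM2l// lef_pV2 ?posrE ?exprn_gt0//.
  apply: (le_trans le); rewrite exprS ler_peMr ?(ltW z0)// exprn_ege1//.
  by apply: le_trans le; rewrite ler_pdivlMr//; lra.
- move=> a r Kr rt rk.
  have : 0 <= interaction r r.
    by apply: Rintegral_ge0 => x _; apply: Rintegral_ge0 => y _.
  by lra.
rewrite mul0r !addr0 -/D; split; [lra|lra|].
rewrite ger0_norm; last by rewrite divr_ge0 ?mulr_ge0// ltW.
have -> : e / (4 * (D + 1)) * (D + 1) = e / 4 by field; rewrite gt_eqF// ltr_wpDl.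
have : (D + 4 * b / l) * (2 / l * kap) <= (D + 4 * b) * (2 * kap) / l.
  have -> : (D + 4 * b) * (2 * kap) / l = (D + 4 * b) * (2 / l * kap).
    by field; rewrite gt_eqF.
  rewrite ler_wpM2r//; first by rewrite mulr_ge0// divr_ge0// ltW.
  rewrite lerD2l ler_pdivrMr// ler_peMr// ?mulr_ge0 ?(ltW b0)//; lra.
have : Y / l < e / 4.
  rewrite ltr_pdivrMr//.
  have -> : e / 4 * l = e * (A + 1) + Y.
    by rewrite /l; field; rewrite gt_eqF.
  by rewrite ltrDr mulr_gt0// ltr_wpDr// ltW.
have -> : Y / l = 4 * b / l + (D + 4 * b) * (2 * kap) / l by rewrite -mulrDl.
lra.
Qed.

Lemma relative_gap d (A K : R) (mu : probability 'rV[R]_d.+1 R)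
    (rho0 : 'rV[R]_d.+1 -> probability 'rV[R]_d.+1 R) :
  0 < A -> 0 <= K -> (\forall x \ae mu, `|x - 0| <= A) -> ball_regular mu K ->
  (forall a, \forall x \ae rho0 a, `|x - a| <= A) ->
  (forall a, ball_regular (rho0 a) K) ->
  exists2 k0 : R, 0 < k0 & has_relative_gap mu rho0 k0.
Proof.
case: d mu rho0 => [|[|d]] mu rho0 A0 K0 muA muK rhoA rhoK.
- by exists 8^-1; [rewrite invr_gt0|exact: (relative_gap_dim1 A0 K0)].
- by exists 2^-1; [rewrite invr_gt0|exact: (relative_gap_dim2 A0 K0)].
- exact: (relative_gap_dim3 A0 K0).
Qed.

End gap_by_dimension.

(** * Absence of a uniform decay rate *)

Lemma ae_pick (R : realType) (P : R -> Prop) (a b : R) : a < b ->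
  (\forall t \ae (@lebesgue_measure R), P t) -> exists t, a < t < b /\ P t.
Proof.
move=> ab [N [mN N0 PN]]; apply: contrapT => /forallNP nP.
have : (lebesgue_measure `]a, b[%classic <= @lebesgue_measure R N)%E.
  apply: le_measure; rewrite ?inE// => t; rewrite /= in_itv/= => tab.
  by apply: PN => Pt; exact: (nP t).
rewrite N0 lebesgue_measure_itv/= lte_fin ab -EFinB lee_fin.
by rewrite leNgt subr_gt0 ab.
Qed.

Theorem corollary1p17 (R : realType) (d : nat) (hd : (1 <= d)%N)
  (mu : probability 'rV[R]_d R)
  (hmuoo : exists M : R, Linfty_le mu M)
  (hmuc : compactly_supported mu)
  (theta : 'rV[R]_d -> R)
  (htheta_smooth : smooth theta)
  (htheta_supp : compact (tsupport theta))
  (htheta_ge0 : forall x, 0 <= theta x)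
  (htheta_int : (\int[lebesgue_rV d]_x (theta x)%:E = 1)%E)
  (rho0 : 'rV[R]_d -> probability 'rV[R]_d R)
  (hrho0 : forall a, is_density (rho0 a) (fun x => theta (x - a)))
  (rho : 'rV[R]_d -> R -> probability 'rV[R]_d R)
  (hrho : forall a, weak_solution mu (rho0 a) (rho a)) :
  ~ exists gamma : R -> R,
      [/\ forall t, 0 <= t -> 0 < gamma t,
          gamma t @[t --> +oo] --> 0 &
          forall (a : 'rV[R]_d) (t : R), 0 <= t ->
            (MMD2 (rho a t) mu <= (gamma t)%:E * MMD2 (rho0 a) mu)%E].
Proof.
move=> [gamma [gamma0 gammaoo decay]].
case: d hd mu hmuoo hmuc theta htheta_smooth htheta_supp htheta_ge0 htheta_int
  rho0 hrho0 rho hrho decay => // d _ mu [M muM] muc theta Ct ct t0 t1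
  rho0 rho0E rho Hrho decay.
have [S [dS SdS]] := smooth_step_exists Ct ct t0 t1.
have [A1 A10 muA1] := supported_of_compact muc.
have [A2 A20 tA2] := compact_norm_le ct.
have [B B0 tB] := compact_smooth_bounded (conj Ct ct).
pose A := Num.max A1 A2.
have A0 : 0 < A by rewrite lt_max A10.
pose K := Num.max (Num.max M 0 * 2 ^+ d.+1) (Num.max B 0 * 2 ^+ d.+1).
have K0 : 0 <= K by rewrite le_max mulr_ge0 ?exprn_ge0// le_max lexx orbT.
have muA : \forall x \ae mu, `|x - 0| <= A.
  by apply: ae_mono muA1 => x xA; rewrite le_max xA.
have muK : ball_regular mu K.
  by apply: (ball_regular_le (Linfty_le_regular muM)); rewrite le_max lexx.
have rhoA a : \forall x \ae rho0 a, `|x - a| <= A.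
  apply: (supported_of_density (rho0E a)) => x x0; rewrite le_max tA2 ?orbT//.
  exact: subset_closure.
have rhoK a : ball_regular (rho0 a) K.
  by apply: (ball_regular_le (regular_of_density (rho0E a) tB)); rewrite le_max lexx orbT.
have [k0 k00 gap] := relative_gap A0 K0 muA muK rhoA rhoK.
have [T T0 gammaT] : exists2 T, 0 <= T & forall t, T < t -> gamma t <= k0.
  have := cvgr_le _ gammaoo _ k00.
  move=> [T [_ gT]]; exists (Num.max T 0); first by rewrite le_max lexx orbT.
  by move=> t; rewrite gt_max => /andP[Tt _]; exact: gT.
have T10 : 0 <= T + 1 by rewrite addr_ge0.
have [a [U [U0 MU gU]]] := gap _ (@confinement_ge0 R d _ _ _ (ltW A0) K0 T10).
(* The density is bounded at almost every time only, hence the choice of t. *)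
have T20 : 0 < T + 2 by rewrite ltr_wpDl.
have [_ /(_ _ T20)[M' rhoM'] _] := Hrho a.
have TT : T < T + 1 by rewrite ltrDl.
have [t [/andP[Tt tT] tM']] := ae_pick TT rhoM'.
have tpos : 0 < t by exact: le_lt_trans Tt.
have [ri rk] := weak_solution_confined SdS (Hrho a) muK (rhoK a) K0 (rhoA a) tpos.
have /Linfty_le_regular rK : Linfty_le (rho a t) M'.
  by apply: tM'; rewrite (ltW tpos)/=; lra.
have rt : tame (rho a t) a (Num.max M' 0 * 2 ^+ d.+1).
  by split=> //; rewrite mulr_ge0 ?exprn_ge0// le_max lexx orbT.
have := gU _ _ rt (le_trans rk (confinement_le A K (ltW tT))).
apply/negP; rewrite -leNgt (le_trans (decay a t (ltW tpos)))//.
apply: (@le_trans _ _ ((gamma t)%:E * U%:E)%E).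
  by rewrite lee_wpmul2l// lee_fin ltW// gamma0// ltW.
by rewrite -EFinM lee_fin ler_pM2r// gammaT.
Qed.
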